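(* Let $\Omega\subset\mathbb{R}^d$ be a bounded open set, and let $\phi_n\in C^\infty(\Omega;\mathbb{R})$ and $h_n>0$, $h_n\to0$, be such that $-h_n^2\Delta\phi_n=\phi_n$ in $\Omega$, $\phi_n|_{\partial\Omega}=0$ and $\|\phi_n\|_{L^2(\Omega)}^2=\mathrm{Vol}(\Omega)$. Let $U\subset\Omega$ be a Borel set of positive Lebesgue measure, $k\in\mathbb{N}$, $\iota_k$ an extension map, and let $\nu\in\sigma^{\iota_k}_{k,U}((\phi_n)_n)$. Then $\nu\in\mathcal{M}$, and $\nu$ is independent of $k$ and $\iota_k$. In other words: if $F\in\mathcal{C}_b(FP)$, $k_1,k_2\in\mathbb{N}$, and $\iota_{k_1},\iota_{k_2}$ are extension maps, then $\langle LM^{\iota_{k_1}}_{k_1,U}(\phi_n),F\rangle$ converges as $n\to\infty$ if and only if $\langle LM^{\iota_{k_2}}_{k_2,U}(\phi_n),F\rangle$ converges, and in that case their limits are equal.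
   Context: $FP:=\{f\in C^\infty(\mathbb{R}^d;\mathbb{R}): -\Delta f=f\}$. For $k\in\mathbb{N}=\{0,1,2,\dots\}$, $\mathcal{H}^k$ is the space $C^k(\mathbb{R}^d)$ of real-valued functions with the metric $\boldsymbol{d}_k(f,g)=\inf\{\varepsilon>0:\|f-g\|_{C^k(B(0,\varepsilon^{-1}))}<\varepsilon\}$; it is a Polish space. $FP$ is closed in every $\mathcal{H}^k$, and all metrics $\boldsymbol{d}_k$ induce the same topology on $FP$, which is the topology used on $FP$. $\mathcal{C}_b(X)$ is the space of bounded real-valued continuous functions on $X$ with the sup norm. $\mathcal{M}$ is the space of finite signed Borel measures on $FP$, viewed as a subset of $(\mathcal{C}_b(FP))^*$. The condition $\phi_n|_{\partial\Omega}=0$ is the Dirichlet condition ($\phi_n$ is an eigenfunction of the Dirichlet Laplacian of $\Omega$, in $H^1_0(\Omega)$). Fix a decreasing function $\chi\in C_c^\infty([0,\infty);[0,1])$ equal to $1$ near the origin and vanishing outside $[0,1]$. For $x_0\in\Omega$ set $\tilde\phi_{x_0,n}(y):=\phi_n(x_0+h_ny)\,\chi\big(\frac{h_n|y|}{d(x_0,\partial\Omega)}\big)$, $y\in\mathbb{R}^d$ (understood as $0$ where the cutoff vanishes). Define $LM_{k,U}(\phi_n):=\frac1{\mathrm{Vol}(U)}\int_U\delta_{\tilde\phi_{x_0,n}}\,dx_0$, a Borel probability measure on $\mathcal{H}^k$. An extension map is a continuous linear map $\iota_k:\mathcal{C}_b(FP)\to\mathcal{C}_b(\mathcal{H}^k)$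 with $(\iota_kF)|_{FP}=F$ and $\|\iota_kF\|=\|F\|$ for all $F$. $LM^{\iota_k}_{k,U}(\phi_n)\in(\mathcal{C}_b(FP))^*$ is $F\mapsto\langle LM_{k,U}(\phi_n),\iota_kF\rangle$, and $\sigma^{\iota_k}_{k,U}((\phi_n)_n)$ is the set of accumulation points of $(LM^{\iota_k}_{k,U}(\phi_n))_n$ for the weak-* topology of $(\mathcal{C}_b(FP))^*$. *)

(* Defs.v *)
From HB Require Import structures.
From mathcomp Require Import all_boot all_order all_algebra.
From mathcomp Require Import all_classical all_reals all_analysis.
From mathcomp Require Import ring lra.
Set Implicit Arguments. Unset Strict Implicit. Unset Printing Implicit Defensive.
Import Order.TTheory GRing.Theory Num.Theory.
Import numFieldNormedType.Exports.
Local Open Scope classical_set_scope.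
Local Open Scope ring_scope.

Notation borel T := (g_sigma_algebraType (@open T)).

Section Lebesgue.
Variable R : realType.
Local Notation RM := (measurableTypeR R).

Definition cons_tuple n (p : RM * n.-tuple RM) : n.+1.-tuple RM :=
  [tuple of p.1 :: p.2].

Lemma measurable_cons_tuple n : measurable_fun [set: RM * n.-tuple RM] (@cons_tuple n).
Proof. by apply: measurable_cons. Qed.

(* The library's sigma-finite instance on [\x] is shadowed by its subprobability
   one, so sigma-finiteness is reproved along the recursion. *)
Definition tuple_leb_step n (m : {sigma_finite_measure set (n.-tuple RM) -> \bar R}) :
  set (n.+1.-tuple RM) -> \bar R :=
  pushforward (lebesgue_measure \x m)%E (@cons_tuple n).

Section step.
Variables (n : nat) (m : {sigma_finite_measure set (n.-tuple RM) -> \bar R}).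

Let m0 : tuple_leb_step m set0 = 0%E.
Proof. by rewrite /tuple_leb_step /pushforward preimage_set0 measure0. Qed.

Let mge0 A : (0 <= tuple_leb_step m A)%E.
Proof. by rewrite /tuple_leb_step /pushforward measure_ge0. Qed.

Let msigma : semi_sigma_additive (tuple_leb_step m).
Proof.
move=> F mF tF mUF; rewrite /tuple_leb_step /pushforward preimage_bigcup.
have mc := @measurable_cons_tuple n.
apply: measure_semi_sigma_additive.
- by move=> i; rewrite -[X in measurable X]setTI; exact: mc.
- apply/trivIsetP => /= i j _ _ ij; rewrite -preimage_setI.
  by move/trivIsetP : tF => /(_ _ _ _ _ ij) ->//; rewrite preimage_set0.
- by rewrite -preimage_bigcup -[X in measurable X]setTI; exact: mc.
Qed.

HB.instance Definition _ := isMeasure.Build _ _ _ (tuple_leb_step m) m0 mge0 msigma.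

Let sfin : sigma_finite setT (tuple_leb_step m).
Proof.
have /sigma_finiteP[F [TF ndF Foo]] := sigma_finiteT (@lebesgue_measure R).
have /sigma_finiteP[G [TG ndG Goo]] := sigma_finiteT m.
pose uncons (t : n.+1.-tuple RM) : RM * n.-tuple RM :=
  (thead t, [tuple of behead t]).
have munc : measurable_fun setT uncons.
  by apply/measurable_fun_pairP; split;
    [exact: measurable_tnth|exact: measurable_behead].
have consK : uncons \o @cons_tuple n = id.
  by apply/funext => -[x t]; rewrite /uncons /cons_tuple/=; congr pair; exact/val_inj.
exists (fun i => uncons @^-1` (F i `*` G i)).
  apply/esym; rewrite -subTset => t _ /=.
  have : setT (uncons t).1 by []. have : setT (uncons t).2 by [].
  rewrite TF TG => -[k _ Gk] [l _ Fl]; exists (maxn k l) => //; split.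
    by move: Fl; apply/subsetPset/ndF/leq_maxr.
  by move: Gk; apply/subsetPset/ndG/leq_maxl.
move=> i; have [mF Fi] := Foo i; have [mG Gi] := Goo i; split.
  by rewrite -[X in measurable X]setTI; apply: munc => //; exact: measurableX.
rewrite /tuple_leb_step /pushforward -comp_preimage consK preimage_id.
by rewrite product_measure1E// lte_mul_pinfty// ge0_fin_numE.
Qed.

HB.instance Definition _ := Measure_isSigmaFinite.Build _ _ _ (tuple_leb_step m) sfin.
End step.

Fixpoint tuple_leb n : {sigma_finite_measure set (n.-tuple RM) -> \bar R} :=
  match n with
  | 0 => \d_[tuple]
  | n'.+1 => tuple_leb_step (tuple_leb n')
  end.

Definition row_of_tuple d (t : d.-tuple RM) : 'rV[R]_d := \row_i tnth t i.


Lemma measurable_row_of_tuple d :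
  measurable_fun setT (@row_of_tuple d : d.-tuple RM -> borel 'rV[R]_d).
Proof.
apply: measurability => //= _ [U oU <-]; rewrite setTI.
pose box (q : 'rV[rat]_d * rat) : set 'rV[R]_d :=
  [set x | forall i, `|x ord0 i - ratr (q.1 ord0 i)| < ratr q.2].
have mbox q : measurable (@row_of_tuple d @^-1` box q).
  rewrite (_ : _ @^-1` _ = \bigcap_(i in [set: 'I_d])
     ((fun t : d.-tuple RM => tnth t i) @^-1`
        [set y | `|y - ratr (q.1 ord0 i)| < ratr q.2])).
    apply: fin_bigcap_measurable => // i _.
    rewrite -[X in measurable X]setTI; apply: measurable_tnth => //.
    rewrite (_ : [set _ | _] = [set` `]ratr (q.1 ord0 i) - ratr q.2,
                                        ratr (q.1 ord0 i) + ratr q.2[]).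
      exact: measurable_itv.
    by apply/seteqP; split => y /=; rewrite in_itv/= ltr_distl.
  apply/seteqP; split=> t /= H i; first by move=> _; have := H i; rewrite mxE.
  by rewrite mxE; exact: H.
pose B (q : 'rV[rat]_d * rat) : set (d.-tuple RM) :=
  if `[< box q `<=` U >] then @row_of_tuple d @^-1` box q else set0.
rewrite (_ : _ @^-1` U = \bigcup_q B q).
  apply: countable_bigcupT_measurable; first exact: countableP.
  by move=> q; rewrite /B; case: ifPn.
apply/seteqP; split => [t /= Ut|t [q _]]; last first.
  by rewrite /B; case: asboolP => // qU /qU.
have : nbhs (row_of_tuple t) U by exact: open_nbhs_nbhs.
move=> /nbhs_ballP[e /= e0 eU].
have [r] := rat_in_itvoo (divr_gt0 e0 (ltr0n R 2)).
rewrite in_itv/= => /andP[r0 re].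
have /choice[q Hq] : forall i : 'I_d, exists q : rat,
    `|row_of_tuple t ord0 i - ratr q| < ratr r.
  move=> i; have [|q] := @rat_in_itvoo R (row_of_tuple t ord0 i - ratr r)
    (row_of_tuple t ord0 i + ratr r).
    by rewrite ltrD2l -subr_gt0 opprK addr_gt0.
  rewrite in_itv/= => /andP[q1 q2]; exists q.
  by rewrite ltr_norml; apply/andP; split; lra.
exists (\row_i q i, r) => //.
rewrite /B; case: asboolP => [_ i|].
  by have := Hq i; rewrite !mxE.
case=> x /= Hx; apply: eU; split=> // i j; rewrite [i]ord1 -ball_normE /ball_/=.
have := Hx j; have := Hq j; rewrite !mxE; move: (tnth t j) => y.
rewrite !ltr_norml => /andP[a1 a2] /andP[b1 b2].
by apply/andP; split; lra.
Qed.

Definition leb d : set (borel 'rV[R]_d) -> \bar R :=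
  pushforward (tuple_leb d) (@row_of_tuple d : _ -> borel 'rV[R]_d).

Section leb_measure.
Variable d : nat.

Let leb0 : leb (set0 : set (borel 'rV[R]_d)) = 0%E.
Proof. by rewrite /leb /pushforward preimage_set0 measure0. Qed.

Let leb_ge0 A : (0 <= @leb d A)%E.
Proof. by rewrite /leb /pushforward measure_ge0. Qed.

Let leb_sigma : semi_sigma_additive (@leb d).
Proof.
move=> F mF tF mUF; rewrite /leb /pushforward preimage_bigcup.
have mr := @measurable_row_of_tuple d.
apply: measure_semi_sigma_additive.
- by move=> i; rewrite -[X in measurable X]setTI; exact: mr.
- apply/trivIsetP => /= i j _ _ ij; rewrite -preimage_setI.
  by move/trivIsetP : tF => /(_ _ _ _ _ ij) ->//; rewrite preimage_set0.
- by rewrite -preimage_bigcup -[X in measurable X]setTI; exact: mr.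
Qed.

HB.instance Definition _ := isMeasure.Build _ _ _ (@leb d) leb0 leb_ge0 leb_sigma.

End leb_measure.

End Lebesgue.

Section Smooth.
Variables (R : realType) (d : nat).
Local Notation V := 'rV[R]_d.
Implicit Types (f g : V -> R) (s : seq 'I_d) (A : set V) (k : nat) (x : V).

(* The library norm on row vectors is the sup norm; lengths, balls and distances
   below are Euclidean. *)
Definition enorm (x : V) : R := Num.sqrt (\sum_i x ord0 i ^+ 2).

Definition eball (r : R) : set V := [set x | enorm x < r].

Definition edist_to (x : V) A : R := inf [set enorm (x - z) | z in A].

Definition boundary A : set V := closure A `\` A°.

Definition partial (i : 'I_d) f : V -> R := fun x => 'D_(delta_mx ord0 i) f x.

(* mixed partial derivative along the multi-index listed by s *)
Definition partials s f : V -> R := foldr partial f s.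

(* meant for open A: membership only depends on f near the points of A *)
Definition C_on k A f : Prop :=
  (forall s i x, (size s < k)%N -> A x ->
     derivable (partials s f) x (delta_mx ord0 i)) /\
  (forall s x, (size s <= k)%N -> A x -> {for x, continuous (partials s f)}).

Definition smooth_on A f : Prop := forall k, C_on k A f.

Definition laplacian f : V -> R := fun x => \sum_i partials [:: i; i] f x.

Definition Ck_norm k A f : \bar R :=
  ereal_sup [set e | exists s x, [/\ (size s <= k)%N, A x & e = `|partials s f x|%:E]].

Definition dist_k k f g : R :=
  inf [set e | 0 < e /\ (Ck_norm k (eball e^-1) (f \- g)%R < e%:E)%E].

Lemma partialsB k f g s : C_on k setT f -> C_on k setT g -> (size s <= k)%N ->
  partials s (f \- g) = partials s f \- partials s g.
Proof.
move=> [df _] [dg _]; elim: s => //= i s IH sk.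
rewrite IH 1?ltnW//; apply/funext => x; rewrite /partial deriveB//.
- exact: df.
- exact: dg.
Qed.

Lemma enorm_ge0 x : 0 <= enorm x. Proof. exact: sqrtr_ge0. Qed.

Lemma enorm0 : enorm 0 = 0.
Proof. by rewrite /enorm big1 ?sqrtr0// => i _; rewrite mxE expr0n. Qed.

Lemma coord_le_enorm x i : `|x ord0 i| <= enorm x.
Proof.
rewrite -sqrtr_sqr ler_sqrt; last by apply: sumr_ge0 => j _; exact: sqr_ge0.
by rewrite (bigD1 i)//= lerDl; apply: sumr_ge0 => j _; exact: sqr_ge0.
Qed.

Lemma Ck_bounded k f : C_on k setT f ->
  exists M : R, forall s x, (size s <= k)%N -> eball 1 x -> `|partials s f x| <= M.
Proof.
move=> [_ cf].
pose K : set V := [set v | forall i, v ord0 i \in `[(-1 : R), 1]].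
have Kc : compact K.
  by apply: (@rV_compact _ _ (fun=> `[(-1:R), 1]%classic)) => _; exact: segment_compact.
have K0 : K !=set0 by exists 0 => i; rewrite mxE in_itv/=; apply/andP; split; lra.
have eK x : eball 1 x -> K x.
  move=> x1 i; have := le_lt_trans (coord_le_enorm x i) x1.
  by rewrite in_itv/= ltr_norml => /andP[/ltW -> /ltW ->].
have Hs s : exists M : R, (size s <= k)%N -> forall x, K x -> `|partials s f x| <= M.
  have [sk|] := leqP (size s) k; last by move=> _; exists 0.
  have cs : {within K, continuous (fun x => `|partials s f x|)}.
    apply: continuous_subspaceT => x.
    have := cf s x sk Logic.I.
    move=> h; exact: (cvg_norm h).
  have [c _ Hc] := compact_EVT_max K0 Kc cs.
  by exists `|partials s f c| => _ x Kx; apply: Hc; rewrite inE.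
move/choice: Hs => [M HM].
exists (\sum_(n < k.+1) \sum_(t : n.-tuple 'I_d) `|M t|) => s x sk x1.
have := HM s sk x (eK _ x1) => /le_trans; apply.
apply: (le_trans (ler_norm _)).
have sk' : (size s < k.+1)%N by [].
rewrite (bigD1 (Ordinal sk'))//= (bigD1 (in_tuple s))//= -addrA lerDl addr_ge0//.
  by apply: sumr_ge0.
by apply: sumr_ge0 => ? _; apply: sumr_ge0.
Qed.

Lemma Ck_norm_ge0 k r f : 0 < r -> (0 <= Ck_norm k (eball r) f)%E.
Proof.
move=> r0; apply: (@le_trans _ _ `|f 0|%:E); first by rewrite lee_fin.
apply: ereal_sup_ubound; exists [::], 0; split => //.
by rewrite /eball/= enorm0.
Qed.

Lemma Ck_norm_le k A B f : A `<=` B -> (Ck_norm k A f <= Ck_norm k B f)%E.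
Proof.
move=> AB; apply: le_ereal_sup => _ [s [x [sk Ax ->]]].
by exists s, x; split => //; exact: AB.
Qed.

Let D k f g : set R := [set e | 0 < e /\ (Ck_norm k (eball e^-1) (f \- g)%R < e%:E)%E].

Lemma dist_lb k f g : lbound (D k f g) 0.
Proof. by move=> e [/ltW]. Qed.

Lemma dist_nonempty k f g : C_on k setT f -> C_on k setT g -> D k f g !=set0.
Proof.
move=> cf cg; have [M HM] := Ck_bounded cf; have [N HN] := Ck_bounded cg.
exists (`|M| + `|N| + 1); have e0 : 0 < `|M| + `|N| + 1 by rewrite ltr_wpDl ?addr_ge0.
split => //; apply: (@le_lt_trans _ _ (`|M| + `|N|)%:E); last first.
  by rewrite lte_fin ltrDl.
apply: ge_ereal_sup => _ [s [x [sk xe ->]]]; rewrite lee_fin.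
have x1 : eball 1 x.
  apply: lt_le_trans xe _; rewrite invf_le1// lerDr addr_ge0//.
rewrite (partialsB cf cg sk)/= (le_trans (ler_normB _ _))// lerD//.
  by apply: le_trans (ler_norm _); exact: HM.
by apply: le_trans (ler_norm _); exact: HN.
Qed.

Lemma dist_kxx k f : C_on k setT f -> dist_k k f f = 0.
Proof.
move=> cf; apply/eqP; rewrite eq_le; apply/andP; split; last first.
  by apply: lb_le_inf; [exact: dist_nonempty|exact: dist_lb].
apply/ler_addgt0Pl => e e0; rewrite addr0; apply: ge_inf.
  by exists 0; exact: dist_lb.
split => //; apply: (@le_lt_trans _ _ 0%E); last by rewrite lte_fin.
apply: ge_ereal_sup => _ [s [x [sk xe ->]]].
by rewrite (partialsB cf cf sk)/= subrr normr0.
Qed.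

Lemma dist_k_sym k f g : C_on k setT f -> C_on k setT g -> dist_k k f g = dist_k k g f.
Proof.
move=> cf cg; rewrite /dist_k; congr inf; apply/seteqP.
have H f' g' e : C_on k setT f' -> C_on k setT g' ->
    Ck_norm k (eball e) (f' \- g') = Ck_norm k (eball e) (g' \- f').
  move=> cf' cg'; congr ereal_sup; apply/seteqP; split => _ [s [x [sk xe ->]]];
    exists s, x; split => //; rewrite !(partialsB _ _ sk)//= distrC//.
by split=> e [e0 He]; split => //; rewrite H.
Qed.

Lemma dist_k_triangle k g f h : C_on k setT f -> C_on k setT g -> C_on k setT h ->
  dist_k k f h <= dist_k k f g + dist_k k g h.
Proof.
move=> cf cg ch; apply/ler_addgt0Pl => e e0.
have e2 : 0 < e / 2 by rewrite divr_gt0.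
have hi f' g' : C_on k setT f' -> C_on k setT g' -> has_inf (D k f' g').
  by move=> ? ?; split; [exact: dist_nonempty|exists 0; exact: dist_lb].
have [a [a0 Ha] aI] := inf_adherent e2 (hi _ _ cf cg).
have [b [b0 Hb] bI] := inf_adherent e2 (hi _ _ cg ch).
apply: (@le_trans _ _ (a + b)); last first.
  by move: aI bI; rewrite /dist_k -/(D k f g) -/(D k g h); lra.
apply: ge_inf; first by exists 0; exact: dist_lb.
have ab0 : 0 < a + b by rewrite addr_gt0.
split => //; apply: (@le_lt_trans _ _ (Ck_norm k (eball a^-1) (f \- g)%R +
    Ck_norm k (eball b^-1) (g \- h)%R)%E); last by rewrite EFinD lteD.
apply: ge_ereal_sup => _ [s [x [sk xe ->]]].
rewrite (partialsB cf ch sk)/=.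
apply: (@le_trans _ _ (`|partials s (f \- g) x| + `|partials s (g \- h) x|)%:E).
  rewrite lee_fin (partialsB cf cg sk) (partialsB cg ch sk)/=.
  rewrite (_ : _ - _ = (partials s f x - partials s g x) +
    (partials s g x - partials s h x)); last by ring.
  exact: ler_normD.
rewrite EFinD leeD//; apply: ereal_sup_ubound; exists s, x; split => //.
  by apply: lt_le_trans xe _; rewrite lef_pV2 ?posrE// lerDl ltW.
by apply: lt_le_trans xe _; rewrite lef_pV2 ?posrE// lerDr ltW.
Qed.

Lemma dist_k_eq0 k f g : C_on k setT f -> C_on k setT g -> dist_k k f g = 0 -> f = g.
Proof.
move=> cf cg d0; apply/funext => x; apply/eqP; rewrite -subr_eq0 -normr_le0.
apply/ler_addgt0Pl => e e0; rewrite addr0.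
have x1 : 0 < enorm x + 1 by rewrite ltr_wpDl ?enorm_ge0.
have m0 : 0 < Num.min e (enorm x + 1)^-1 by rewrite lt_min e0 invr_gt0.
have hi : has_inf (D k f g).
  by split; [exact: dist_nonempty|exists 0; exact: dist_lb].
have [a [a0 Ha]] := inf_adherent m0 hi.
rewrite -/(dist_k k f g) d0 add0r lt_min => /andP[ae ax].
rewrite ltW// (lt_trans _ ae)// -lte_fin (le_lt_trans _ Ha)//.
apply: ereal_sup_ubound; exists [::], x; split => //.
have : enorm x + 1 < a^-1 by rewrite -[ltLHS]invrK ltf_pV2 ?posrE ?invr_gt0.
by rewrite /eball/=; lra.
Qed.

End Smooth.

Section Spaces.
Variables (R : realType) (d : nat).
Local Notation V := 'rV[R]_d.

Lemma partials0 s : partials s (fun _ : V => 0 : R) = fun=> 0.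
Proof.
elim: s => //= i s ->; apply/funext => x; rewrite /partial.
exact: derive_cst.
Qed.

Lemma C_on0 k A : C_on k A (fun _ : V => 0 : R).
Proof.
split=> [s i x _ _|s x _ _]; rewrite partials0; first exact: derivable_cst.
exact: cst_continuous.
Qed.

(* the space H^k, a metric space for dist_k *)
Record Cspace (k : nat) := MkCspace {
  Cspace_fun :> V -> R ;
  Cspace_funP : `[< C_on k setT Cspace_fun >] }.

Section Cspace_instances.
Variable k : nat.
HB.instance Definition _ := [isSub for @Cspace_fun k].
HB.instance Definition _ := [Choice of Cspace k by <:].

Lemma CspaceP (f : Cspace k) : C_on k setT f.
Proof. exact/asboolP/Cspace_funP. Qed.

Definition Cspace0 : Cspace k := MkCspace (asboolT (@C_on0 k setT)).

HB.instance Definition _ := isPointed.Build (Cspace k) Cspace0.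

Definition Cspace_dist (f g : Cspace k) : R := dist_k k f g.

Let distxx f : Cspace_dist f f = 0.
Proof. exact/dist_kxx/CspaceP. Qed.

Let dist_positivity f g : Cspace_dist f g = 0 -> f = g.
Proof. by move/(dist_k_eq0 (CspaceP f) (CspaceP g)) => ?; exact/val_inj. Qed.

Let dist_sym f g : Cspace_dist f g = Cspace_dist g f.
Proof. exact: dist_k_sym (CspaceP f) (CspaceP g). Qed.

Let dist_triangle g f h : Cspace_dist f h <= Cspace_dist f g + Cspace_dist g h.
Proof. exact: dist_k_triangle (CspaceP f) (CspaceP g) (CspaceP h). Qed.

HB.instance Definition _ := isMetric.Build R (Cspace k)
  distxx dist_positivity dist_sym dist_triangle.
End Cspace_instances.

(* Packs a C^k function; the value on other functions is irrelevant. *)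
Definition to_Cspace k (f : V -> R) : Cspace k := insubd (Cspace0 k) f.

Definition free_particle (f : V -> R) : Prop :=
  smooth_on setT f /\ forall x, - laplacian f x = f x.

Record FP := MkFP { FP_fun :> V -> R ; FP_funP : `[< free_particle FP_fun >] }.

HB.instance Definition _ := [isSub for FP_fun].
HB.instance Definition _ := [Choice of FP by <:].

Lemma FP_smooth (f : FP) : smooth_on setT f.
Proof. by have /asboolP[] := FP_funP f. Qed.

Lemma free_particle0 : free_particle (fun=> 0).
Proof.
split=> [k|x]; first exact: C_on0.
by rewrite /laplacian big1 ?oppr0// => i _; rewrite partials0.
Qed.

HB.instance Definition _ := isPointed.Build FP (MkFP (asboolT free_particle0)).

Definition FP_incl k (f : FP) : Cspace k := MkCspace (asboolT (FP_smooth f k)).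

(* All the metrics dist_k induce the same topology on FP; we take k = 0. *)
HB.instance Definition _ := Topological.copy FP (initial_topology (FP_incl 0)).

End Spaces.

Section Cb.
Variables (R : realType) (X : topologicalType).

Definition Cb_pred : {pred X -> R^o} :=
  fun f => `[< continuous f /\ exists M : R, forall x, `|f x| <= M >].

Record Cb := MkCb { Cb_fun :> X -> R^o ; Cb_funP : Cb_fun \in Cb_pred }.

HB.instance Definition _ := [isSub for Cb_fun].
HB.instance Definition _ := [Choice of Cb by <:].

Lemma Cb_submod : submod_closed Cb_pred.
Proof.
split; first by apply/asboolP; split; [exact: cst_continuous|exists 0 => x; rewrite normr0].
move=> a f g /asboolP[cf [M HM]] /asboolP[cg [N HN]]; apply/asboolP; split.
  by move=> x; apply: cvgD; [apply: cvgZr; exact: cf|exact: cg].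
exists (`|a| * M + N) => x; rewrite (le_trans (ler_normD _ _))// lerD//.
by rewrite normrM ler_wpM2l.
Qed.

HB.instance Definition _ := GRing.isSubmodClosed.Build R (X -> R^o) Cb_pred Cb_submod.
HB.instance Definition _ := [SubChoice_isSubLmodule of Cb by <:].

Definition Cb_norm (f : Cb) : R := sup (range (fun x => `|f x|)).

Lemma Cb_has_sup (f : Cb) (x : X) : has_sup (range (fun x => `|f x|)).
Proof.
split; first by exists `|f x|, x.
by have /asboolP[_ [M HM]] := Cb_funP f; exists M => _ [y _ <-].
Qed.

Lemma Cb_norm_ub (f : Cb) x : `|f x| <= Cb_norm f.
Proof. by apply: sup_upper_bound; [exact: Cb_has_sup x|exists x]. Qed.

Lemma Cb_norm_le (f : Cb) M : 0 <= M -> (forall x, `|f x| <= M) -> Cb_norm f <= M.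
Proof.
move=> M0 H; have [[x _]|/nonemptyPn X0] := pselect ([set: X] !=set0).
  apply: ge_sup; first by exists `|f x|, x.
  by move=> _ [y _ <-].
rewrite /Cb_norm X0 image_set0 sup0//.
Qed.

Lemma Cb_norm_ge0 (f : Cb) : 0 <= Cb_norm f.
Proof.
have [[x _]|/nonemptyPn X0] := pselect ([set: X] !=set0).
  exact: le_trans (Cb_norm_ub f x).
by rewrite /Cb_norm X0 image_set0 sup0.
Qed.

Let normD (f g : Cb) : Cb_norm (f + g) <= Cb_norm f + Cb_norm g.
Proof.
apply: Cb_norm_le => [|x]; first by rewrite addr_ge0 ?Cb_norm_ge0.
by rewrite (le_trans (ler_normD _ _))// lerD// Cb_norm_ub.
Qed.

Let normZ (a : R) (f : Cb) : Cb_norm (a *: f) = `|a| * Cb_norm f.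
Proof.
have le (b : R) (g : Cb) : Cb_norm (b *: g) <= `|b| * Cb_norm g.
  apply: Cb_norm_le => [|x]; first by rewrite mulr_ge0 ?Cb_norm_ge0.
  by rewrite normrM ler_wpM2l// Cb_norm_ub.
apply/eqP; rewrite eq_le le/=; have [->|a0] := eqVneq a 0.
  by rewrite normr0 mul0r Cb_norm_ge0.
rewrite -ler_pdivlMl ?normr_gt0// -normfV.
by rewrite -{1}[f](@scalerK _ _ a) ?unitfE//; exact: le.
Qed.

Let norm0 (f : Cb) : Cb_norm f = 0 -> f = 0.
Proof.
move=> f0; apply/val_inj/funext => x /=; apply/eqP; rewrite -normr_le0 -f0.
exact: Cb_norm_ub.
Qed.

HB.instance Definition _ := Lmodule_isNormed.Build R Cb normD normZ norm0.
End Cb.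

Section LocalLimits.
Variables (R : realType) (d : nat).
Local Notation V := 'rV[R]_d.
Local Notation FP := (FP R d).
Local Notation H := (@Cspace R d).

Definition extension_map k (iota : {linear Cb R FP -> Cb R (H k)}) : Prop :=
  [/\ continuous iota,
      forall F (f : FP), iota F (FP_incl k f) = F f
    & forall F, `|iota F| = `|F| ].

(* chi lives on [0, +oo[: its values at negative arguments are unconstrained.
   Being 1 near 0, it is smooth up to 0 as soon as it is smooth on ]0, +oo[. *)
Definition cutoff (chi : R -> R) : Prop :=
  [/\ forall n t, 0 < t -> derivable (derive1n n chi) t 1,
      exists2 e, 0 < e & forall t, 0 <= t < e -> chi t = 1,
      forall t, 1 < t -> chi t = 0,
      forall t, 0 <= t -> 0 <= chi t <= 1
    & forall s t, 0 <= s -> s <= t -> chi t <= chi s].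

(* phi is only meaningful on Omega. For x0 in Omega the second factor is 0 unless
   x0 + h y is in Omega. *)
Definition localized (chi : R -> R) (Omega : set V) (phi : V -> R) (h : R) (x0 : V) :
    V -> R :=
  fun y => phi (x0 + h *: y) * chi (h * enorm y / edist_to x0 (boundary Omega)).

Definition LM chi Omega k (U : set V) (phi : V -> R) (h : R) : set (borel (H k)) -> \bar R :=
  fun A => ((fine (leb U))^-1%:E *
    \int[@leb R d]_(x0 in U) \d_(to_Cspace k (localized chi Omega phi h x0) : borel (H k)) A)%E.

(* <LM^iota, F> *)
Definition LM_ext chi Omega k (U : set V) phi h
    (iota : {linear Cb R FP -> Cb R (H k)}) (F : Cb R FP) : R :=
  fine (\int[LM chi Omega U phi h]_f (iota F f)%:E)%E.

(* The weak-* topology is the topology of pointwise convergence, restricted to the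
   continuous linear functionals; accumulation points are cluster points. *)
Definition acc_points chi Omega k (U : set V) (phi : nat -> V -> R) (h : nat -> R)
    (iota : {linear Cb R FP -> Cb R (H k)}) : set {linear Cb R FP -> R^o} :=
  [set nu | continuous nu /\
    cluster ((fun n => LM_ext chi Omega U (phi n) (h n) iota : {ptws Cb R FP -> R}) @ \oo)
      (nu : Cb R FP -> R)].

(* the functionals F |-> \int F dmu with mu a finite signed Borel measure; the
   integral is taken through a Jordan decomposition of mu *)
Definition signed_measures : set {linear Cb R FP -> R^o} :=
  [set nu | exists (mu : {charge set (borel FP) -> \bar R}) (P N : set (borel FP))
      (PN : hahn_decomposition mu P N),
    forall F : Cb R FP, (nu F)%:E =
      (\int[jordan_pos PN]_f (F f)%:E - \int[jordan_neg PN]_f (F f)%:E)%E].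

Definition test_function (Omega : set V) (psi : V -> R) : Prop :=
  smooth_on setT psi /\
  exists K : set V, [/\ compact K, K `<=` Omega & forall x, ~ K x -> psi x = 0].

(* squared H^1(Omega) distance, for functions that are C^1 on Omega *)
Definition H1_dist2 (Omega : set V) (f g : V -> R) : \bar R :=
  (\int[@leb R d]_(x in Omega)
    ((f x - g x) ^+ 2 + \sum_i (partial i f x - partial i g x) ^+ 2)%:E)%E.

(* f, smooth on Omega, lies in H^1_0(Omega), the H^1-closure of C_c^oo(Omega) *)
Definition dirichlet (Omega : set V) (f : V -> R) : Prop :=
  exists2 psi : nat -> V -> R, forall j, test_function Omega (psi j)
    & H1_dist2 Omega (psi j) f @[j --> \oo] --> 0%E.

End LocalLimits.

(* Main.v *)
(* In the variable y the function phi_n(x + h_n y) solves -Lap f = f, so interior elliptic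
   estimates bound all its derivatives on a cube by its L^2 norm on a larger cube. By Fubini,
   the average over x of these local L^2 norms is bounded uniformly in n; by Chebyshev, up to a
   set of x of small measure the localized functions therefore stay in a set of functions with
   uniformly bounded derivatives on every cube. Along ultrafilters such functions converge, in
   every H^k at once, to elements of a compact subset of FP. Hence if two bounded continuous
   functions on H^k and H^k' agree on FP, their integrals against the local measures have the
   same limits, which gives the independence of k and of the extension map. The same compactness
   and Dini's theorem show that an accumulation point nu is positive and sigma-smooth (F_m
   decreasing to 0 implies nu F_m -> 0), so that Daniell's theorem represents it by a measure.
   For the local measures to make sense, the localized functions must be smooth and depend
   continuously on x: at the edge of the cutoff, which vanishes there to infinite order, this
   follows from the polynomial growth of the derivatives of phi_n at the boundary of Omega. *)
Require Import Defs.
From HB Require Import structures.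
From mathcomp Require Import all_boot all_order all_algebra.
From mathcomp Require Import all_classical all_reals all_analysis.
From mathcomp Require Import measurable_realfun.
From mathcomp Require Import ring lra.
Set Implicit Arguments. Unset Strict Implicit. Unset Printing Implicit Defensive.
Import Order.TTheory GRing.Theory Num.Theory.
Import numFieldNormedType.Exports.
Local Open Scope classical_set_scope.
Local Open Scope ring_scope.

(** * Partial derivatives *)

(** The functions are smooth from the start, so only the size of constants is at stake in the
    elliptic estimates. They rest on one-variable calculus: Caccioppoli's inequality integrates an
    explicit divergence over a cube, and a point value is bounded by L^2 norms of mixed derivatives
    of order at most one in each variable, through the fundamental theorem of calculus in one
    coordinate at a time. No constant may depend on n, and at scale h_n the equation contains no
    parameter.

    The weak-* topology on the dual of C_b(FP) has no countable bases to work with, so an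
    accumulation point need not be the limit of a subsequence; ultrafilters on the indices take the
    place of subsequences throughout.

    An extension map says nothing about [iota F] off FP beyond its sup norm. Every comparison
    therefore splits the base points into good ones, whose localized functions approach a compact
    part of FP, and bad ones of small measure, where the sup norm is enough. The bounds defining
    good points involve no k, so one limit in FP serves all spaces H^k; this is how functions on
    different H^k get compared. *)

Section Calculus.
Variables (R : realType) (d : nat).
Local Notation V := 'rV[R]_d.
Implicit Types (f g : V -> R) (s : seq 'I_d) (A : set V) (x y v : V) (i j : 'I_d).

Local Notation e_ i := (delta_mx ord0 i : V).

(** The two difference quotients are the same function of the increment. Directional derivatives
    thus reduce to one-variable calculus, with no appeal to total differentiability. *)
Lemma is_derive_lineP f x v (t df : R) :
  is_derive (t *: v + x) v f df <-> is_derive t 1 (fun u : R => f (u *: v + x)) df.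
Proof.
have E : (fun h : R => h^-1 *: ((f \o shift (t *: v + x)) (h *: v) - f (t *: v + x)))
   = (fun h : R => h^-1 *: (((fun u : R => f (u *: v + x)) \o shift t) (h *: 1)
        - (fun u : R => f (u *: v + x)) t)).
  by apply/funext => h /=; rewrite addrA -scalerDl [h *: 1]mulr1.
by split=> -[]; rewrite /derivable/derive => H1 H2; split;
  rewrite /derivable/derive ?E// -E.
Qed.

Lemma is_derive_line0 f x v df :
  is_derive x v f df -> is_derive (0 : R) 1 (fun u : R => f (u *: v + x)) df.
Proof. by move=> H; apply/is_derive_lineP; rewrite scale0r add0r. Qed.

Lemma is_derive_comp1 (c : R -> R) f x v (dc df : R) :
  is_derive (f x) 1 c dc -> is_derive x v f df ->
  is_derive x v (c \o f) (dc * df).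
Proof.
move=> hc hf; rewrite -[x]add0r -(scale0r v); apply/is_derive_lineP.
rewrite (_ : (fun _ => _) = c \o (fun u : R => f (u *: v + x))); last exact/funext.
apply: is_derive1_comp; last exact: is_derive_line0.
by rewrite scale0r add0r.
Qed.

(** Agreement near [x] is agreement near every point close to [x] ([near_join]), which is what the
    next derivative sees. *)
Lemma near_eq_partials s f g x :
  {near x, f =1 g} -> {near x, partials s f =1 partials s g}.
Proof.
elim: s => //= i s IH fg; have := near_join (IH fg).
apply: filterS => y fgy; rewrite /partial; apply: near_eq_derive => //.
Qed.

Lemma near_open (A : set V) f g : open A -> (forall y, A y -> f y = g y) ->
  forall x, A x -> {near x, f =1 g}.
Proof. by move=> oA fg x Ax; near=> y; apply: fg; near: y; exact: open_nbhs_nbhs. Unshelve. all: by end_near. Qed.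

Lemma eq_partials (A : set V) f g s x : open A -> (forall y, A y -> f y = g y) ->
  A x -> partials s f x = partials s g x.
Proof.
move=> oA fg Ax; exact: (nbhs_singleton (near_eq_partials s (near_open oA fg Ax))).
Qed.

Lemma partials_cat s t f : partials s (partials t f) = partials (s ++ t) f.
Proof. by rewrite /partials foldr_cat. Qed.

Lemma eq_C_on k A f g : open A -> (forall y, A y -> f y = g y) ->
  C_on k A f -> C_on k A g.
Proof.
move=> oA fg [df cf]; have N s x : A x -> {near x, partials s f =1 partials s g}.
  by move=> Ax; apply: near_eq_partials; exact: near_open oA fg x Ax.
split=> [s i x sk Ax|s x sk Ax].
  exact: near_eq_derivable (N s x Ax) (df s i x sk Ax).
rewrite /prop_for /continuous_at -(nbhs_singleton (N s x Ax)).
by apply: cvg_trans (cf s x sk Ax); exact: near_eq_cvg (N s x Ax).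
Qed.

Lemma eq_smooth_on A f g : open A -> (forall y, A y -> f y = g y) ->
  smooth_on A f -> smooth_on A g.
Proof. by move=> oA fg sf k; apply: eq_C_on (sf k). Qed.

Lemma smooth_onP A f : smooth_on A f <->
  (forall s x, A x -> {for x, continuous (partials s f)} /\
     forall i, is_derive x (e_ i) (partials s f) (partials (i :: s) f x)).
Proof.
split=> [sf s x Ax|H k].
  split=> [|i]; first by have [_] := sf (size s); exact.
  by apply: derivableP; have [+ _] := sf (size s).+1; exact.
split=> [s i x _ Ax|s x _ Ax]; last by have [] := H s x Ax.
by have [_ /(_ i)[]] := H s x Ax.
Qed.

Lemma smooth_on_partials A f s : smooth_on A f -> smooth_on A (partials s f).
Proof. move=> /smooth_onP H; apply/smooth_onP => t x Ax.
rewrite partials_cat; split=> [|i]; first by have [] := H (t ++ s) x Ax.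
rewrite (partials_cat (i :: t)).
by have [_ /(_ i)] := H (t ++ s) x Ax. Qed.

Lemma smooth_on_derive A f x i s : smooth_on A f -> A x ->
  is_derive x (e_ i) (partials s f) (partials (i :: s) f x).
Proof. by move=> /smooth_onP H Ax; have [_] := H s x Ax. Qed.

Lemma smooth_on_continuous A f x s : smooth_on A f -> A x ->
  {for x, continuous (partials s f)}.
Proof. by move=> /smooth_onP H Ax; have [] := H s x Ax. Qed.

Lemma line_MVT f (df : V -> R) x i (a b : R) : a <= b ->
  (forall t, a <= t <= b -> is_derive (t *: e_ i + x) (e_ i) f (df (t *: e_ i + x))) ->
  exists2 t, a <= t <= b &
    f (b *: e_ i + x) - f (a *: e_ i + x) = df (t *: e_ i + x) * (b - a).
Proof.
move=> ab H.
have H' (t : R) : a <= t <= b ->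
   is_derive t 1 (fun t : R => f (t *: e_ i + x)) (df (t *: e_ i + x)).
  by move=> /H /is_derive_lineP.
have [|t|t] := @MVT_segment R (fun t => f (t *: e_ i + x)) (fun t => df (t *: e_ i + x)) a b ab.
- by move=> t; rewrite in_itv/= => /andP[? ?]; apply: H'; rewrite !ltW.
- by apply: derivable_within_continuous => u; rewrite in_itv/= => /H'[].
- by rewrite in_itv/=; exists t.
Qed.

Lemma rV_norm_leP x (r : R) : 0 <= r -> (`|x| <= r) <-> (forall i, `|x ord0 i| <= r).
Proof.
move=> r0; rewrite [`|x|]/Num.norm/= mx_normrE; split.
  by move=> /bigmax_leP[_ H] i; exact: (H (ord0, i)).
by move=> H; apply/bigmax_leP; split => // -[a b] _ /=; rewrite [a]ord1.
Qed.

Lemma coord_le_norm x i : `|x ord0 i| <= `|x|.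
Proof. by move: i; apply/rV_norm_leP. Qed.

Lemma norm_delta i (t : R) : `|t *: e_ i| <= `|t|.
Proof.
apply/rV_norm_leP => // j; rewrite !mxE/=; case: (j == i); first by rewrite mulr1.
by rewrite mulr0 normr0.
Qed.

Lemma continuous_affine (a : V) (r : R) : continuous (fun y : V => a + r *: y).
Proof.
move=> y; apply: (@continuousD _ _ _ (cst a : V -> V) (fun y : V => r *: y) y).
  exact: cst_continuous.
exact: scaler_continuous.
Qed.

(** A family closed under formal differentiation certifies smoothness and computes all derivatives
    at once; the two conclusions are proved together by induction on [s]. *)
Lemma smooth_on_family A f (F : seq 'I_d -> V -> R) : open A ->
  (forall x, A x -> F [::] x = f x) ->
  (forall s x, A x -> {for x, continuous (F s)}) ->
  (forall s i x, A x -> is_derive x (e_ i) (F s) (F (i :: s) x)) ->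
  smooth_on A f /\ forall s x, A x -> partials s f x = F s x.
Proof.
move=> oA F0 cF dF.
have E s x : A x -> partials s f x = F s x.
  elim: s x => [|i s IH] x Ax /=; first by rewrite F0.
  rewrite /partial (near_eq_derive _ (near_open oA IH Ax)).
  by have [_ ->] := dF s i x Ax.
split=> //; apply/smooth_onP => s x Ax; split=> [|i].
  rewrite /prop_for/continuous_at E//; apply: cvg_trans (cF s x Ax).
  by have /near_eq_cvg := near_open oA (fun y Ay => esym (E s y Ay)) Ax; exact.
rewrite E//; apply: near_eq_is_derive (dF s i x Ax).
exact: near_open oA (fun y Ay => esym (E s y Ay)) x Ax.
Qed.

Lemma is_derive_affine f (a : V) (r : R) x v df : is_derive (a + r *: x) v f df ->
  is_derive x v (fun y => f (a + r *: y)) (r * df).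
Proof.
move=> H; rewrite -[x]add0r -(scale0r v); apply/is_derive_lineP.
rewrite (_ : (fun _ => _) = (fun t => f (t *: v + (a + r *: x))) \o (fun u : R => r * u)).
  rewrite mulrC; apply: is_derive1_comp.
    by rewrite mulr0; exact: is_derive_line0.
  by have := is_deriveZ r (is_derive_id (0 : R) (1 : R)); rewrite [r *: 1]mulr1.
by apply/funext => u /=; rewrite scalerDr scalerA addrCA.
Qed.

Lemma smooth_on_affine A f (a : V) (r : R) : open A -> smooth_on A f ->
  let B := [set y | A (a + r *: y)] in
  [/\ open B, smooth_on B (fun y => f (a + r *: y)) &
   forall s x, B x -> partials s (fun y => f (a + r *: y)) x
     = r ^+ size s * partials s f (a + r *: x)].
Proof.
move=> oA sf B; have oB : open B.
  apply: (@open_comp _ _ (fun y : V => a + r *: y)) oA => y _; exact: continuous_affine.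
have [//|x Bx|s x Bx|s i x Bx|sB E] := @smooth_on_family B (fun y => f (a + r *: y))
  (fun s y => r ^+ size s * partials s f (a + r *: y)).
- by rewrite mul1r.
- have H := continuous_comp (@continuous_affine a r x) (smooth_on_continuous (s := s) sf Bx).
  exact: (cvgMl_tmp H).
- rewrite /= exprSr -mulrA; apply: is_deriveZ.
  by apply: is_derive_affine; exact: smooth_on_derive sf Bx.
- by split.
Qed.

(** The mean value theorem is applied in direction [i] to the difference of [f] and its shift by t
    e_j, then in direction [j] to the first derivative. *)
Lemma double_difference A f i j x (t : R) : smooth_on A f -> 0 <= t ->
  (forall s u : R, 0 <= s <= t -> 0 <= u <= t -> A (s *: e_ i + (u *: e_ j + x))) ->
  exists s u : R, [/\ 0 <= s <= t, 0 <= u <= t &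
    f (t *: e_ i + (t *: e_ j + x)) - f (t *: e_ j + x) - f (t *: e_ i + x) + f x
    = partials [:: j; i] f (s *: e_ i + (u *: e_ j + x)) * t ^+ 2].
Proof.
move=> sf t0 HA.
have A0 (s : R) : 0 <= s <= t -> A (s *: e_ i + x).
  move=> st; have := HA s 0 st; rewrite lexx t0 => /(_ isT).
  by rewrite scale0r add0r.
have tt : 0 <= t <= t by rewrite t0 lexx.
(* The factor [1 *:] gives the shifted function the shape that [is_derive_affine] differentiates. *)
have [|s st] := @line_MVT (fun y => f (t *: e_ j + 1 *: y) - f y)
  (fun y => partials [:: i] f (t *: e_ j + y) - partials [:: i] f y) x i 0 t t0.
  move=> s st; apply: is_deriveB; last exact: smooth_on_derive [::] sf (A0 _ st).
  rewrite -[X in is_derive _ _ _ X]mul1r; apply: is_derive_affine.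
  rewrite scale1r; apply: smooth_on_derive [::] sf _.
  by rewrite addrCA; exact: HA.
rewrite !scale1r scale0r add0r subr0 => Es.
have [|u ut] := @line_MVT (partials [:: i] f) (partials [:: j; i] f) (s *: e_ i + x) j 0 t t0.
  move=> u ut; apply: smooth_on_derive [:: i] sf _; rewrite addrCA; exact: HA.
rewrite subr0 scale0r add0r => Eu.
exists s, u; split => //.
move: Es Eu; rewrite ![_ *: e_ j + (_ *: e_ i + x)]addrCA => Es Eu.
rewrite Eu in Es; rewrite expr2 mulrA -Es; ring.
Qed.

Lemma dist_half (e a b c : R) :
  `|a - c| < e / 2 -> `|b - c| < e / 2 -> `|b - a| <= e.
Proof.
rewrite !ltr_norml ler_norml => /andP[? ?] /andP[? ?].
by apply/andP; split; lra.
Qed.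

(** The second difference is symmetric in the two directions, so the two mixed derivatives coincide
    at some pair of points near [x]; continuity brings both points to [x]. *)
Lemma partialsC A f i j x : open A -> smooth_on A f -> A x ->
  partials [:: i; j] f x = partials [:: j; i] f x.
Proof.
move=> oA sf Ax; apply/eqP; rewrite -subr_eq0 -normr_le0; apply/ler_addgt0Pl => e e0.
rewrite addr0; have e2 : 0 < e / 2 by rewrite divr_gt0.
have cvg_dist k l : \forall y \near x, `|partials [:: k; l] f x - partials [:: k; l] f y| < e / 2.
  by have /cvgrPdist_lt/(_ _ e2) := smooth_on_continuous (s := [:: k; l]) sf Ax; exact.
have /nbhs_normP[r /= r0 Hr] : nbhs x (A `&`
    ([set y | `|partials [:: i; j] f x - partials [:: i; j] f y| < e / 2] `&`
     [set y | `|partials [:: j; i] f x - partials [:: j; i] f y| < e / 2])).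
  apply: filterI; first exact: open_nbhs_nbhs.
  by apply: filterI; exact: cvg_dist.
have [t t0 t3] : exists2 t : R, 0 < t & 2 * t < r by exists (r / 3); lra.
have tn0 : t ^+ 2 != 0 by rewrite expf_neq0// gt_eqF.
have tt : 0 <= t <= t by rewrite lexx ltW.
have HB k l (s u : R) : 0 <= s <= t -> 0 <= u <= t ->
   `|x - (s *: e_ k + (u *: e_ l + x))| < r.
  move=> /andP[s0 st] /andP[u0 ut]; rewrite addrA -opprB addrK normrN.
  apply: (le_lt_trans (ler_normD _ _)).
  apply: (@le_lt_trans _ _ (s + u)); last by lra.
  by rewrite lerD// (le_trans (norm_delta _ _))// ger0_norm.
have HA k l (s u : R) : 0 <= s <= t -> 0 <= u <= t -> A (s *: e_ k + (u *: e_ l + x)).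
  by move=> st ut; have [] := Hr _ (HB k l s u st ut).
have [s [u [st ut E1]]] := double_difference sf (ltW t0) (HA i j).
have [s' [u' [st' ut' E2]]] := double_difference sf (ltW t0) (HA j i).
have [_ [_ H1]] := Hr _ (HB i j s u st ut).
have [_ [H2 _]] := Hr _ (HB j i s' u' st' ut').
have /(mulIf _) E : partials [:: j; i] f (s *: e_ i + (u *: e_ j + x)) * t ^+ 2 =
   partials [:: i; j] f (s' *: e_ j + (u' *: e_ i + x)) * t ^+ 2.
  apply: etrans (esym E1) _; apply: etrans _ E2; congr (_ + _).
  by apply: etrans (addrAC _ _ _) _; congr (f _ - _ - _); exact: addrCA.
have {}E := E tn0.
apply: (@dist_half e _ _ (partials [:: i; j] f (s' *: e_ j + (u' *: e_ i + x)))).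
  by rewrite -E; exact: H1.
exact: H2.
Qed.

(** The head of [s] is moved to the front of [t] by adjacent transpositions, each an instance of
    [partialsC]. *)
Lemma perm_partials A f s t x : open A -> smooth_on A f -> perm_eq s t -> A x ->
  partials s f x = partials t f x.
Proof.
move=> oA sf /permP; elim: s t x => [|i s IH] t x st Ax.
  by case: t st => // j t /(_ predT).
have it : i \in t by rewrite -has_pred1 has_count -st /= eqxx.
have [t1 [t2 Et]] : exists t1 t2, t = t1 ++ i :: t2.
  by case/splitPr: it => t1 t2; exists t1, t2.
have -> : partials t f x = partials (i :: t1 ++ t2) f x.
  rewrite Et; elim: t1 x Ax {st it Et} => //= j t1 IHt x Ax.
  have -> : partial j (partials (t1 ++ i :: t2) f) x
      = partial j (partials (i :: t1 ++ t2) f) x.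
    by apply: near_eq_derive; exact: near_open oA IHt x Ax.
  have := partialsC j i oA (smooth_on_partials (t1 ++ t2) sf) Ax.
  by rewrite !partials_cat.
rewrite /= /partial; apply: near_eq_derive; apply: near_open oA _ x Ax => y Ay.
apply: IH => // p; have := st p; rewrite Et /= !count_cat/= => /eqP.
by rewrite addnCA eqn_add2l => /eqP.
Qed.

Definition cube (c : V) (r : R) : set V := [set y | forall i, `|y ord0 i - c ord0 i| <= r].

Lemma sum_ord_le (g : 'I_d -> R) (t : R) : (forall i, g i <= t) -> \sum_i g i <= d%:R * t.
Proof.
by move=> gt; rewrite mulr_natl -[X in _ *+ X]card_ord -sumr_const; exact: ler_sum.
Qed.

Lemma cube_lipschitz A f c (r C : R) y z : smooth_on A f -> cube c r `<=` A ->
  (forall i w, cube c r w -> `|partials [:: i] f w| <= C) ->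
  cube c r y -> cube c r z ->
  `|f y - f z| <= C * \sum_i `|y ord0 i - z ord0 i|.
Proof.
move=> sf cA HC cy cz.
(* The path from [z] to [y] changes one coordinate at a time: it stays in the cube, and each step is
   a one-variable mean value theorem. *)
pose w m : V := \row_i (if (i < m)%N then y ord0 i else z ord0 i).
have cw m : cube c r (w m) by move=> i; rewrite mxE; case: ifP => _; [exact: cy|exact: cz].
have w0 : w 0%N = z by apply/rowP => i; rewrite mxE.
have wd : w d = y by apply/rowP => i; rewrite mxE ltn_ord.
have step (m : 'I_d) : `|f (w m.+1) - f (w m)| <= C * `|y ord0 m - z ord0 m|.
  have wE : w m.+1 = (y ord0 m - z ord0 m) *: e_ m + w m.
    apply/rowP => i; rewrite !mxE ltnS eqxx/=.
    have [->|im] := eqVneq i m; first by rewrite leqnn ltnn mulr1 subrK.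
    by rewrite mulr0 add0r (leq_eqVlt i m) (negbTE im : (val i == val m) = false).
  pose t := y ord0 m - z ord0 m.
  have inb (u : R) : (0 <= u <= t) || (t <= u <= 0) -> cube c r (u *: e_ m + w m).
    move=> ut i; rewrite !mxE eqxx/=; have [->|im] := eqVneq i m.
      rewrite ltnn mulr1; have := cy m; have := cz m; rewrite !ler_norml /t in ut *.
      by move=> /andP[? ?] /andP[? ?]; case/orP: ut => /andP[? ?]; apply/andP; split; lra.
    by rewrite mulr0 add0r; case: ifP => _; [exact: cy|exact: cz].
  have [t0|t0] := leP 0 t.
    have [u ut|u ut] := @line_MVT f (partials [:: m] f) (w m) m 0 t t0.
      by apply: smooth_on_derive [::] sf _; apply/cA/inb; rewrite ut.
    rewrite -wE scale0r add0r subr0 => ->; rewrite normrM ler_wpM2r//.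
    by apply/HC/inb; rewrite ut.
  have [u ut|u ut] := @line_MVT f (partials [:: m] f) (w m) m t 0 (ltW t0).
    by apply: smooth_on_derive [::] sf _; apply/cA/inb; rewrite ut orbT.
  rewrite -wE scale0r add0r distrC => ->; rewrite normrM sub0r normrN ler_wpM2r//.
  by apply/HC/inb; rewrite ut orbT.
rewrite -w0 -[in f y]wd -(telescope_sumr (fun m => f (w m)))// big_mkord mulr_sumr.
rewrite w0; apply: le_trans (ler_norm_sum _ _ _) _; apply: ler_sum => m _; exact: step.
Qed.

End Calculus.

(** * Integration over cubes *)

(** Extension by zero turns functions controlled only on an open set into Borel functions on the
    whole space, as Tonelli's theorem requires. *)
Lemma open_continuous_borel (R : realType) (T : ptopologicalType) (W : set T) (f : T -> R) :
  open W -> (forall x, W x -> {for x, continuous f}) ->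
  measurable_fun [set: borel T] (f \_ W : borel T -> R).
Proof.
move=> oW cf; apply: (measurability _ (measurable_realfun.RGenOpens.measurableE R)).
move=> _ [_ [a [b ->]] <-]; rewrite setTI.
have : open `]a, b[%classic by exact: interval_open.
move: `]a, b[%classic => O oO.
have oWO : open (W `&` f @^-1` O).
  rewrite openE => x [Wx Ox]; apply: filterI; first exact: open_nbhs_nbhs.
  by apply: (cf _ Wx); exact: open_nbhs_nbhs.
have mO A : open A -> measurable (A : set (borel T)) by exact: sub_sigma_algebra.
(* Off [W] the patched function is 0, so the complement of [W] lies in the preimage exactly when 0
   is in [O]. *)
have [Oz|Oz] := pselect (O 0).
  rewrite (_ : _ @^-1` O = (W `&` f @^-1` O) `|` ~` W); last first.
    apply/seteqP; split => x /=; rewrite patchE; case: ifPn => [|].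
    - by rewrite inE => Wx Ofx; left.
    - by rewrite notin_setE => nW _; right.
    - by rewrite inE => Wx [[]|].
    - by [].
  by apply: measurableU; [exact: mO|apply: measurableC; exact: mO].
rewrite (_ : _ @^-1` O = (W `&` f @^-1` O)); first exact: mO.
apply/seteqP; split => x /=; rewrite patchE; case: ifPn => [|].
- by rewrite inE.
- by [].
- by move=> _ [].
- by rewrite notin_setE => nW [].
Qed.

Section Tuples.
Variable R : realType.
Local Notation RM := (measurableTypeR R).
Local Notation leb1 := (@lebesgue_measure R).
Local Notation T n := (n.-tuple RM).
Local Notation cons_tuple := (@Defs.cons_tuple R _).

Definition tcube n : set (T n) := [set t | forall i, `|tnth t i| <= 1].
Definition I1 : set RM := `[(-1 : R), 1]%classic.

Lemma I1P (s : R) : I1 s <-> `|s| <= 1.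
Proof. by rewrite /I1/= in_itv/= ler_norml. Qed.

Lemma measurable_I1 : measurable I1. Proof. exact: measurable_itv. Qed.

Lemma measurable_tcube n : measurable (@tcube n).
Proof.
rewrite (_ : @tcube n = \bigcap_(i in [set: 'I_n]) ((fun t : T n => tnth t i) @^-1` I1)).
  apply: fin_bigcap_measurable => // i _.
  rewrite -[X in measurable X]setTI; apply: measurable_tnth => //.
  exact: measurable_I1.
apply/seteqP; split => t /= H i; first by move=> _; apply/I1P; exact: H.
by apply/I1P; exact: H.
Qed.

Lemma tnth_cons n (s : RM) (t : T n) i :
  tnth (cons_tuple (s, t)) (lift ord0 i) = tnth t i.
Proof. by rewrite /cons_tuple/= tnthS. Qed.

Lemma tnth_cons0 n (s : RM) (t : T n) : tnth (cons_tuple (s, t)) ord0 = s.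
Proof. by rewrite /cons_tuple/= tnth0. Qed.

Lemma tcube_cons n (s : RM) (t : T n) :
  tcube (cons_tuple (s, t)) <-> I1 s /\ tcube t.
Proof.
split=> [H|[/I1P Hs Ht] i].
  split; first by apply/I1P; have := H ord0; rewrite tnth_cons0.
  by move=> i; have := H (lift ord0 i); rewrite tnth_cons.
by have [j ->|->] := unliftP ord0 i; rewrite ?tnth_cons ?tnth_cons0.
Qed.

Lemma cons_tuple_eta n (t : T n.+1) : t = cons_tuple (thead t, [tuple of behead t]).
Proof. exact: tuple_eta. Qed.

Lemma measurable_cons_l n (s : RM) : measurable_fun setT (fun t : T n => cons_tuple (s, t)).
Proof. exact: measurableT_comp (@measurable_cons_tuple R n) (@measurable_pair1 _ _ _ _ s). Qed.

Section recursion.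
Local Open Scope ereal_scope.
Variables (n : nat) (g : T n.+1 -> \bar R).
Hypotheses (mg : measurable_fun setT g) (g0 : forall t, 0 <= g t).

Let mgc : measurable_fun setT (g \o @Defs.cons_tuple R n).
Proof. exact: measurableT_comp mg (@measurable_cons_tuple R n). Qed.

Let gc0 p : 0 <= (g \o @Defs.cons_tuple R n) p. Proof. exact: g0. Qed.

Let pushE : \int[tuple_leb R n.+1]_t g t =
  \int[leb1 \x tuple_leb R n]_p g (cons_tuple p).
Proof.
rewrite /= /tuple_leb_step ge0_integral_pushforward//.
exact: measurable_cons_tuple.
Qed.

Lemma tonelli_tuple1 : \int[tuple_leb R n.+1]_t g t =
  \int[leb1]_s \int[tuple_leb R n]_t g (cons_tuple (s, t)).
Proof. by rewrite pushE; exact: (fubini_tonelli1 _ mgc gc0). Qed.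

Lemma tonelli_tuple2 : \int[tuple_leb R n.+1]_t g t =
  \int[tuple_leb R n]_t \int[leb1]_s g (cons_tuple (s, t)).
Proof. by rewrite tonelli_tuple1; exact: (fubini_tonelli _ mgc gc0). Qed.

Lemma measurable_tonelli1 :
  measurable_fun setT (fun s => \int[tuple_leb R n]_t g (cons_tuple (s, t))).
Proof. exact: (measurable_fun_fubini_tonelli_F _ mgc gc0). Qed.

End recursion.

(** Integration takes place on tuples, where Lebesgue measure is defined by recursion on the
    dimension, so that facts about cubes can be proved by induction. *)
Definition J n (g : T n -> \bar R) : \bar R := (\int[tuple_leb R n]_(t in @tcube n) g t)%E.

Section J_theory.
Local Open Scope ereal_scope.

Lemma measurable_patch_tcube n (g : T n -> \bar R) : measurable_fun setT g ->
  measurable_fun setT (g \_ (@tcube n)).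
Proof.
move=> mg; apply/(measurable_restrictT g (measurable_tcube (n := n))).
exact: measurable_funS mg.
Qed.

Lemma patch_tcube_cons n (g : T n.+1 -> \bar R) s t :
  (g \_ (@tcube n.+1)) (cons_tuple (s, t)) =
  ((fun s => ((fun t => g (cons_tuple (s, t))) \_ (@tcube n)) t) \_ I1) s.
Proof.
rewrite !patchE; case: ifPn => [|/negP].
  by rewrite inE => /tcube_cons[I1s Ct]; rewrite !mem_set.
rewrite inE => nC; case: ifPn => //; rewrite inE => I1s; case: ifPn => //.
by rewrite inE => Ct; exfalso; apply: nC; apply/tcube_cons.
Qed.

Variables (n : nat).

Lemma patch_tcube_ge0 m (g : T m -> \bar R) : (forall t, 0 <= g t) ->
  forall t, 0 <= (g \_ (@tcube m)) t.
Proof. by move=> g0 t; rewrite patchE; case: ifP. Qed.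

Lemma J_cons (g : T n.+1 -> \bar R) : measurable_fun setT g -> (forall t, 0 <= g t) ->
  J g = \int[leb1]_(s in I1) J (fun t => g (cons_tuple (s, t))).
Proof.
move=> mg g0; rewrite /J integral_mkcond tonelli_tuple1; last 2 first.
- exact: measurable_patch_tcube.
- exact: patch_tcube_ge0.
rewrite [RHS]integral_mkcond; apply: eq_integral => s _.
under eq_integral do rewrite patch_tcube_cons.
rewrite [RHS]patchE; case: ifPn => I1s.
  by rewrite [RHS]integral_mkcond; apply: eq_integral => t _; rewrite patchE I1s.
by under eq_integral do rewrite patchE (negbTE I1s); rewrite integral0.
Qed.

(** With the first coordinate innermost, the fundamental theorem of calculus applies to it; [J_cons]
    has it outermost, for inductions on the remaining ones. *)
Lemma J_cons_swap (g : T n.+1 -> \bar R) : measurable_fun setT g -> (forall t, 0 <= g t) ->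
  J g = J (fun t => \int[leb1]_(s in I1) g (cons_tuple (s, t))).
Proof.
move=> mg g0; rewrite /J integral_mkcond tonelli_tuple2; last 2 first.
- exact: measurable_patch_tcube.
- exact: patch_tcube_ge0.
rewrite [RHS]integral_mkcond; apply: eq_integral => t _.
under eq_integral do rewrite patch_tcube_cons.
rewrite -integral_mkcond [RHS]patchE; case: ifPn => Ct.
  by apply: eq_integral => s _; rewrite patchE Ct.
by under eq_integral do rewrite patchE (negbTE Ct); rewrite integral0.
Qed.

Lemma measurable_J (g : T n.+1 -> \bar R) : measurable_fun setT g -> (forall t, 0 <= g t) ->
  measurable_fun setT (fun s => J (fun t => g (cons_tuple (s, t)))).
Proof.
move=> mg g0.
have mC : measurable (setT `*` @tcube n : set (RM * T n)).
  by apply: measurableX => //; exact: measurable_tcube.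
have mh : measurable_fun setT ((g \o @Defs.cons_tuple R n) \_ (setT `*` @tcube n)).
  apply/(measurable_restrictT _ mC); apply: measurable_funS (measurableT) _ _ => //.
  exact: measurableT_comp mg (@measurable_cons_tuple R n).
have h0 p : 0 <= ((g \o @Defs.cons_tuple R n) \_ (setT `*` @tcube n)) p.
  by rewrite patchE; case: ifP => // _; exact: g0.
have := measurable_fun_fubini_tonelli_F (m2 := tuple_leb R n) _ mh h0.
apply: eq_measurable_fun => s _; rewrite /fubini_F /J [RHS]integral_mkcond.
by apply: eq_integral => t _; rewrite !patchE in_setX in_setT.
Qed.

Lemma le_J (f g : T n -> \bar R) : measurable_fun setT f -> measurable_fun setT g ->
  (forall t, tcube t -> 0 <= f t) -> (forall t, tcube t -> f t <= g t) -> J f <= J g.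
Proof.
move=> mf mg f0 fg; apply: ge0_le_integral => //.
- exact: measurable_tcube.
- exact: measurable_funS mf.
- exact: measurable_funS mg.
Qed.

Lemma J_ge0 (g : T n -> \bar R) : (forall t, tcube t -> 0 <= g t) -> 0 <= J g.
Proof. by move=> g0; apply: integral_ge0. Qed.

Lemma eq_J (f g : T n -> \bar R) : (forall t, tcube t -> f t = g t) -> J f = J g.
Proof. by move=> fg; apply: eq_integral => t; rewrite inE; exact: fg. Qed.

Lemma JD (f g : T n -> \bar R) : measurable_fun setT f -> measurable_fun setT g ->
  (forall t, 0 <= f t) -> (forall t, 0 <= g t) -> J (fun t => f t + g t) = J f + J g.
Proof.
move=> mf mg f0 g0; apply: ge0_integralD => //.
- exact: measurable_tcube.
- exact: measurable_funS mf.
- exact: measurable_funS mg.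
Qed.

Lemma JZ (k : R) (f : T n -> \bar R) : (0 <= k)%R -> measurable_fun setT f ->
  (forall t, 0 <= f t) -> J (fun t => k%:E * f t) = k%:E * J f.
Proof.
move=> k0 mf f0; apply: ge0_integralZl_EFin => //.
- exact: measurable_tcube.
- exact: measurable_funS mf.
Qed.

End J_theory.

Lemma J0 (g : T 0 -> \bar R) : (forall t, (0 <= g t)%E) -> J g = g [tuple].
Proof.
move=> g0; rewrite /J /= integral_dirac//; last first.
- rewrite (_ : g = cst (g [tuple])); first exact: measurable_cst.
  by apply/funext => t; rewrite (tuple0 t).
- exact: measurable_tcube.
by rewrite diracE mem_set ?mul1e// => -[].
Qed.

Lemma leb_I1 : lebesgue_measure I1 = 2%:E.
Proof. by rewrite /I1 lebesgue_measure_itv/= lte_fin ifT ?opprK//; lra. Qed.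

Lemma J_cst n (k : R) : 0 <= k -> J (fun _ : T n => k%:E) = (k * 2 ^+ n)%:E.
Proof.
move=> k0; elim: n => [|n IH]; first by rewrite J0 ?mulr1.
rewrite J_cons//; under eq_integral do rewrite IH.
rewrite integral_cst; last exact: measurable_I1.
by rewrite /= leb_I1 -EFinM exprSr mulrA.
Qed.

Lemma ftc (F f : R -> R) (a b : R) : a < b ->
  (forall s : R, a <= s <= b -> is_derive s 1 F (f s) /\ {for s, continuous f}) ->
  (\int[leb1]_(s in `[a, b]) (f s)%:E = (F b - F a)%:E)%E.
Proof.
move=> ab H; rewrite (@continuous_FTC2 _ f F a b ab) ?EFinB//.
- by apply: continuous_in_subspaceT => s; rewrite inE/= in_itv/= => sab; case: (H _ sab).
- have cF s : a <= s <= b -> {for s, continuous F}.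
    move=> /H[[dFs _] _]; exact/differentiable_continuous/derivable1_diffP.
  split=> [s||].
  + by rewrite in_itv/= => /andP[? ?]; have [|[]] := H s; rewrite ?ltW.
  + by apply: cvg_at_right_filter; apply: cF; rewrite lexx ltW.
  + by apply: cvg_at_left_filter; apply: cF; rewrite lexx ltW.
- move=> s; rewrite in_itv/= => /andP[? ?]; rewrite derive1E.
  by have [|[]] := H s; rewrite ?ltW.
Qed.

(** The derivative of (s - 1) u(s)^2 is integrated over [0, 1]: the boundary term at 1 vanishes and
    the one at 0 is u(0)^2. The cross term 2 (1 - s) |u u'| is at most u^2 + u'^2, hence the
    constant 2. *)
Lemma sobolev_dim1 (u u' : R -> R) :
  (forall s : R, `|s| <= 1 -> is_derive s 1 u (u' s)) ->
  (forall s : R, `|s| <= 1 -> {for s, continuous u'}) ->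
  (((u 0) ^+ 2)%:E <= 2%:E * \int[leb1]_(s in I1) (u s ^+ 2 + u' s ^+ 2)%:E)%E.
Proof.
move=> du cu'.
have cu (s : R) : `|s| <= 1 -> {for s, continuous u}.
  move=> /du[dus _]; exact/differentiable_continuous/derivable1_diffP.
have sub01 (s : R) : 0 <= s <= 1 -> `|s| <= 1 by rewrite ler_norml; lra.
pose f1 s := u s ^+ 2 - 2 * (1 - s) * (u s * u' s).
pose f2 s := 2 * (u s ^+ 2 + u' s ^+ 2).
have cf1 (s : R) : `|s| <= 1 -> {for s, continuous f1}.
  move=> s1; apply: cvgB; first by apply: cvgM; exact: cu.
  apply: cvgM; last by apply: cvgM; [exact: cu|exact: cu'].
  by apply: cvgM; [exact: cvg_cst|apply: cvgB; [exact: cvg_cst|exact: cvg_id]].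
have cf2 (s : R) : `|s| <= 1 -> {for s, continuous f2}.
  move=> s1; apply: cvgM; first exact: cvg_cst.
  by apply: cvgD; apply: cvgM; solve [exact: cu|exact: cu'].
have mI01 : measurable (`[0, 1]%classic : set RM) by exact: measurable_itv.
have mf2 : measurable_fun I1 f2.
  apply: subspace_continuous_measurable_fun; first exact: measurable_I1.
  by apply: continuous_in_subspaceT => s; rewrite inE => /I1P; exact: cf2.
have -> : ((u 0) ^+ 2)%:E = (\int[leb1]_(s in `[0%R, 1%R]) (f1 s)%:E)%E.
  rewrite (@ftc (fun s => (s - 1) * u s ^+ 2) f1 0 1)//.
    by congr _%:E; lra.
  move=> s /sub01 s1; split; last exact: cf1.
  have dus := du s s1; apply: is_derive_eq.
  rewrite /f1 /= /GRing.scale/=; ring.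
have int_f (f : R -> R) : (forall s : R, `|s| <= 1 -> {for s, continuous f}) ->
    lebesgue_measure.-integrable `[0, 1] (EFin \o f).
  move=> cf; apply: continuous_compact_integrable; first exact: segment_compact.
  apply: continuous_in_subspaceT => s; rewrite inE/= in_itv/= => /sub01; exact: cf.
apply: (@le_trans _ _ (\int[leb1]_(s in `[0%R, 1%R]) (f2 s)%:E)%E).
  apply: le_integral => //; [exact: int_f|exact: int_f|] => s.
  rewrite inE/= in_itv/= lee_fin /f1 /f2 => /andP[s0 s1].
  have H1 : 0 <= (u s + u' s) ^+ 2 by exact: sqr_ge0.
  have H2 : 0 <= (u s - u' s) ^+ 2 by exact: sqr_ge0.
  have H3 : 0 <= u s ^+ 2 by exact: sqr_ge0.
  have H4 : 0 <= u' s ^+ 2 by exact: sqr_ge0.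
  nra.
rewrite -ge0_integralZl_EFin//; last 3 first.
- exact: measurable_I1.
- by move=> s _; rewrite lee_fin addr_ge0// sqr_ge0.
- apply/measurable_EFinP.
  rewrite (_ : (fun _ => _) = (fun s => 2^-1 * f2 s)); last first.
    by apply/funext => s; rewrite /f2 mulrA mulVf ?mul1r.
  by apply: measurable_funM.
apply: ge0_subset_integral => //.
- exact: measurable_I1.
- by apply/measurable_EFinP.
- by move=> s _; rewrite lee_fin mulr_ge0// addr_ge0// sqr_ge0.
- by move=> s /=; rewrite in_itv/= => /sub01 /I1P.
Qed.

Definition upd n (t : T n) (i : 'I_n) (s : RM) : T n :=
  [tuple if j == i then s else tnth t j | j < n].

Lemma upd_cons0 n (a s : RM) (t : T n) :
  upd (cons_tuple (a, t)) ord0 s = cons_tuple (s, t).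
Proof.
apply: eq_from_tnth => j; rewrite tnth_mktuple.
by have [k ->|->] := unliftP ord0 j; rewrite ?tnth_cons ?tnth_cons0.
Qed.

Lemma upd_cons n (a s : RM) (t : T n) i :
  upd (cons_tuple (a, t)) (lift ord0 i) s = cons_tuple (a, upd t i s).
Proof.
apply: eq_from_tnth => j; rewrite tnth_mktuple.
have [k ->|->] := unliftP ord0 j; rewrite ?tnth_cons ?tnth_cons0//.
by rewrite tnth_mktuple (inj_eq lift_inj).
Qed.

(** A derivative has integral zero over the cube when its primitive vanishes on the two faces. The
    shift by [M] makes the integrand nonnegative, so that Tonelli suffices; [w] is a bounded
    measurable function on all tuples that represents [v] on the cube. *)
Lemma J_derivative n (i : 'I_n) (u v w : T n -> R) (M : R) :
  measurable_fun setT w -> (forall t, `|w t| <= M) -> (forall t, tcube t -> w t = v t) ->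
  (forall t (s : R), tcube t -> `|s| <= 1 ->
     is_derive s 1 (fun s : R => u (upd t i s)) (v (upd t i s)) /\
     {for s, continuous (fun s : R => v (upd t i s))}) ->
  (forall t (s : R), tcube t -> `|s| = 1 -> u (upd t i s) = 0) ->
  J (fun t => (M + w t)%:E) = (M * 2 ^+ n)%:E.
Proof.
have M0 m (w' : T m -> R) t : (forall t, `|w' t| <= M) -> 0 <= M + w' t.
  by move=> /(_ t); rewrite ler_norml; lra.
have mM m (w' : T m -> R) : measurable_fun setT w' -> measurable_fun setT (fun t => (M + w' t)%:E).
  by move=> mw; apply/measurable_EFinP; exact: measurable_funD.
elim: n i u v w => [[]//|n IH] i u v w mw wM wv duv u0.
have MM : 0 <= M.
  by apply: le_trans (wM [tuple of nseq n.+1 0]).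
have [j ij|i0] := unliftP ord0 i.
  rewrite J_cons; [|exact: mM|by move=> t; rewrite lee_fin M0].
  rewrite (eq_integral (fun=> (M * 2 ^+ n)%:E)); last first.
    move=> s; rewrite inE => I1s.
    apply: (IH j (fun t => u (cons_tuple (s, t))) (fun t => v (cons_tuple (s, t)))).
    - apply: measurableT_comp mw _; exact: measurable_cons_l.
    - by move=> t; exact: wM.
    - by move=> t Ct; apply: wv; apply/tcube_cons.
    - move=> t a Ct a1; have := duv (cons_tuple (s, t)) a _ a1.
      rewrite ij; under eq_fun do rewrite upd_cons.
      under [X in {for _, continuous X}]eq_fun do rewrite upd_cons.
      by rewrite upd_cons; apply; apply/tcube_cons.
    - by move=> t a Ct a1; rewrite -upd_cons -ij u0//; apply/tcube_cons.
  rewrite integral_cst; last exact: measurable_I1.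
  by rewrite /= leb_I1 -EFinM exprSr mulrA.
(* For the first coordinate the inner integral is the increment of M s + u from -1 to 1, which is 2
   M because u vanishes at both ends. *)
rewrite J_cons_swap; [|exact: mM|by move=> t; rewrite lee_fin M0].
rewrite (@eq_J _ _ (fun=> (M * 2)%:E)); first by rewrite J_cst ?mulr_ge0// exprS mulrA.
move=> t Ct.
transitivity (\int[leb1]_(s in `[(-1)%R, 1%R]) (M + v (cons_tuple (s, t)))%:E)%E.
  by apply: eq_integral => s; rewrite inE => I1s; rewrite wv//; apply/tcube_cons.
have C0 : tcube (cons_tuple (0, t)) by apply/tcube_cons; split => //; apply/I1P; rewrite normr0.
have duv0 (s : R) : -1 <= s <= 1 -> is_derive s 1 (fun s : R => u (cons_tuple (s, t))) (v (cons_tuple (s, t))) /\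
     {for s, continuous (fun s => v (cons_tuple (s, t)))}.
  rewrite -ler_norml => s1; have := duv (cons_tuple (0, t)) s C0 s1; rewrite i0.
  under eq_fun do rewrite upd_cons0.
  under [X in {for _, continuous X}]eq_fun do rewrite upd_cons0.
  by rewrite upd_cons0.
rewrite (@ftc (fun s => M * s + u (cons_tuple (s, t)))) /=; first last.
- move=> s /duv0[ds cs]; split; last by apply: cvgD; [exact: cvg_cst|exact: cs].
  by apply: is_derive_eq; rewrite /GRing.scale/=; ring.
- by lra.
have := u0 _ 1 C0; have := u0 _ (-1) C0; rewrite i0 !upd_cons0 normrN normr1 => -> // -> //.
by congr _%:E; lra.
Qed.

Fixpoint masks n : seq (seq bool) :=
  if n is n'.+1 then map (cons false) (masks n') ++ map (cons true) (masks n') else [:: [::]].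

Definition zero_tuple n : T n := [tuple 0 | _ < n].

Lemma tcube_zero n : tcube (zero_tuple n).
Proof. by move=> i; rewrite tnth_mktuple normr0. Qed.

Lemma zero_tuple_cons n : zero_tuple n.+1 = cons_tuple (0, zero_tuple n).
Proof.
apply: eq_from_tnth => j; rewrite tnth_mktuple.
by have [k ->|->] := unliftP ord0 j; rewrite ?tnth_cons ?tnth_cons0 ?tnth_mktuple.
Qed.

(* The mask [m] selects the coordinates in which [G m] is a derivative of
   [G (nseq n false)]. *)
Lemma J_sobolev n (G W : seq bool -> T n -> R) :
  (forall m, measurable_fun setT (W m)) -> (forall m t, tcube t -> W m t = G m t) ->
  (forall m (i : 'I_n) t (s : R), size m = n -> nth false m i = false -> tcube t -> `|s| <= 1 ->
     is_derive s 1 (fun s : R => G m (upd t i s)) (G (set_nth false m i true) (upd t i s)) /\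
     {for s, continuous (fun s : R => G (set_nth false m i true) (upd t i s))}) ->
  ((G (nseq n false) (zero_tuple n) ^+ 2)%:E <=
    (2 ^+ n)%:E * \sum_(m <- masks n) J (fun t => (W m t ^+ 2)%:E))%E.
Proof.
elim: n G W => [|n IH] G W mW WG dG.
  rewrite big_seq1 J0; last by move=> t; rewrite lee_fin sqr_ge0.
  by rewrite mul1e WG; [rewrite (tuple0 (zero_tuple 0))|case].
have m2 k (w : T k -> R) : measurable_fun setT w -> measurable_fun setT (fun t => (w t ^+ 2)%:E).
  by move=> mw; apply/measurable_EFinP; exact: measurable_funX.
have p2 k (w : T k -> R) t : (0 <= (w t ^+ 2)%:E)%E by rewrite lee_fin sqr_ge0.
have IHs b s : I1 s -> ((G (b :: nseq n false) (cons_tuple (s, zero_tuple n)) ^+ 2)%:E <=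
    (2 ^+ n)%:E * \sum_(m <- masks n) J (fun t => (W (b :: m) (cons_tuple (s, t)) ^+ 2)%:E))%E.
  move=> I1s; apply: (IH (fun m t => G (b :: m) (cons_tuple (s, t)))
                         (fun m t => W (b :: m) (cons_tuple (s, t)))).
  - move=> m; apply: measurableT_comp (mW _) _; exact: measurable_cons_l.
  - by move=> m t Ct; apply: WG; apply/tcube_cons.
  - move=> m i t a sm mi Ct a1.
    have := dG (b :: m) (lift ord0 i) (cons_tuple (s, t)) a; rewrite /= sm.
    rewrite /bump/= add0n mi.
    under eq_fun do rewrite upd_cons.
    under [X in {for _, continuous X}]eq_fun do rewrite upd_cons.
    by rewrite upd_cons; apply => //; apply/tcube_cons.
(* The one-dimensional inequality along the first axis bounds the value at the origin by integrals
   of values at (s, 0); [IHs] then bounds these on each slice. *)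
pose z := zero_tuple n.
have := @sobolev_dim1 (fun s => G (false :: nseq n false) (cons_tuple (s, z)))
               (fun s => G (true :: nseq n false) (cons_tuple (s, z))).
have H (s : R) : `|s| <= 1 -> is_derive s 1 (fun s : R => G (false :: nseq n false) (cons_tuple (s, z)))
     (G (true :: nseq n false) (cons_tuple (s, z))) /\
   {for s, continuous (fun s => G (true :: nseq n false) (cons_tuple (s, z)))}.
  move=> s1; have := dG (nseq n.+1 false) ord0 (cons_tuple (0, z)) s; rewrite size_nseq upd_cons0/=.
  under eq_fun do rewrite upd_cons0.
  under [X in {for _, continuous X}]eq_fun do rewrite upd_cons0.
  apply => //; apply/tcube_cons; split; first by apply/I1P; rewrite normr0.
  exact: tcube_zero.
move=> /(_ (fun s s1 => (H s s1).1) (fun s s1 => (H s s1).2)).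
rewrite -zero_tuple_cons => /le_trans; apply.
rewrite exprS EFinM -muleA; rewrite lee_pmul2l//.
pose S b s := (\sum_(m <- masks n) J (fun t => (W (b :: m) (cons_tuple (s, t)) ^+ 2)%:E))%E.
have mJ b m : measurable_fun setT (fun s => J (fun t => (W (b :: m) (cons_tuple (s, t)) ^+ 2)%:E)).
  by apply: (@measurable_J _ (fun t => (W (b :: m) t ^+ 2)%:E)) => //; exact: m2.
have mS b : measurable_fun setT (S b).
  by apply: emeasurable_sum => m; exact: mJ.
have S0 b s : (0 <= S b s)%E by apply: sume_ge0 => m _; exact: J_ge0.
have ES b : (\int[leb1]_(s in I1) S b s = \sum_(m <- masks n) J (fun t => (W (b :: m) t ^+ 2)%:E))%E.
  rewrite ge0_integral_sum//; last 3 first.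
  - exact: measurable_I1.
  - by move=> m; exact: measurable_funS (mJ b m).
  - by move=> m s _; exact: J_ge0.
  by apply: eq_bigr => m _; rewrite J_cons//; exact: m2.
rewrite big_cat !big_map /= -!ES -ge0_integralD//; last 3 first.
- exact: measurable_I1.
- exact: measurable_funS (mS _).
- exact: measurable_funS (mS _).
rewrite -ge0_integralZl_EFin//; last 3 first.
- exact: measurable_I1.
- by move=> s _; rewrite adde_ge0.
- by apply: emeasurable_funD; exact: measurable_funS (mS _).
have cG b (s : R) : `|s| <= 1 -> {for s, continuous (fun s => G (b :: nseq n false) (cons_tuple (s, z)))}.
  move=> /H[d c]; case: b => //.
  by have [] := d => /derivable1_diffP/differentiable_continuous.
apply: ge0_le_integral => //.
- exact: measurable_I1.
- by move=> s _; rewrite lee_fin addr_ge0// sqr_ge0.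
- apply/measurable_EFinP; apply: subspace_continuous_measurable_fun; first exact: measurable_I1.
  apply: continuous_in_subspaceT => s; rewrite inE => /I1P s1.
  by apply: cvgD; apply: cvgM; exact: cG.
- apply: measurable_funeM; apply: emeasurable_funD; exact: measurable_funS (mS _).
- by move=> s I1s; rewrite EFinD ge0_muleDr//; apply: leeD; exact: IHs.
Qed.

(** * Affine changes of variables *)

Section affine.
Local Open Scope ereal_scope.

(** The image of Lebesgue measure under the affine map, multiplied by [r], gives half-open intervals
    their length, and Lebesgue measure is unique with this property. *)
Lemma integral_affine (a r : R) (f : RM -> \bar R) : (0 < r)%R ->
  measurable_fun setT f -> (forall s, 0 <= f s) ->
  \int[leb1]_s f (a + r * s)%R = r^-1%:E * \int[leb1]_s f s.
Proof.
move=> r0 mf f0.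
have mphi : measurable_fun setT (fun s : RM => (a + r * s)%R : RM).
  by apply: measurable_funD => //; exact: measurable_funM.
pose m := mscale (NngNum (ltW r0)) (pushforward leb1 (fun s : RM => (a + r * s)%R : RM)).
have leb_m A : measurable A -> leb1 A = m mphi A.
  apply: lebesgue_measure_unique => _ [[x y] /= _ <-].
  rewrite /m /mscale/= /pushforward.
  rewrite (_ : _ @^-1` _ = `](x - a) / r, (y - a) / r]%classic)%R; last first.
    apply/seteqP; split => s /=; rewrite !in_itv/= ltr_pdivrMr// ler_pdivlMr//;
      by move=> /andP[? ?]; apply/andP; split; lra.
  rewrite !lebesgue_measure_itv/= !lte_fin ltr_pM2r ?invr_gt0// ltrD2r.
  case: ifP => _; last by rewrite mule0.
  rewrite -!EFinB -EFinM -mulrBl opprB addrA subrK; congr _%:E.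
  by rewrite mulrC divfK ?gt_eqF.
have -> : \int[leb1]_s f s = \int[m mphi]_s f s.
  by apply: eq_measure_integral => A mA _; exact: leb_m.
rewrite ge0_integral_mscale//= ge0_integral_pushforward//= preimage_setT.
by rewrite muleA -EFinM mulVf ?gt_eqF// mul1e.
Qed.

Definition affine_tuple n (a : T n) (r : R) (t : T n) : T n :=
  [tuple (tnth a i + r * tnth t i)%R | i < n].

Lemma affine_tuple_cons n (a : T n) (r a0 s : R) (t : T n) :
  affine_tuple (cons_tuple (a0, a)) r (cons_tuple (s, t)) = cons_tuple ((a0 + r * s)%R, affine_tuple a r t).
Proof.
apply: eq_from_tnth => j; rewrite tnth_mktuple.
by have [k ->|->] := unliftP ord0 j; rewrite ?tnth_cons ?tnth_cons0 ?tnth_mktuple.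
Qed.

Lemma measurable_affine_tuple n (a : T n) r : measurable_fun setT (affine_tuple a r).
Proof.
apply/measurable_fun_tnthP => i.
rewrite (_ : _ \o _ = fun t : T n => (tnth a i + r * tnth t i)%R); last first.
  by apply/funext => t /=; rewrite tnth_mktuple.
apply: measurable_funD => //; apply: measurable_funM => //; exact: measurable_tnth.
Qed.

Lemma integral_affine_tuple n (a : T n) (r : R) (g : T n -> \bar R) : (0 < r)%R ->
  measurable_fun setT g -> (forall t, 0 <= g t) ->
  \int[tuple_leb R n]_t g (affine_tuple a r t) = (r ^- n)%:E * \int[tuple_leb R n]_t g t.
Proof.
move=> r0; elim: n a g => [|n IH] a g mg g0.
  rewrite expr0 invr1 mul1e; apply: eq_integral => t _.
  by rewrite (tuple0 t) (tuple0 (affine_tuple _ _ _)).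
have r'0 : (0 <= r ^- n)%R by rewrite invr_ge0 exprn_ge0// ltW.
move: r'0; set k := (r ^- n)%R => k0.
rewrite tonelli_tuple1//; last first.
  by apply: measurableT_comp mg _; exact: measurable_affine_tuple.
rewrite (tonelli_tuple1 mg g0) [a]cons_tuple_eta; set a0 := thead a; set a' := [tuple of _].
under eq_integral => s _.
  under eq_integral do rewrite affine_tuple_cons.
  rewrite (IH a' (fun t => g (cons_tuple ((a0 + r * s)%R, t)))); first over.
    by apply: measurableT_comp mg _; exact: measurable_cons_l.
  by move=> t; exact: g0.
have mT := measurable_tonelli1 mg g0.
rewrite ge0_integralZl_EFin; last 4 first.
- exact: measurableT.
- by move=> s _; exact: integral_ge0.
- apply: (measurableT_comp mT).
  by apply: measurable_funD => //; exact: measurable_funM.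
- exact: k0.
rewrite (integral_affine a0 r0 mT); last by move=> s; exact: integral_ge0.
by rewrite muleA -EFinM /k exprSr invfM mulrC.
Qed.
End affine.

Lemma measurable_row d (g : borel 'rV[R]_d -> \bar R) : measurable_fun setT g ->
  measurable_fun setT (g \o @row_of_tuple R d).
Proof. by move=> mg; exact: measurableT_comp mg (@measurable_row_of_tuple R d). Qed.

Lemma integral_leb d (g : borel 'rV[R]_d -> \bar R) : measurable_fun setT g ->
  (forall x, 0 <= g x)%E ->
  (\int[@leb R d]_x g x = \int[tuple_leb R d]_t g (row_of_tuple t))%E.
Proof.
move=> mg g0; rewrite /leb ge0_integral_pushforward//.
exact: measurable_row_of_tuple.
Qed.

Definition tuple_of_row d (x : 'rV[R]_d) : T d := [tuple x ord0 i | i < d].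

Lemma tuple_of_rowK d (x : 'rV[R]_d) : row_of_tuple (tuple_of_row x) = x.
Proof. by apply/rowP => i; rewrite mxE tnth_mktuple. Qed.

Lemma row_affine_tuple d (a : 'rV[R]_d) (r : R) t :
  row_of_tuple (affine_tuple (tuple_of_row a) r t) = a + r *: row_of_tuple t.
Proof. by apply/rowP => i; rewrite !mxE !tnth_mktuple. Qed.

Lemma row_upd d (t : T d) i (s : R) :
  row_of_tuple (upd t i s) = s *: (delta_mx ord0 i : 'rV[R]_d) + row_of_tuple (upd t i 0).
Proof.
apply/rowP => j; rewrite !mxE !tnth_mktuple eqxx/=.
by case: eqP; rewrite ?mulr1 ?mulr0 ?addr0 ?add0r.
Qed.

Lemma integral_leb_affine d (a : 'rV[R]_d) (r : R) (g : borel 'rV[R]_d -> \bar R) : 0 < r ->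
  measurable_fun setT g -> (forall x, 0 <= g x)%E ->
  (\int[tuple_leb R d]_t g (a + r *: row_of_tuple t)%R = (r ^- d)%:E * \int[@leb R d]_x g x)%E.
Proof.
move=> r0 mg g0; rewrite integral_leb//.
under eq_integral do rewrite -row_affine_tuple.
apply: (@integral_affine_tuple _ _ r (g \o @row_of_tuple R d)) => //; first exact: measurable_row.
by move=> t; exact: g0.
Qed.

End Tuples.

(** * Interior elliptic estimates *)

Section Elliptic.
Variables (R : realType) (d : nat).
Local Notation V := 'rV[R]_d.
Local Notation T := (d.-tuple (measurableTypeR R)).
Local Notation e_ i := (delta_mx ord0 i : V).
Local Notation row := (@row_of_tuple R d).
Implicit Types (f g : V -> R) (W : set V).

Definition Q1 : set V := cube 0 1.

Lemma Q1P x : Q1 x <-> forall i, `|x ord0 i| <= 1.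
Proof. by split=> H i; have := H i; rewrite mxE subr0. Qed.

Lemma Q1_row t : Q1 (row t) <-> tcube t.
Proof. by split=> H i; have := H i; rewrite !mxE subr0. Qed.

Lemma cube_compact (r : R) : compact (cube (0 : V) r).
Proof.
rewrite (_ : cube 0 r = [set v : V | forall i, `[(- r), r]%classic (v ord0 i)]).
  by apply: (@rV_compact _ _ (fun=> `[(-r), r]%classic)) => _; exact: segment_compact.
by apply/seteqP; split => x /= H i; have := H i; rewrite in_itv/= mxE subr0 ler_norml.
Qed.

Lemma Q1_bounded f : (forall x, Q1 x -> {for x, continuous f}) ->
  exists M, forall x, Q1 x -> `|f x| <= M.
Proof.
move=> cf; have Q10 : Q1 !=set0 by exists 0; apply/Q1P => i; rewrite mxE normr0.
have [|c _ Hc] := @compact_EVT_max _ R (fun x => `|f x|) _ Q10 (@cube_compact 1).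
  apply: continuous_in_subspaceT => x; rewrite inE => Qx.
  exact: (cvg_norm (cf _ Qx)).
by exists `|f c| => x Qx; apply: Hc; rewrite inE.
Qed.

Definition solution W (lam : R) f :=
  [/\ open W, smooth_on W f & forall x, W x -> - laplacian f x = lam * f x].

Lemma is_derive_line_row f (t : T) i (s df : R) :
  is_derive (row (upd t i s)) (e_ i) f df ->
  is_derive s 1 (fun s : R => f (row (upd t i s))) df.
Proof.
rewrite row_upd => /is_derive_lineP; under [X in _ -> is_derive _ _ X _]eq_fun do rewrite row_upd.
exact.
Qed.

Lemma continuous_line_row f (t : T) i (s : R) :
  {for row (upd t i s), continuous f} ->
  {for s, continuous (fun s : R => f (row (upd t i s)))}.
Proof.
rewrite row_upd => cf; under [X in {for _, continuous X}]eq_fun do rewrite row_upd.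
apply: (@continuous_comp _ _ _ (fun s : R => s *: e_ i + row (upd t i 0)) f) cf.
apply: (@continuousD _ _ _ (fun s : R => s *: e_ i) (cst (row (upd t i 0))) s).
  exact: scalel_continuous.
exact: cst_continuous.
Qed.

Lemma tcube_upd (t : T) i (s : R) : tcube t -> `|s| <= 1 -> tcube (upd t i s).
Proof. by move=> Ct s1 j; rewrite tnth_mktuple; case: eqP. Qed.

Lemma measurable_patch_row f W : open W -> (forall x, W x -> {for x, continuous f}) ->
  measurable_fun setT (fun t : T => (f \_ W) (row t)).
Proof.
move=> oW cf; have mf := open_continuous_borel oW cf.
exact: (measurableT_comp mf (@measurable_row_of_tuple R d)).
Qed.

Section weight.
(* A weight vanishing on the faces of the cube plays the role of a cutoff function. *)
Definition eta (x : V) : R := \prod_j (1 - x ord0 j ^+ 2).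
Definition deta i (x : V) : R := - (2 * x ord0 i) * \prod_(j | j != i) (1 - x ord0 j ^+ 2).

Lemma is_derive_coord x i j : is_derive x (e_ i) (fun y : V => y ord0 j) (j == i)%:R.
Proof.
have -> : x = 0 *: e_ i + x by rewrite scale0r add0r.
apply/is_derive_lineP.
rewrite (_ : (fun _ => _) = (fun u : R => u * (j == i)%:R + x ord0 j)).
  by apply: is_derive_eq; rewrite /GRing.scale/=; ring.
by apply/funext => u; rewrite !mxE eqxx/= eq_sym.
Qed.

Lemma continuous_prod (X : topologicalType) (I : Type) (r : seq I) (P : pred I) (F : I -> X -> R) :
  (forall i, continuous (F i)) -> continuous (fun x => \prod_(i <- r | P i) F i x).
Proof.
move=> cF x; elim: r => [|i r IH].
  by under eq_fun do rewrite big_nil; exact: cvg_cst.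
under eq_fun do rewrite big_cons; case: (P i) => //.
by apply: cvgM; [exact: cF|exact: IH].
Qed.

Lemma fac_continuous j : continuous (fun x : V => 1 - x ord0 j ^+ 2).
Proof.
move=> x; apply: (@continuousB _ _ _ (cst 1 : V -> R^o) (fun x : V => x ord0 j ^+ 2) x).
  exact: cst_continuous.
by apply: (@continuousM _ _ (fun x : V => x ord0 j) (fun x : V => x ord0 j));
  exact: coord_continuous.
Qed.

Lemma eta_continuous : continuous eta.
Proof. by apply: continuous_prod => i; exact: fac_continuous. Qed.

Lemma deta_continuous i : continuous (deta i).
Proof.
move=> x; apply: (@continuousM _ _ (fun x : V => - (2 * x ord0 i)) (fun x : V =>
  \prod_(j | j != i) (1 - x ord0 j ^+ 2))).
  apply: (@continuousN _ _ _ (fun x : V => 2 * x ord0 i : R^o)).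
  apply: (@continuousM _ _ (cst 2) (fun x : V => x ord0 i)); first exact: cst_continuous.
  exact: coord_continuous.
by apply: continuous_prod => j; exact: fac_continuous.
Qed.

Lemma is_derive_eta x i : is_derive x (e_ i) eta (deta i x).
Proof.
rewrite -[X in is_derive X]add0r -[X in is_derive (X + _)](scale0r (e_ i)).
apply/is_derive_lineP.
pose p := \prod_(j | j != i) (1 - x ord0 j ^+ 2).
have H (a : R) : is_derive (0 : R) 1 (fun u : R => (1 - (u + a) ^+ 2) * p) (- (2 * a) * p).
  by apply: is_derive_eq; rewrite /= /GRing.scale/=; ring.
rewrite (_ : (fun _ => _) = (fun u : R => (1 - (u + x ord0 i) ^+ 2) * p)); first exact: H.
apply/funext => u; rewrite /eta (bigD1 i)//=; congr (_ * _).
  by rewrite !mxE !eqxx mulr1.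
by apply: eq_bigr => j ji; rewrite !mxE (negbTE ji) andbF mulr0 add0r.
Qed.

Let fac (x : V) j : Q1 x -> 0 <= 1 - x ord0 j ^+ 2 <= 1.
Proof.
move=> /Q1P/(_ j); rewrite ler_norml => /andP[a b].
have H : 0 <= x ord0 j ^+ 2 by exact: sqr_ge0.
apply/andP; split; nra.
Qed.

Let prod01 (P : pred 'I_d) (x : V) : Q1 x -> 0 <= \prod_(j | P j) (1 - x ord0 j ^+ 2) <= 1.
Proof.
move=> Qx; apply: (big_ind (fun y : R => 0 <= y <= 1)) => [|y z|j _]; last exact: fac.
  by rewrite ler01 lexx.
by move=> /andP[y0 y1] /andP[z0 z1]; rewrite mulr_ge0// mulr_ile1.
Qed.

Lemma eta01 x : Q1 x -> 0 <= eta x <= 1. Proof. exact: prod01. Qed.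

Lemma deta2 x i : Q1 x -> deta i x ^+ 2 <= 4.
Proof.
move=> Qx; have /andP[p0 p1] := prod01 (fun j => j != i) Qx.
rewrite /deta exprMn sqrrN exprMn; have /andP[a _] := fac i Qx.
have b : 0 <= x ord0 i ^+ 2 by exact: sqr_ge0.
move: p0 p1; set p := \prod_(_ | _) _ => p0 p1.
have : 0 <= p ^+ 2 <= 1 by rewrite sqr_ge0 exprn_ile1.
move: (p ^+ 2) (x ord0 i ^+ 2) a b => P X a b /andP[P0 P1].
have : X * P <= 1 by rewrite -[leRHS]mul1r ler_pM//; lra.
lra.
Qed.

Lemma eta0 (x : V) i : `|x ord0 i| = 1 -> eta x = 0.
Proof.
by move=> x1; rewrite /eta (bigD1 i)//= -[x ord0 i ^+ 2]real_normK ?num_real// x1 expr1n subrr mul0r.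
Qed.

(** On the half cube each of the [d] factors is at least 1 - 1/4. Squaring the reciprocal gives the
    constant (16/9)^d of Caccioppoli's inequality. *)
Lemma eta_half x : Q1 x -> (3 / 4) ^+ d <= eta (2^-1 *: x).
Proof.
move=> /Q1P Qx; rewrite -[X in _ ^+ X]card_ord -prodr_const /eta.
apply: ler_prod => j _; apply/andP; split; first by lra.
have := Qx j; rewrite mxE ler_norml => /andP[a b].
have : x ord0 j ^+ 2 <= 1 by rewrite -real_normK ?num_real// exprn_ile1.
rewrite exprMn; lra.
Qed.

End weight.

(** For r > 0 this is r^-d times the squared L^2 norm on the cube of half-side [r]: cubes of all
    sizes are pulled back to the unit one. *)
Definition energy W (r : R) f : \bar R := J (fun t : T => ((f \_ W) (r *: row t) ^+ 2)%:E).

Lemma measurable_scale_row f W (r : R) : open W -> (forall x, W x -> {for x, continuous f}) ->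
  measurable_fun setT (fun t : T => (f \_ W) (r *: row t)).
Proof.
move=> oW cf; have H := measurable_patch_row oW cf.
have := measurableT_comp H (@measurable_affine_tuple R d (tuple_of_row 0) r).
by apply: eq_measurable_fun => t _ /=; rewrite row_affine_tuple add0r.
Qed.

Lemma measurable_sqr (g : T -> R) : measurable_fun setT g ->
  measurable_fun setT (fun t : T => (g t ^+ 2)%:E).
Proof. by move=> mg; apply/measurable_EFinP; exact: measurable_funX. Qed.

(** * Caccioppoli's inequality *)

Section caccioppoli.
Variables (W : set V) (lam Lam : R) (f : V -> R).
Hypotheses (sol : solution W lam f) (QW : Q1 `<=` W) (lamLam : `|lam| <= Lam).

Let oW : open W. Proof. by case: sol. Qed.
Let sf : smooth_on W f. Proof. by case: sol. Qed.

Let D i := partials [:: i] f.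
Let DD i := partials [:: i; i] f.
(** The vector field eta^2 f grad f. It vanishes on the faces of the cube, so its divergence, with
    terms [v i], has integral zero there. *)
Let u i (x : V) : R := eta x * (eta x * (f x * D i x)).
Let v i (x : V) : R := 2 * (eta x * deta i x * (f x * D i x)) +
  eta x ^+ 2 * (D i x ^+ 2 + f x * DD i x).

Let is_derive_u i x : W x -> is_derive x (e_ i) (u i) (v i x).
Proof.
move=> Wx; have H1 := is_derive_eta x i.
have H2 := smooth_on_derive i [::] sf Wx.
have H3 := smooth_on_derive i [:: i] sf Wx.
have H4 := is_deriveM H1 (is_deriveM H1 (is_deriveM H2 H3)).
apply: (is_derive_eq H4).
change (eta x * (eta x * (f x * DD i x + D i x * D i x) + f x * D i x * deta i x) +
  eta x * (f x * D i x) * deta i x = v i x); rewrite /v; ring.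
Qed.

Let cont_v i x : W x -> {for x, continuous (v i)}.
Proof.
move=> Wx; have cf := smooth_on_continuous (s := [::]) sf Wx.
have cD := smooth_on_continuous (s := [:: i]) sf Wx.
have cDD := smooth_on_continuous (s := [:: i; i]) sf Wx.
have ce := @eta_continuous x; have cde := @deta_continuous i x.
have cfD := continuousM cf cD.
apply: (@continuousD _ _ _ (fun x => 2 * (eta x * deta i x * (f x * D i x)) : R^o)).
  apply: (@continuousM _ _ (cst 2)); first exact: cst_continuous.
  exact: continuousM (continuousM ce cde) cfD.
exact: continuousM (continuousM ce ce) (continuousD (continuousM cD cD) (continuousM cf cDD)).
Qed.

(** Patched twice: on [W] for measurability, on the cube for boundedness, the two requirements of
    [J_derivative]. *)
Let w i (t : T) : R := ((fun t => (v i \_ W) (row t)) \_ (@tcube R d)) t.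

Let wE i t : tcube t -> w i t = v i (row t).
Proof.
by move=> Ct; rewrite /w patchE mem_set// patchE mem_set//; apply/QW/Q1_row.
Qed.

Let mw i : measurable_fun setT (w i).
Proof.
apply/(measurable_restrictT _ (@measurable_tcube R d)).
apply: measurable_funS (measurable_patch_row oW (@cont_v i)) => //.
Qed.

Let M i := sval (cid (Q1_bounded (fun x Qx => @cont_v i x (QW Qx)))).

Let MP i x : Q1 x -> `|v i x| <= M i.
Proof. exact: svalP (cid (Q1_bounded (fun x Qx => @cont_v i x (QW Qx)))) x. Qed.

Let Q10 : Q1 0. Proof. by apply/Q1P => i; rewrite mxE normr0. Qed.

Let M0 i : 0 <= M i. Proof. exact: le_trans (MP i Q10). Qed.

Let wM i t : `|w i t| <= M i.
Proof.
have [Ct|nC] := pselect (tcube t); first by rewrite wE//; apply/MP/Q1_row.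
by rewrite /w patchE memNset// normr0.
Qed.

Let J_w i : J (fun t => (M i + w i t)%:E) = (M i * 2 ^+ d)%:E.
Proof.
apply: (@J_derivative _ _ i (fun t => u i (row t)) (fun t => v i (row t))) => //.
- by move=> t; exact: wE.
- move=> t s Ct s1; have Wr : W (row (upd t i s)) by apply/QW/Q1_row/tcube_upd.
  split; first exact/is_derive_line_row/is_derive_u.
  exact/continuous_line_row/cont_v.
- move=> t s Ct s1; rewrite /u (@eta0 _ i) ?mul0r//.
  by rewrite mxE tnth_mktuple eqxx.
Qed.

(** In the divergence the equation replaces [f * laplacian f] by [- lam * f ^ 2]. Young's inequality
    absorbs the cross term: 2 |eta deta f D| is at most (eta D)^2 / 2 + 2 (deta f)^2, and deta^2 <=
    4 produces the 8 for each coordinate. *)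
Let pointwise j x : Q1 x ->
  2^-1 * (eta x * D j x) ^+ 2 <= \sum_i v i x + (Lam + 8 * d%:R) * f x ^+ 2.
Proof.
move=> Qx; have Wx := QW Qx.
have Ev : \sum_i v i x = \sum_i (2 * (eta x * deta i x * (f x * D i x)) + eta x ^+ 2 * D i x ^+ 2)
    - lam * (eta x ^+ 2 * f x ^+ 2).
  have [_ _ /(_ x Wx) lapE] := sol.
  have -> : lam * (eta x ^+ 2 * f x ^+ 2) = - (eta x ^+ 2 * f x * laplacian f x).
    by rewrite -[RHS]mulrN lapE; ring.
  rewrite opprK /laplacian mulr_sumr -big_split/=; apply: eq_bigr => i _.
  rewrite -[partial i (partial i f) x]/(DD i x) /v; ring.
rewrite Ev.
have e01 := eta01 Qx.
have e2 : 0 <= eta x ^+ 2 <= 1 by rewrite sqr_ge0/=; case/andP: e01 => *; exact: exprn_ile1.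
have f2 : 0 <= f x ^+ 2 by exact: sqr_ge0.
have H1 : lam * (eta x ^+ 2 * f x ^+ 2) <= Lam * f x ^+ 2.
  have L0 : 0 <= Lam by exact: le_trans lamLam.
  apply: (@le_trans _ _ (Lam * (eta x ^+ 2 * f x ^+ 2))).
    apply: ler_wpM2r; first by case/andP: e2 => *; exact: mulr_ge0.
    exact: le_trans (ler_norm _) lamLam.
  by apply: ler_wpM2l => //; case/andP: e2 => _ ?; exact: ler_piMl.
have H2 : \sum_i (2^-1 * (eta x * D i x) ^+ 2 - 8 * f x ^+ 2) <=
    \sum_i (2 * (eta x * deta i x * (f x * D i x)) + eta x ^+ 2 * D i x ^+ 2).
  apply: ler_sum => i _; have d2 := deta2 i Qx.
  have H : 0 <= (eta x * D i x + 2 * (deta i x * f x)) ^+ 2 by exact: sqr_ge0.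
  have H' : deta i x ^+ 2 * f x ^+ 2 <= 4 * f x ^+ 2 by exact: ler_wpM2r.
  move: H H'; move: (eta x) (deta i x) (f x) (D i x) => a b c e H H'.
  nra.
have H3 : 2^-1 * (eta x * D j x) ^+ 2 - 8 * d%:R * f x ^+ 2 <=
    \sum_i (2^-1 * (eta x * D i x) ^+ 2 - 8 * f x ^+ 2).
  rewrite sumrB sumr_const card_ord -mulrnAl lerB//; last by rewrite mulr_natr.
  rewrite (bigD1 j)//= lerDl sumr_ge0// => i _.
  by rewrite mulr_ge0 ?sqr_ge0.
lra.
Qed.

Lemma caccioppoli_weighted j :
  (J (fun t => ((eta (row t) * (D j \_ W) (row t)) ^+ 2)%:E) <=
  (2 * (Lam + 8 * d%:R))%:E * energy W 1 f)%E.
Proof.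
have L0 : 0 <= Lam by exact: le_trans lamLam.
have C0 : 0 <= Lam + 8 * d%:R by rewrite addr_ge0// mulr_ge0.
have mD : measurable_fun setT (fun t : T => (eta (row t) * (D j \_ W) (row t))).
  apply: measurable_funM; last first.
    by apply: measurable_patch_row => // x Wx; exact: smooth_on_continuous sf Wx.
  have := @measurable_patch_row eta setT openT (fun x _ => @eta_continuous x).
  by rewrite patch_setT.
have mf : measurable_fun setT (fun t : T => (f \_ W) (1 *: row t)).
  by apply: measurable_scale_row => // x Wx; exact: (smooth_on_continuous (s := [::]) sf Wx).
(* [S] is the integral of the shifts [M i]. Being finite, it can be added to both sides to make all
   integrands nonnegative, and cancelled afterwards. *)
pose S := (\sum_i M i * 2 ^+ d)%:E.
pose g (t : T) := (2^-1%:E * ((eta (row t) * (D j \_ W) (row t)) ^+ 2)%:E)%E.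
have g0 t : (0 <= g t)%E by rewrite /g -EFinM lee_fin mulr_ge0 ?sqr_ge0.
have mg : measurable_fun setT g by apply: measurable_funeM; exact: measurable_sqr.
pose h (t : T) := (\sum_(i < d) (M i + w i t)%:E)%E.
have Mw0 i t : 0 <= M i + w i t by have := wM i t; rewrite ler_norml; lra.
have h0 t : (0 <= h t)%E by apply: sume_ge0 => i _; rewrite lee_fin.
have mMw i : measurable_fun setT (fun t => (M i + w i t)%:E).
  by apply/measurable_EFinP; exact: measurable_funD.
have mh : measurable_fun setT h by exact: emeasurable_sum.
have Jh : J h = S.
  rewrite /J ge0_integral_sum//.
  - by rewrite /S -sumEFin; apply: eq_bigr => i _; exact: J_w.
  - exact: measurable_tcube.
  - by move=> i; exact: measurable_funS (mMw i).
  - by move=> i t _; rewrite lee_fin.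
have SM : J (fun _ : T => (\sum_i M i)%:E) = S.
  by rewrite J_cst ?mulr_suml// sumr_ge0.
have le1 : (J g + S <= (Lam + 8 * d%:R)%:E * energy W 1 f + S)%E.
  rewrite -{1}SM -{1}Jh /energy -JZ; last 3 first.
  - exact: C0.
  - exact: measurable_sqr.
  - by move=> t; rewrite lee_fin sqr_ge0.
  rewrite -!JD//; last 3 first.
  - by apply: measurable_funeM; exact: measurable_sqr.
  - by move=> t; rewrite -EFinM lee_fin mulr_ge0 ?sqr_ge0.
  - by move=> t; rewrite lee_fin sumr_ge0.
  apply: le_J => //.
  - exact: emeasurable_funD.
  - apply: emeasurable_funD => //.
    by apply: measurable_funeM; exact: measurable_sqr.
  - by move=> t _; rewrite adde_ge0// lee_fin sumr_ge0.
  move=> t Ct; have Qt : Q1 (row t) by exact/Q1_row.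
  have Wt := QW Qt.
  rewrite /g /h scale1r !patchE !mem_set// sumEFin -!EFinM -!EFinD lee_fin big_split/=.
  under [X in _ <= _ + (_ + X)]eq_bigr do rewrite wE//.
  have := pointwise j Qt; lra.
rewrite leeD2rE// in le1.
have -> : J (fun t => ((eta (row t) * (D j \_ W) (row t)) ^+ 2)%:E) = (2%:E * J g)%E.
  rewrite -JZ//; apply: eq_J => t _.
  by rewrite /g -!EFinM mulrA divff// mul1r.
by rewrite EFinM -muleA lee_pmul2l.
Qed.

End caccioppoli.

Lemma tcube_half (t : T) : tcube t -> tcube (affine_tuple (tuple_of_row 0) 2^-1 t).
Proof.
by move=> Ct i; have := Ct i; rewrite !tnth_mktuple mxE add0r !ler_norml; lra.
Qed.

(** Halving maps the cube into itself, and 2^d is the inverse Jacobian. *)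
Lemma J_half (G : T -> \bar R) : measurable_fun setT G -> (forall t, 0 <= G t)%E ->
  (J (fun t => G (affine_tuple (tuple_of_row 0) 2^-1 t)) <= (2 ^+ d)%:E * J G)%E.
Proof.
move=> mG G0; pose a := @affine_tuple R d (tuple_of_row 0) 2^-1.
have mP := measurable_patch_tcube mG.
have P0 := @patch_tcube_ge0 R d G G0.
have mPa : measurable_fun setT ((G \_ (@tcube R d)) \o a).
  by apply: measurableT_comp mP _; exact: measurable_affine_tuple.
apply: (@le_trans _ _ (J ((G \_ (@tcube R d)) \o a))).
  apply: le_J => //.
  - by apply: measurableT_comp mG _; exact: measurable_affine_tuple.
  - by move=> t Ct /=; rewrite patchE mem_set//; exact: tcube_half.
apply: (@le_trans _ _ (\int[tuple_leb R d]_t (G \_ (@tcube R d)) (a t))%E).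
  apply: (@ge0_subset_integral _ _ _ (tuple_leb R d) (@tcube R d) setT) => //.
    exact: measurable_tcube.
  by move=> t _; exact: P0.
by rewrite integral_affine_tuple// exprVn invrK /J [in leRHS]integral_mkcond.
Qed.

Lemma row_scale (r : R) (t : T) : row (affine_tuple (tuple_of_row 0) r t) = r *: row t.
Proof. by rewrite row_affine_tuple add0r. Qed.

Lemma energy_half W r f : open W -> (forall x, W x -> {for x, continuous f}) ->
  (energy W (r * 2^-1) f <= (2 ^+ d)%:E * energy W r f)%E.
Proof.
move=> oW cf.
rewrite {1}/energy (_ : (fun t => _) =
    (fun t => ((f \_ W) (r *: row (affine_tuple (tuple_of_row 0) 2^-1 t)) ^+ 2)%:E)); last first.
  by apply/funext => t; rewrite row_scale scalerA.
apply: (@J_half (fun t => ((f \_ W) (r *: row t) ^+ 2)%:E)).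
  by apply: measurable_sqr; exact: measurable_scale_row.
by move=> t; rewrite lee_fin sqr_ge0.
Qed.

(** The three factors come from [eta_half], [J_half] and [caccioppoli_weighted], in this order. *)
Definition caccioppoli_cst (Lam : R) : R := (16 / 9) ^+ d * (2 ^+ d * (2 * (Lam + 8 * d%:R))).

Lemma caccioppoli W lam Lam f j : solution W lam f -> Q1 `<=` W -> `|lam| <= Lam ->
  (energy W 2^-1 (partials [:: j] f) <= (caccioppoli_cst Lam)%:E * energy W 1 f)%E.
Proof.
move=> sol QW lamLam; have [oW sf _] := sol.
have cD x : W x -> {for x, continuous (partials [:: j] f)}.
  by move=> Wx; exact: smooth_on_continuous sf Wx.
pose g t := eta (row t) * ((partials [:: j] f) \_ W) (row t).
have mg : measurable_fun setT g.
  apply: measurable_funM; last exact: measurable_patch_row.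
  have := @measurable_patch_row eta setT openT (fun x _ => @eta_continuous x).
  by rewrite patch_setT.
have mg2 := measurable_sqr mg.
have g20 t : (0 <= (g t ^+ 2)%:E)%E by rewrite lee_fin sqr_ge0.
rewrite /caccioppoli_cst EFinM -muleA EFinM -muleA.
apply: (@le_trans _ _ (((16 / 9) ^+ d)%:E * ((2 ^+ d)%:E * J (fun t => (g t ^+ 2)%:E)))%E); last first.
  apply: lee_wpmul2l; first by rewrite lee_fin exprn_ge0// divr_ge0.
  apply: lee_wpmul2l; first by rewrite lee_fin exprn_ge0.
  exact: (caccioppoli_weighted sol QW lamLam).
apply: (@le_trans _ _ (((16 / 9) ^+ d)%:E *
    J (fun t => (g (affine_tuple (tuple_of_row 0) 2^-1 t) ^+ 2)%:E))%E); last first.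
  apply: lee_wpmul2l; first by rewrite lee_fin exprn_ge0// divr_ge0.
  exact: (J_half mg2 g20).
have mga : measurable_fun setT (fun t => (g (affine_tuple (tuple_of_row 0) 2^-1 t) ^+ 2)%:E).
  by apply: (measurableT_comp mg2); exact: measurable_affine_tuple.
rewrite -JZ//.
apply: le_J.
- by apply: measurable_sqr; exact: measurable_scale_row.
- exact: measurable_funeM.
- by move=> t _; rewrite lee_fin sqr_ge0.
move=> t Ct; rewrite -EFinM lee_fin /g row_scale [X in _ * X]exprMn mulrA ler_peMl ?sqr_ge0//.
have Qt : Q1 (row t) by exact/Q1_row.
have := eta_half Qt => H.
rewrite (_ : 16 / 9 = (3 / 4)^-1 ^+ 2 :> R); last by lra.
have p0 : 0 < (3 / 4 : R) ^+ d by rewrite exprn_gt0//; lra.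
rewrite -exprM mulnC exprM -exprMn exprVn; apply: exprn_ege1.
by rewrite mulrC ler_pdivlMr// mul1r.
Qed.

Lemma Q1_scale (r : R) x : 0 <= r <= 1 -> Q1 x -> Q1 (r *: x).
Proof.
move=> /andP[r0 r1] /Q1P Qx; apply/Q1P => i; rewrite mxE normrM ger0_norm//.
by rewrite mulr_ile1.
Qed.

Lemma solution_affine W lam f (a : V) (r : R) : solution W lam f ->
  solution [set y | W (a + r *: y)] (r ^+ 2 * lam) (fun y => f (a + r *: y)).
Proof.
move=> [oW sf lap]; have [oB sB E] := smooth_on_affine a r oW sf.
split=> // x Wx; rewrite -mulrA -(lap _ Wx) mulrN /laplacian mulr_sumr.
by congr (- _); apply: eq_bigr => i _; rewrite E.
Qed.

(** Dilating by [r] multiplies the eigenvalue and the squared derivative by r^2: this explains the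
    bound on [lam] and the division by r^2. *)
Lemma caccioppoli_scaled W lam Lam (r : R) f j : solution W lam f -> 0 < r ->
  (forall x, Q1 x -> W (r *: x)) -> `|lam| * r ^+ 2 <= Lam ->
  (energy W (r * 2^-1) (partials [:: j] f) <= (caccioppoli_cst Lam / r ^+ 2)%:E * energy W r f)%E.
Proof.
move=> sol r0 QW lamLam; have := solution_affine 0 r sol => solr.
have [oW sf _] := sol; have [oB sB E] := smooth_on_affine 0 r oW sf.
have Wr x : W (r *: x) -> W (0 + r *: x) by rewrite add0r.
have r20 : 0 < r ^+ 2 by rewrite exprn_gt0.
have := @caccioppoli _ _ Lam _ j solr (fun x Qx => Wr _ (QW x Qx)).
rewrite normrM (ger0_norm (ltW r20)) mulrC => /(_ lamLam).
have -> : energy [set y | W (0 + r *: y)] 1 (fun y => f (0 + r *: y)) = energy W r f.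
  apply: eq_J => t _; rewrite scale1r !patchE.
  have -> : (row t \in [set y | W (0 + r *: y)]) = (r *: row t \in W).
    by apply/idP/idP; rewrite !inE/= add0r.
  by rewrite add0r.
have -> : energy [set y | W (0 + r *: y)] 2^-1 (partials [:: j] (fun y => f (0 + r *: y))) =
    ((r ^+ 2)%:E * energy W (r * 2^-1) (partials [:: j] f))%E.
  rewrite /energy -JZ; last 3 first.
  - exact: ltW.
  - apply: measurable_sqr; apply: measurable_scale_row => // x Wx.
    exact: smooth_on_continuous sf Wx.
  - by move=> t; rewrite lee_fin sqr_ge0.
  apply: eq_J => t Ct; have Qt : Q1 (2^-1 *: row t).
    by apply: Q1_scale; [lra|exact/Q1_row].
  have Bt : [set y | W (0 + r *: y)] (2^-1 *: row t) by exact/Wr/QW.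
  rewrite !patchE !mem_set//; last by rewrite -scalerA; exact: QW.
  by rewrite E// add0r scalerA expr1 exprMn -EFinM.
move=> H; rewrite (mulrC (caccioppoli_cst Lam)) EFinM -muleA -(@lee_pmul2l _ (r ^+ 2)%:E)//.
by rewrite muleA -EFinM divff ?gt_eqF// mul1e.
Qed.

(** The equation has constant coefficients. [H1] and [H3] compute the same derivative, from the sum
    defining the Laplacian and from the equation. *)
Lemma solution_partial W lam f j : solution W lam f -> solution W lam (partials [:: j] f).
Proof.
move=> [oW sf lap]; split=> //; first exact: smooth_on_partials.
move=> x Wx.
have -> : laplacian (partials [:: j] f) x = \sum_i partials [:: j; i; i] f x.
  apply: eq_bigr => i _; rewrite partials_cat.
  by apply: (perm_partials (A := W)) => //; rewrite (perm_catC [:: i; i] [:: j]).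
have H1 : is_derive x (e_ j) (\sum_(i < d) partials [:: i; i] f) (\sum_i partials [:: j; i; i] f x).
  by apply: is_derive_sum => i; exact: smooth_on_derive sf Wx.
have H2 : is_derive x (e_ j) ((- lam) *: f) ((- lam) *: partials [:: j] f x).
  by apply: is_deriveZ; exact: (smooth_on_derive j [::] sf Wx).
have H3 : is_derive x (e_ j) (\sum_(i < d) partials [:: i; i] f) ((- lam) *: partials [:: j] f x).
  apply: near_eq_is_derive H2; apply: (near_open oW _ Wx) => y Wy.
  have L := lap y Wy; rewrite fct_sumE; apply: oppr_inj; rewrite [RHS]L.
  by rewrite -[(- lam *: f) y]/(- lam * f y) mulNr opprK.
have [_ <-] := H1; have [_ ->] := H3.
by rewrite -mulNr opprK.
Qed.

Lemma solution_partials W lam f s : solution W lam f -> solution W lam (partials s f).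
Proof. by elim: s => // i s IH /IH; exact: solution_partial. Qed.

(** Each derivative costs one halving of the cube. Allowing [k] to exceed [size s] puts derivatives
    of different orders on one common cube. *)
Lemma energy_partials (Lam : R) k s : 0 <= Lam -> (size s <= k)%N ->
  exists2 C : R, 0 <= C & forall W lam f, solution W lam f -> Q1 `<=` W -> `|lam| <= Lam ->
    (energy W (2^-1 ^+ k) (partials s f) <= C%:E * energy W 1 f)%E.
Proof.
move=> L0; elim: k s => [[]//= _|k IH s sk].
  by exists 1 => // W lam f _ _ _; rewrite expr0 mul1e.
have r1 : 0 <= (2^-1 : R) ^+ k <= 1 by rewrite exprn_ge0 ?exprn_ile1//=; lra.
have r0 : 0 < (2^-1 : R) ^+ k by rewrite exprn_gt0.
case: s sk => [_|i s sk].
  have [//|C C0 H] := IH [::].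
  exists (2 ^+ d * C); first by rewrite mulr_ge0// exprn_ge0.
  move=> W lam f sol QW lamL; have [oW sf _] := sol.
  rewrite exprSr EFinM -muleA.
  apply: (@le_trans _ _ ((2 ^+ d)%:E * energy W (2^-1 ^+ k) (partials [::] f))%E).
    by apply: energy_half => // x Wx; exact: smooth_on_continuous sf Wx.
  by rewrite lee_pmul2l ?lte_fin ?exprn_gt0//; exact: (H W lam).
have [|C C0 H] := IH s; first by rewrite -ltnS.
have Cc0 : 0 <= caccioppoli_cst Lam.
  by rewrite /caccioppoli_cst !mulr_ge0 ?exprn_ge0 ?addr_ge0 ?divr_ge0// mulr_ge0.
exists (caccioppoli_cst Lam / (2^-1 ^+ k) ^+ 2 * C).
  by rewrite mulr_ge0// divr_ge0// exprn_ge0// ltW.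
move=> W lam f sol QW lamL.
rewrite exprSr EFinM -muleA.
apply: (@le_trans _ _ ((caccioppoli_cst Lam / (2^-1 ^+ k) ^+ 2)%:E * energy W (2^-1 ^+ k) (partials s f))%E).
  have := solution_partials s sol => sols.
  have := @caccioppoli_scaled _ _ Lam _ _ i sols r0; apply.
    by move=> x Qx; apply: QW; exact: Q1_scale.
  apply: le_trans lamL; rewrite ler_piMr// exprn_ile1//.
  by case/andP: r1.
apply: lee_wpmul2l; last exact: (H W lam).
by rewrite lee_fin divr_ge0// exprn_ge0// ltW.
Qed.

Definition masked_indices (m : seq bool) : seq 'I_d := [seq i : 'I_d <- enum 'I_d | nth false m i].

Lemma mem_msel m (j : 'I_d) : (j \in masked_indices m) = nth false m j.
Proof. by rewrite mem_filter mem_enum andbT. Qed.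

Lemma perm_msel m (i : 'I_d) : nth false m i = false -> perm_eq (i :: masked_indices m) (masked_indices (set_nth false m i true)).
Proof.
move=> mi; apply: uniq_perm.
- by rewrite /= mem_msel mi/= filter_uniq// enum_uniq.
- by rewrite filter_uniq// enum_uniq.
- move=> j; rewrite inE !mem_msel nth_set_nth/= -(inj_eq val_inj)/=; case: eqP => // ->.
Qed.

Lemma size_msel m : (size (masked_indices m) <= d)%N.
Proof. by rewrite (leq_trans (size_subseq (filter_subseq _ _)))// size_enum_ord. Qed.

Lemma msel0 : masked_indices (nseq d false) = [::].
Proof.
apply/eqP; rewrite -size_eq0 size_filter -leqn0 leqNgt -has_count -all_predC.
by apply/allP => i _ /=; rewrite nth_nseq ltn_ord.
Qed.

Lemma row_zero : row (zero_tuple R d) = 0.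
Proof. by apply/rowP => i; rewrite !mxE tnth_mktuple. Qed.

(** The Sobolev inequality for [partials s f] takes at most [d] further derivatives. The cube of
    half-side 2^-(d + |s|) leaves room for the d + |s| halvings they cost in [energy_partials]. *)
Lemma elliptic0 (Lam : R) s : 0 <= Lam ->
  exists2 C : R, 0 <= C & forall W lam f, solution W lam f -> Q1 `<=` W -> `|lam| <= Lam ->
    ((partials s f 0 ^+ 2)%:E <= C%:E * energy W 1 f)%E.
Proof.
move=> L0; pose k := (d + size s)%N; pose r : R := 2^-1 ^+ k.
have r0 : 0 < r by rewrite exprn_gt0.
have r1 : 0 <= r <= 1 by rewrite ltW//= exprn_ile1//; lra.
have /choice[C HC] m : exists C : R, 0 <= C /\ forall W lam f, solution W lam f ->
    Q1 `<=` W -> `|lam| <= Lam ->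
    (energy W r (partials (masked_indices m ++ s) f) <= C%:E * energy W 1 f)%E.
  have [|C ? ?] := @energy_partials Lam k (masked_indices m ++ s) L0; last by exists C.
  by rewrite size_cat leq_add2r size_msel.
exists (2 ^+ d * \sum_(m <- masks d) C m).
  by rewrite mulr_ge0 ?exprn_ge0// sumr_ge0// => m _; have [] := HC m.
move=> W lam f sol QW lamL; have [oW sf _] := sol.
pose P m := partials (masked_indices m ++ s) f.
(* The power of [r] is the chain rule factor, one for each direction in the mask; [G'] is the
   globally measurable version. *)
pose G m (t : T) := r ^+ size (masked_indices m) * P m (r *: row t).
pose G' m (t : T) := r ^+ size (masked_indices m) * (P m \_ W) (r *: row t).
have Wr t : tcube t -> W (r *: row t) by move=> Ct; apply: QW; apply: Q1_scale => //; exact/Q1_row.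
have mP m : measurable_fun setT (fun t : T => (P m \_ W) (r *: row t)).
  by apply: measurable_scale_row => // x Wx; exact: smooth_on_continuous sf Wx.
have := @J_sobolev R d G G'.
rewrite /G msel0 expr0 mul1r row_zero scaler0 /P msel0/= -/P.
move=> /(_ _ _ _)/le_trans; apply.
- by move=> m; apply: measurable_funM => //; exact: mP.
- by move=> m t Ct; rewrite /G' patchE mem_set//; exact: Wr.
- move=> m i t u sm mi Ct u1; have Wu : W (r *: row (upd t i u)) by apply/Wr/tcube_upd.
  have Es : size (masked_indices (set_nth false m i true)) = (size (masked_indices m)).+1.
    by rewrite -(perm_size (perm_msel mi)).
  have Wu0 : W (0 + r *: row (upd t i u)) by rewrite add0r.
  have H := smooth_on_derive i (masked_indices m ++ s) sf Wu0.
  rewrite -cat_cons in H.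
  have E : partials ((i :: masked_indices m) ++ s) f (0 + r *: row (upd t i u)) =
      P (set_nth false m i true) (r *: row (upd t i u)).
    rewrite add0r; apply: (perm_partials (A := W)) => //.
    by rewrite perm_cat2r; exact: perm_msel.
  rewrite E in H; split.
    have := is_derive_line_row (is_derive_affine H).
    under [X in is_derive _ _ X _]eq_fun do rewrite add0r.
    move=> /(is_deriveZ (r ^+ size (masked_indices m))).
    by rewrite Es exprSr -mulrA; exact.
  apply: (@continuousM _ _ (cst (r ^+ size (masked_indices (set_nth false m i true))))).
    exact: cst_continuous.
  apply: (@continuous_line_row (fun y => P (set_nth false m i true) (r *: y))).
  apply: continuous_comp; first exact: scaler_continuous.
  exact: smooth_on_continuous sf Wu.
rewrite EFinM -muleA lee_pmul2l ?lte_fin ?exprn_gt0//.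
rewrite -sumEFin ge0_sume_distrl; last by move=> m _; have [] := HC m.
apply: lee_sum => m _; have [_ H] := HC m; apply: le_trans (H W lam f sol QW lamL).
apply: le_J.
- by apply: measurable_sqr; apply: measurable_funM => //; exact: mP.
- by apply: measurable_sqr; exact: mP.
- by move=> t _; rewrite lee_fin sqr_ge0.
move=> t _; rewrite lee_fin exprMn ler_piMl ?sqr_ge0//.
by case/andP: r1 => ? ?; rewrite -exprM exprn_ile1.
Qed.

(* The powers of [rho] and the bound on [lam * rho^2] make the constant scale invariant. *)
Lemma elliptic (Lam : R) s : 0 <= Lam ->
  exists2 C : R, 0 <= C & forall W lam f (c : V) (rho : R), solution W lam f -> 0 < rho ->
    (forall x, Q1 x -> W (c + rho *: x)) -> `|lam| * rho ^+ 2 <= Lam ->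
    (((rho ^+ size s * partials s f c) ^+ 2)%:E <=
      C%:E * J (fun t : T => ((f \_ W) (c + rho *: row t) ^+ 2)%:E))%E.
Proof.
move=> L0; have [C C0 H] := elliptic0 s L0; exists C => // W lam f c rho sol rho0 QW lamL.
have [oW sf _] := sol; have [_ _ E] := smooth_on_affine c rho oW sf.
have := H _ _ _ (solution_affine c rho sol) QW.
rewrite normrM (ger0_norm (exprn_ge0 2 (ltW rho0))) mulrC => /(_ lamL).
rewrite E; last by apply: QW; apply/Q1P => i; rewrite mxE normr0.
rewrite scaler0 addr0 => /le_trans; apply.
rewrite /energy; under eq_fun do rewrite scale1r.
rewrite le_eqVlt; apply/orP; left; apply/eqP; congr (_ * _)%E.
Qed.

End Elliptic.

(** * Daniell representation *)

Section CbOps.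
Variables (R : realType) (X : topologicalType).
Implicit Types F G : Cb R X.

Definition mkCb (f : X -> R) (cf : continuous f) (bf : exists M : R, forall x, `|f x| <= M) :
  Cb R X := MkCb (asboolT (conj cf bf) : (f : X -> R^o) \in @Cb_pred R X).

Lemma CbD F G x : (F + G) x = F x + G x. Proof. by []. Qed.
Lemma CbB F G x : (F - G) x = F x - G x. Proof. by []. Qed.
Lemma CbZ (a : R) F x : (a *: F) x = a * F x. Proof. by []. Qed.
Lemma Cb0 x : (0 : Cb R X) x = 0. Proof. by []. Qed.

Lemma Cb_sum (I : Type) (r : seq I) (P : pred I) (F : I -> Cb R X) x :
  (\sum_(i <- r | P i) F i) x = \sum_(i <- r | P i) F i x.
Proof. by elim/big_rec2: _ => // i y z _ <-. Qed.

Lemma Cb_continuous F : continuous F.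
Proof. by have /asboolP[] := Cb_funP F. Qed.

Definition Cb1 : Cb R X.
Proof.
apply: (@mkCb (fun=> 1)); first by move=> x; exact: cvg_cst.
by exists 1 => x; rewrite normr1.
Defined.

Definition Cb_min F G : Cb R X.
Proof.
apply: (@mkCb (fun x => Num.min (F x) (G x))).
  by move=> x; apply: continuous_min; exact: Cb_continuous.
exists (Cb_norm F + Cb_norm G) => x.
have := Cb_norm_ub F x; have := Cb_norm_ub G x.
have := Cb_norm_ge0 F; have := Cb_norm_ge0 G.
by rewrite /Num.min; case: ifP => _ *; lra.
Defined.

Lemma Cb_minE F G x : Cb_min F G x = Num.min (F x) (G x). Proof. by []. Qed.

Definition Cb_pos F : Cb R X := F - Cb_min F 0.

Lemma Cb_posE F x : Cb_pos F x = Num.max (F x) 0.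
Proof. by rewrite CbB Cb_minE Cb0; case: leP => _; [rewrite subrr|rewrite subr0]. Qed.

End CbOps.

Lemma measurable_Cb (R : realType) (X : ptopologicalType) (F : Cb R X) :
  measurable_fun setT (F : borel X -> R).
Proof.
have := @open_continuous_borel R X setT F openT (fun x _ => @Cb_continuous _ _ F x).
by rewrite patch_setT.
Qed.

Section Daniell.
Variables (R : realType) (X : ptopologicalType).
Hypothesis open_Cb : forall U : set X, open U -> exists g : Cb R X,
  (forall x, 0 <= g x <= 1) /\ (forall x, U x <-> 0 < g x).
Variable nu : {linear Cb R X -> R^o}.
Hypothesis nu_pos : forall F : Cb R X, (forall x, 0 <= F x) -> 0 <= nu F.
Hypothesis nu_sigma : forall F : nat -> Cb R X, (forall n x, 0 <= F n x) ->
  (forall n x, F n.+1 x <= F n x) -> (forall x, F n x @[n --> \oo] --> 0) ->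
  nu (F n) @[n --> \oo] --> 0.
Implicit Types (F G : Cb R X) (U A : set X).

Let one : Cb R X := Cb1 R X.
Let c := nu one.

Let nu_le F G : (forall x, F x <= G x) -> nu F <= nu G.
Proof.
move=> FG; rewrite -subr_ge0 -[nu G - nu F]linearB; apply: nu_pos => x.
by rewrite CbB subr_ge0.
Qed.

Let c0 : 0 <= c. Proof. by apply: nu_pos => x; exact: ler01. Qed.

(** The competitors in the inner content of [A]. No compactness of supports is asked:
    sigma-smoothness of [nu] takes over that role. *)
Definition under A F := forall x, 0 <= F x <= 1 /\ (~ A x -> F x = 0).

Let inner A : R := sup [set nu F | F in under A].

Let under0 A : under A 0.
Proof. by move=> x; rewrite Cb0 lexx ler01. Qed.

Let inner_has_sup A : has_sup [set nu F | F in under A].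
Proof.
split; first by exists (nu 0), 0.
by exists c => _ [F uF <-]; apply: nu_le => x; case: (uF x) => /andP[].
Qed.

Let inner_ub A F : under A F -> nu F <= inner A.
Proof. by move=> uF; apply: sup_upper_bound => //; exists F. Qed.

Let inner_le A r : (forall F, under A F -> nu F <= r) -> inner A <= r.
Proof.
move=> H; apply: ge_sup; first by case: (inner_has_sup A).
by move=> _ [F uF <-]; exact: H.
Qed.

Let inner_ge0 A : 0 <= inner A.
Proof. by rewrite -(linear0 nu); exact: inner_ub. Qed.

Let inner_mono A B : A `<=` B -> inner A <= inner B.
Proof.
move=> AB; apply: inner_le => F uF; apply: inner_ub => x.
by have [F01 F0] := uF x; split => // nB; apply: F0 => /AB.
Qed.

Let inner_le1 A : inner A <= c.
Proof. by apply: inner_le => F uF; apply: nu_le => x; case: (uF x) => /andP[]. Qed.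

Let innerT : inner setT = c.
Proof.
apply/eqP; rewrite eq_le inner_le1/=; apply: inner_ub => x.
by split; [rewrite -[one x]/(1 : R) ler01 lexx|move=> /(_ Logic.I)].
Qed.

Let inner0 : inner set0 = 0.
Proof.
apply/eqP; rewrite eq_le inner_ge0 andbT; apply: inner_le => F uF.
by rewrite -(linear0 nu); apply: nu_le => x; case: (uF x) => _ ->.
Qed.

Let min_sum (a : R) n (b : nat -> R) : 0 <= a -> (forall i, 0 <= b i) ->
  Num.min a (\sum_(i < n) b i) <= \sum_(i < n) Num.min a (b i).
Proof.
move=> a0 b0; elim: n => [|n IH]; first by rewrite !big_ord0 ge_min lexx orbT.
rewrite !big_ord_recr/=; apply: le_trans (lerD IH (lexx _)).
have S0 : 0 <= \sum_(i < n) b i by exact: sumr_ge0.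
have := b0 n; move: (\sum_(_ < _) _) (b n) S0 => s t s0 t0.
by rewrite /Num.min; do !case: ifPn; rewrite -?leNgt; lra.
Qed.

(** A competitor [F] for the union is cut off by multiples of finite sums of the functions [g i],
    which are positive exactly on [U i]. The cut function is dominated by a sum of competitors for
    the single sets, and what is lost decreases to 0 pointwise, so [nu] of it tends to 0. *)
Let inner_bigcup (U : nat -> set X) : (forall n, open (U n)) ->
  ((inner (\bigcup_n U n))%:E <= \sum_(0 <= n <oo) (inner (U n))%:E)%E.
Proof.
move=> oO; have /choice[g Hg] : forall n, exists g : Cb R X,
  (forall x, 0 <= g x <= 1) /\ (forall x, U n x <-> 0 < g x) by move=> n; exact: open_Cb.
have g0 n x : 0 <= g n x by have [/(_ x)/andP[]] := Hg n.
set S := (\sum_(0 <= n <oo) _)%E.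
have partS n : ((\sum_(i < n) inner (U i))%:E <= S)%E.
  rewrite -sumEFin -(big_mkord xpredT (fun i => (inner (U i))%:E)).
  by apply: nneseries_lim_ge => i _ _; rewrite lee_fin.
suff H F : under (\bigcup_n U n) F -> ((nu F)%:E <= S)%E.
  case: S partS H => [r _ H|_ _|/(_ 0%N)//]; last exact: leey.
  by rewrite lee_fin; apply: inner_le => F /H; rewrite lee_fin.
(* The growing factor [m] makes [Sm m] eventually exceed 1, hence [F], at each point of the
   union. *)
move=> uF; pose Sm m := \sum_(i < m) (m%:R *: g i).
pose D m := F - Cb_min F (Sm m).
have SmE m x : Sm m x = m%:R * \sum_(i < m) g i x.
  by rewrite Cb_sum mulr_sumr; apply: eq_bigr.
have Sm_mono m x : Sm m x <= Sm m.+1 x.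
  rewrite !SmE; apply: ler_pM => //; first exact: sumr_ge0.
    by rewrite ler_nat.
  by rewrite big_ord_recr/= lerDl.
have D_cvg : nu (D m) @[m --> \oo] --> 0.
  apply: nu_sigma => [m x|m x|x].
  - by rewrite CbB Cb_minE subr_ge0 ge_min lexx.
  - by rewrite !CbB !Cb_minE lerD2l lerN2 le_min ge_min lexx/= ge_min Sm_mono orbT.
  - have [[n _ Onx]|nO] := pselect ((\bigcup_n U n) x); last first.
      have [_ /(_ nO) Fx0] := uF x.
      rewrite (_ : (fun m => _) = fun=> 0); first exact: cvg_cst.
      apply/funext => m; rewrite CbB Cb_minE Fx0 min_l ?subrr//.
      by rewrite SmE mulr_ge0// sumr_ge0.
    have gx : 0 < g n x by have [_ /(_ x)[+ _]] := Hg n; exact.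
    apply: cvg_near_cst; exists (maxn n.+1 (Num.truncn (g n x)^-1).+1) => // m /=.
    rewrite geq_max => /andP[nm Nm].
    rewrite -[LHS]/(F x - Num.min (F x) (Sm m x)) min_l ?subrr//.
    have [/andP[_ F1] _] := uF x; apply: (le_trans F1); rewrite SmE.
    apply: (@le_trans _ _ (m%:R * g n x)); last first.
      rewrite ler_wpM2l//; rewrite (bigD1 (Ordinal nm))//= lerDl.
      by apply: sumr_ge0.
    rewrite -ler_pdivrMr// div1r ltW//.
    apply: lt_le_trans (truncnS_gt _) _; first by rewrite ler_nat.
have nuF m : nu F <= nu (D m) + \sum_(i < m) inner (U i).
  have -> : nu F = nu (D m) + nu (Cb_min F (Sm m)) by rewrite -linearD subrK.
  rewrite lerD2l; apply: (@le_trans _ _ (nu (\sum_(i < m) Cb_min F (m%:R *: g i)))).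
    apply: nu_le => x; rewrite Cb_minE SmE Cb_sum mulr_sumr.
    apply: (@min_sum (F x) m (fun i => m%:R * g i x)); first by have [/andP[]] := uF x.
    by move=> i; rewrite mulr_ge0.
  rewrite linear_sum; apply: ler_sum => i _; apply: inner_ub => x.
  have [/andP[F0 F1] _] := uF x; rewrite Cb_minE CbZ; split.
    by rewrite le_min F0 mulr_ge0//= ge_min F1.
  move=> nO; have -> : g i x = 0.
    apply/eqP; rewrite eq_le g0 andbT leNgt; apply/negP.
    by have [_ /(_ x)[_ H]] := Hg i => /H.
  by rewrite mulr0 min_r.
have [Sr|] : S = +oo%E \/ exists r, S = r%:E.
- case: S partS {nuF} => [r _|_|/(_ 0%N)//]; [by right; exists r|by left].
- by rewrite Sr leey.
case=> r Sr; rewrite Sr lee_fin.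
have H m : nu F - r <= nu (D m).
  by have := nuF m; have := partS m; rewrite Sr lee_fin; lra.
rewrite -subr_le0 leNgt; apply/negP => lt0.
have /cvgrPdist_lt/(_ _ lt0)[m _ /(_ m (leqnn m))] := D_cvg.
by rewrite sub0r normrN; have := H m; have := ler_norm (nu (D m)); lra.
Qed.

Let outer A : R := inf [set inner U | U in [set U | open U /\ A `<=` U]].

Let outer_has_inf A : has_inf [set inner U | U in [set U | open U /\ A `<=` U]].
Proof.
split; first by exists (inner setT), setT => //; split => //; exact: openT.
by exists 0 => _ [U _ <-].
Qed.

Let outer_lb A U : open U -> A `<=` U -> outer A <= inner U.
Proof. by move=> oO AO; apply: ge_inf; [exact: (outer_has_inf A).2|exists U]. Qed.

Let outer_ge A r : (forall U, open U -> A `<=` U -> r <= inner U) -> r <= outer A.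
Proof.
move=> H; apply: lb_le_inf; first exact: (outer_has_inf A).1.
by move=> _ [U [oO AO] <-]; exact: H.
Qed.

Let outer_adherent A (e : R) : 0 < e -> exists U, [/\ open U, A `<=` U & inner U < outer A + e].
Proof.
by move=> e0; have [_ [U [oO AO] <-] H] := inf_adherent e0 (outer_has_inf A); exists U.
Qed.

Let outer_ge0 A : 0 <= outer A.
Proof. by apply: outer_ge => U _ _. Qed.

Let outer_open U : open U -> outer U = inner U.
Proof.
move=> oO; apply/eqP; rewrite eq_le outer_lb//=.
by apply: outer_ge => U' _ OO'; exact: inner_mono.
Qed.

Definition daniell_outer A : \bar R := (outer A)%:E.

Let outer_set0 : daniell_outer set0 = 0%E.
Proof. by rewrite /daniell_outer outer_open ?inner0//; exact: open0. Qed.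

Let outer_nneg A : (0 <= daniell_outer A)%E.
Proof. by rewrite lee_fin. Qed.

Let outer_mono : {homo daniell_outer : A B / A `<=` B >-> (A <= B)%E}.
Proof.
move=> A B AB; rewrite lee_fin; apply: outer_ge => U oO BO.
by apply: outer_lb => //; exact: subset_trans BO.
Qed.

Let outer_subadd : sigma_subadditive daniell_outer.
Proof.
move=> A; apply/lee_addgt0Pr => e e0.
have /choice[U HO] n : exists U, [/\ open U, A n `<=` U & inner U < outer (A n) + e / (2 ^ n.+1)%:R].
  by apply: outer_adherent; rewrite divr_gt0.
apply: (@le_trans _ _ (inner (\bigcup_n U n))%:E).
  rewrite lee_fin; apply: outer_lb; first by apply: bigcup_open => n _; have [] := HO n.
  by move=> x [n _ Anx]; exists n => //; have [_ + _] := HO n; exact.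
apply: (le_trans (inner_bigcup _)); first by move=> n; have [] := HO n.
apply: le_trans (epsilon_trick xpredT _ (ltW e0)); last by [].
apply: lee_nneseries => [n _ _|n _]; first by rewrite lee_fin.
by rewrite -EFinD lee_fin ltW//; have [] := HO n.
Qed.

HB.instance Definition _ := isOuterMeasure.Build R X daniell_outer
  outer_set0 outer_nneg outer_mono outer_subadd.

(** For a near-optimal competitor [F] of B cap U, the part (F - k)^+ vanishes on the open set where
    F < k, and that set contains the points of [A] off [U]. It can thus be added to any competitor
    of B' = B cap {F < k} to give a competitor of [B]. *)
Let cara_open U : open U -> daniell_outer.-caratheodory U.
Proof.
move=> oO; apply: le_caratheodory_measurable => A; rewrite -EFinD lee_fin.
apply: outer_ge => B oB AB.
(* The total loss is [k] for the choice of [F] and k c for lowering it by [k], together [e]. *)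
apply/ler_addgt0Pl => e e0; pose k := e / (1 + c).
have k0 : 0 < k by rewrite divr_gt0// ltr_wpDr.
have [_ [F uF <-]] := sup_adherent k0 (inner_has_sup (B `&` U)).
rewrite -/(inner (B `&` U)) => HF.
have H1 : outer (A `&` U) <= inner (B `&` U).
  by apply: outer_lb; [exact: openI|exact: setSI].
pose B' := B `&` [set x | F x < k].
have oB' : open B'.
  apply: openI => //.
  rewrite (_ : [set x | F x < k] = (F : X -> R) @^-1` [set y | y < k])//.
  by apply: open_comp (@open_lt _ k) => x _; exact: Cb_continuous.
have H2 : outer (A `&` ~` U) <= inner B'.
  apply: outer_lb => // x [Ax nOx]; split; first exact: AB.
  by rewrite /= (proj2 (uF x))// => -[].
pose F' := Cb_pos (F - k *: one).
have F'E x : F' x = Num.max (F x - k) 0 by rewrite Cb_posE CbB CbZ -[one x]/(1 : R) mulr1.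
have H3 : nu F - k * c <= nu F'.
  rewrite /c -[k * _]linearZ -[_ - _]linearB; apply: nu_le => x.
  by rewrite F'E CbB CbZ -[one x]/(1 : R) mulr1 le_max lexx.
have H4 : inner B' <= inner B - nu F'.
  apply: inner_le => G uG; rewrite lerBrDr -linearD; apply: inner_ub => x.
  rewrite CbD F'E; have [/andP[G0 G1] Gz] := uG x; have [/andP[F0 F1] Fz] := uF x.
  have [Fk|Fk] := leP k (F x).
    rewrite Gz; last by move=> [_ /=]; rewrite ltNge Fk.
    rewrite add0r max_l ?subr_ge0//; split; first by move: k0; lra.
    move=> nB; move: Fk; rewrite Fz; last by case.
    by rewrite leNgt k0.
  have -> : Num.max (F x - k) 0 = 0 by apply: max_r; rewrite subr_le0 ltW.
  by rewrite addr0 G0 G1; split => // nB; apply: Gz => -[/nB].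
have H5 : k + k * c = e by rewrite /k; field; have := c0; lra.
lra.
Qed.

Let cara_borel (A : set (borel X)) : measurable A -> daniell_outer.-caratheodory A.
Proof.
apply: smallest_sub; first exact: (@sigma_algebra_measurable _ (caratheodory_type daniell_outer)).
by move=> U; exact: cara_open.
Qed.

Definition daniell_measure : set (borel X) -> \bar R := daniell_outer.

Let dm0 : daniell_measure set0 = 0%E. Proof. exact: outer_set0. Qed.
Let dm_ge0 A : (0 <= daniell_measure A)%E. Proof. exact: outer_nneg. Qed.
Let dm_sigma : semi_sigma_additive daniell_measure.
Proof.
move=> A mA tA mUA.
apply: (@caratheodory_measure_sigma_additive R X daniell_outer) => //.
  by move=> n; exact: cara_borel.
exact: cara_borel.
Qed.

HB.instance Definition _ := isMeasure.Build _ _ _ daniell_measure dm0 dm_ge0 dm_sigma.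

Let dm_fin : fin_num_fun daniell_measure.
Proof. by []. Qed.

HB.instance Definition _ := Measure_isFinite.Build _ _ _ daniell_measure dm_fin.

(** A discrete layer-cake formula: with [count_le] it compares [N F] with the number of level sets
    that contain the point, counted from 0 or from 1. *)
Let count_ge (y : R) n : 0 <= y -> Num.min y n%:R <= \sum_(i < n) ((i%:R < y)%R)%:R.
Proof.
move=> y0; elim: n => [|n IH]; first by rewrite big_ord0 ge_min lexx orbT.
rewrite big_ord_recr/=; move: IH; move: (\sum_(_ < _) _) => s; rewrite -natr1.
by have [ny|yn] := ltP n%:R y; rewrite /Num.min; do !case: ifPn; rewrite -?leNgt/=; lra.
Qed.

Let count_le (y : R) n : 0 <= y -> \sum_(i < n) ((i.+1%:R < y)%R)%:R <= Num.min y n%:R.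
Proof.
move=> y0; elim: n => [|n IH]; first by rewrite big_ord0 le_min y0 lexx.
rewrite big_ord_recr/=; move: IH; move: (\sum_(_ < _) _) => s; rewrite -natr1.
by have [ny|yn] := ltP (n%:R + 1) y; rewrite /Num.min; do !case: ifPn; rewrite -?leNgt/=; lra.
Qed.

Let level F (N i : nat) : set X := [set x | i%:R < N%:R * F x].

Let level_open F N i : open (level F N i).
Proof.
rewrite (_ : level F N i = (N%:R *: F : Cb R X) @^-1` [set y | i%:R < y])//.
by apply: open_comp (@open_gt _ _) => x _; exact: Cb_continuous.
Qed.

Let dm_open U : open U -> daniell_measure U = (inner U)%:E.
Proof. by move=> oU; rewrite /daniell_measure /daniell_outer outer_open. Qed.

Let mopen (U : set X) : open U -> measurable (U : set (borel X)).
Proof. exact: sub_sigma_algebra. Qed.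

Let int_Cb F : daniell_measure.-integrable setT (fun x : borel X => (F x)%:E).
Proof.
apply: measurable_bounded_integrable => //.
- by rewrite -ge0_fin_numE// fin_num_measure.
- exact: measurable_Cb.
- exists (Cb_norm F); split; first exact: num_real.
  by move=> M /ltW FM x _; exact: le_trans (Cb_norm_ub F x) FM.
Qed.

Let I F : R := (\int[daniell_measure]_x (F x))%R.

Let IE F : (\int[daniell_measure]_x (F x)%:E = (I F)%:E)%E.
Proof. by rewrite /I /Rintegral fineK//; exact: (integrable_fin_num _ (int_Cb F)). Qed.

Let I_lin (a : R) F G : I (a *: F + G) = a * I F + I G.
Proof.
rewrite /I; have := RintegralD measurableT (int_Cb (a *: F)) (int_Cb G).
move=> ->; congr (_ + _).
exact: (RintegralZl a measurableT (int_Cb F)).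
Qed.

Let I1 : I one = c.
Proof.
apply: EFin_inj; rewrite -IE -[c]innerT -dm_open; last exact: openT.
rewrite (_ : (fun x => _) = cst 1%:E)// integral_cst//; exact: mul1e.
Qed.

(** Both functionals are compared with the sum of the contents of the level sets. The error [c] does
    not grow with [N] and disappears in [I_le] after division by [N]. *)
Let I_le_step F N : (0 < N)%N -> (forall x, 0 <= F x <= 1) -> N%:R * I F <= N%:R * nu F + c.
Proof.
move=> N0 F01; have NF0 x : 0 <= N%:R * F x by rewrite mulr_ge0//; case/andP: (F01 x).
apply: (@le_trans _ _ (\sum_(i < N) inner (level F N i))).
  rewrite -lee_fin EFinM -IE -ge0_integralZl_EFin//; last 2 first.
  - by move=> x _; rewrite lee_fin; case/andP: (F01 x).
  - by apply/measurable_EFinP; exact: measurable_Cb.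
  rewrite -sumEFin.
  have Hi i : (inner (level F N i))%:E =
      (\int[daniell_measure]_x (\1_(level F N i) x)%:E)%E.
    have oL := level_open F N i.
    by rewrite (integral_indic _ measurableT (mopen oL)) setIT; exact/esym/(dm_open oL).
  under [leRHS]eq_bigr do rewrite Hi.
  rewrite -ge0_integral_sum//; last first.
  - by move=> i; apply/measurable_EFinP; apply: measurable_indic; exact: (mopen (level_open F N i)).
  apply: ge0_le_integral => //.
  - by move=> x _; rewrite -EFinM lee_fin.
  - apply: measurable_funeM; apply/measurable_EFinP; exact: measurable_Cb.
  - by apply: emeasurable_sum => i; apply/measurable_EFinP; apply: measurable_indic; exact: (mopen (level_open F N i)).
  move=> x _; rewrite -EFinM sumEFin lee_fin.
  apply: (@le_trans _ _ (Num.min (N%:R * F x) N%:R)).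
    by rewrite le_min lexx/= ler_piMr//; case/andP: (F01 x).
  apply: le_trans (count_ge _ (NF0 x)) _; apply: ler_sum => i _.
  rewrite indicE /level; case: ltP => H /=; last by [].
  by rewrite mem_set.
case: N N0 NF0 => // n _ NF0.
(* Level 0 is paid for by [c]. The levels i + 1 have near-optimal competitors [G i], whose sum is at
   most [N F] by [count_le]. *)
rewrite big_ord_recl/= addrC lerD//.
apply/ler_addgt0Pr => e e0; pose k := e / n.+1%:R.
have k0 : 0 < k by rewrite divr_gt0.
have /choice[G HG] : forall i : nat, exists G, under (level F n.+1 i.+1) G /\
    inner (level F n.+1 i.+1) - k < nu G.
  by move=> i; have [_ [G uG <-] ?] := sup_adherent k0 (inner_has_sup (level F n.+1 i.+1)); exists G.
apply: (@le_trans _ _ (\sum_(i < n) nu (G i) + e)).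
  apply: (@le_trans _ _ (\sum_(i < n) (nu (G i) + k))).
    by apply: ler_sum => i _; have [_ /ltW] := HG i; rewrite lerBlDr.
  rewrite big_split/= lerD2l sumr_const card_ord -mulr_natr /k.
  by rewrite -mulrA ler_piMr// ?(ltW e0)// [leLHS]mulrC ler_pdivrMr// mul1r ler_nat.
rewrite lerD2r -linear_sum -[_ * nu F]linearZ; apply: nu_le => x.
rewrite Cb_sum CbZ; apply: le_trans (le_trans (count_le n (NF0 x)) _); last by rewrite ge_min lexx.
apply: ler_sum => i _; have [/andP[G0 G1] Gz] := (HG i).1 x.
have [//|nl] := boolP (_ < _); rewrite Gz//; exact/negP.
Qed.

Let I_le F : (forall x, 0 <= F x <= 1) -> I F <= nu F.
Proof.
move=> F01; rewrite leNgt; apply/negP => lt.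
have d0 : 0 < I F - nu F by rewrite subr_gt0.
pose N := (Num.truncn (c / (I F - nu F))).+1.
have := @I_le_step F N isT F01; have := truncnS_gt (c / (I F - nu F)).
rewrite -/N ltr_pdivrMr//; move: (N%:R) => M; lra.
Qed.

Let I_eq01 F : (forall x, 0 <= F x <= 1) -> I F = nu F.
Proof.
move=> F01; apply/eqP; rewrite eq_le I_le//=.
(* The reverse inequality is [I_le] for 1 - F, since the two functionals agree on the constant 1. *)
have := @I_le (-1 *: F + one); rewrite I_lin linearP I1 -/c => H.
have : -1 * I F + c <= -1 * nu F + c.
  apply: H => x; rewrite CbD CbZ -[one x]/(1 : R); have := F01 x; lra.
lra.
Qed.

Let daniell_integral F : ((nu F)%:E = \int[daniell_measure]_x (F x)%:E)%E.
Proof.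
rewrite IE; congr _%:E; pose M := Cb_norm F + 1.
have M0 : 0 < M by rewrite ltr_wpDl// Cb_norm_ge0.
pose G := (2 * M)^-1 *: (M *: one + F).
have G01 x : 0 <= G x <= 1.
  rewrite CbZ CbD CbZ -[one x]/(1 : R) mulr1.
  have := Cb_norm_ub F x; rewrite ler_norml /M => /andP[a b].
  have := Cb_norm_ge0 F => n0.
  rewrite mulr_ge0 ?invr_ge0//=; [|lra|lra].
  by rewrite ler_pdivrMl ?mulr1; lra.
have := I_eq01 G01; rewrite /G -[X in I X]addr0 I_lin linearZ I_lin linearP.
have -> : I 0 = 0 by have := I_lin 1 0 0; rewrite scale1r addr0 mul1r; lra.
rewrite addr0 I1 => E.
have {E} : (2 * M)^-1 * (M * c + I F) = (2 * M)^-1 * (M * c + nu F) by exact: E.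
move=> /(mulfI _) H; have /H/addrI : (2 * M)^-1 != 0 by rewrite invr_eq0 gt_eqF// mulr_gt0.
by [].
Qed.

Lemma daniell : exists mu : {finite_measure set (borel X) -> \bar R},
  forall F, ((nu F)%:E = \int[mu]_x (F x)%:E)%E.
Proof. by exists daniell_measure => F; exact: daniell_integral. Qed.

End Daniell.

(** * Compactness of bounded families of solutions *)

Section Ultra.
Variable R : realType.

Lemma fmap_ultra (T U : Type) (f : T -> U) (F : set_system T) :
  UltraFilter F -> UltraFilter (f @ F).
Proof.
move=> FU; split; first exact: fmap_proper_filter.
move=> G PG FG; apply/seteqP; split => [A GA|]; last exact: FG.
have [//|FnA] := in_ultra_setVsetC (f @^-1` A) FU.
have GnA : G (~` A) by exact: FG.
by have [x []] := filter_ex (filterI GA GnA).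
Qed.

Lemma cvg_near_le (T : Type) (F : set_system T) (f : T -> R) (a c : R) : ProperFilter F ->
  f @ F --> a -> F [set t | f t <= c] -> a <= c.
Proof.
move=> PF fa fc; apply/ler_addgt0Pr => e e0.
have /cvgrPdist_le/(_ _ e0) H := fa.
have [t [/=]] := filter_ex (filterI H fc).
by rewrite ler_norml => /andP[_ ?] ?; lra.
Qed.

Lemma ultra_bounded (T : Type) (F : set_system T) (f : T -> R) (C : R) : UltraFilter F ->
  F [set t | `|f t| <= C] -> exists l : R, f @ F --> l.
Proof.
move=> FU fC; have := @segment_compact R (- C) C; rewrite compact_ultra => H.
have [|l [_ Hl]] := H (f @ F) (fmap_ultra f FU); last by exists l.
by rewrite /fmap/=; apply: filterS fC => t /=; rewrite in_itv/= ler_norml.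
Qed.

Lemma cvg_near_norm_le (T : Type) (F : set_system T) (f : T -> R) (a c : R) {PF : ProperFilter F} :
  f @ F --> a -> F [set t | `|f t| <= c] -> `|a| <= c.
Proof. by move=> fa fc; apply: cvg_near_le fc; exact: cvg_norm. Qed.

Lemma cvg_sumr (T : Type) (F : set_system T) (I : finType) (f : I -> T -> R) (a : I -> R) {FF : Filter F} :
  (forall i, f i @ F --> a i) -> (fun t => \sum_i f i t) @ F --> \sum_i a i.
Proof. by move=> H; apply: (@cvg_big _ _ _ _ _ add_continuous). Qed.

End Ultra.

(** The function is the distance to the complement, truncated at 1. The whole space is treated
    apart, because the infimum of the empty set is 0 by convention. *)
Lemma metric_cozero (R : realType) (M : metricType R) (A : set M) : open A ->
  exists g : M -> R, [/\ continuous g, forall x, 0 <= g x <= 1 & forall x, A x <-> 0 < g x].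
Proof.
move=> oA; have [nA|] := pselect (~` A !=set0); last first.
  move=> /nonemptyPn/(congr1 (@setC _)); rewrite setCK setC0 => AT.
  exists (fun=> 1); split=> [|x|x]; first exact: cst_continuous.
    by rewrite ler01 lexx.
  by rewrite AT ltr01.
pose S (x : M) : set R := [set Num.min 1 (mdist x y) | y in ~` A].
have S0 x : S x !=set0 by have [y Ay] := nA; exists (Num.min 1 (mdist x y)), y.
have lbS x : lbound (S x) 0 by move=> _ [y _ <-]; rewrite le_min ler01 mdist_ge0.
have hS x : has_inf (S x) by split=> //; exists 0.
have lip x y : inf (S x) <= inf (S y) + mdist x y.
  rewrite -lerBlDr; apply: lb_le_inf => // _ [z Az <-]; rewrite lerBlDr.
  apply: (@le_trans _ _ (Num.min 1 (mdist x z))); first by apply: ge_inf; [exists 0|exists z].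
  have := metric_triangle x y z; have := mdist_ge0 x y.
  by rewrite !minElt; case: ltP => ?; case: ltP => ?; lra.
exists (fun x => inf (S x)); split=> [x|x|x].
- apply/cvgrPdist_lt => e e0; near=> y.
  apply: (@le_lt_trans _ _ (mdist x y)).
    rewrite ler_norml; have := lip x y; have := lip y x; rewrite (metric_sym y x); lra.
  near: y; have := nbhsx_ballx x e e0; by rewrite ballEmdist.
- rewrite lb_le_inf//=; have [y Ay] := nA.
  by apply: (@le_trans _ _ (Num.min 1 (mdist x y))); [apply: ge_inf; [exists 0|exists y]|rewrite ge_min lexx].
- split=> [Ax|]; last first.
    apply: contraPP => nAx; apply/negP; rewrite -leNgt.
    apply: (@le_trans _ _ (Num.min 1 (mdist x x))); first by apply: ge_inf; [exists 0|exists x].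
    by rewrite mdistxx ge_min lexx orbT.
  have /nbhs_ballP[e /= e0] : nbhs x A by exact: open_nbhs_nbhs.
  rewrite ballEmdist => eA; apply: (@lt_le_trans _ _ (Num.min 1 e)); first by rewrite lt_min ltr01.
  apply: lb_le_inf => // _ [y Ay <-]; rewrite le_min ge_min lexx/= ge_min.
  by apply/orP; right; rewrite leNgt; apply/negP => /eA.
Unshelve. all: by end_near. Qed.

Section Limit.
Variables (R : realType) (d : nat).
Local Notation V := 'rV[R]_d.
Local Notation e_ i := (delta_mx ord0 i : V).

(** A Taylor bound with quadratic remainder survives pointwise limits, unlike differentiability
    itself. It serves both for limits of solutions and at the edge of the cutoff. *)
Lemma is_derive_quadratic (g : V -> R) y i (a K r : R) : 0 < r ->
  (forall t : R, `|t| <= r -> `|g (t *: e_ i + y) - g y - t * a| <= K * t ^+ 2) ->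
  is_derive y (e_ i) g a.
Proof.
move=> r0 H.
have L : h^-1 *: ((g \o shift y) (h *: e_ i) - g y) @[h --> (0 : R)^'] --> a.
  apply/cvgrPdist_le => e e0.
  have K0 : 0 < `|K| + 1 by rewrite ltr_wpDl.
  have d0 : 0 < Num.min r (e / (`|K| + 1)) by rewrite lt_min r0 divr_gt0.
  near=> t; have tn0 : t != 0 by near: t; exact: nbhs_dnbhs_neq.
  have : `|t| < Num.min r (e / (`|K| + 1)) by near: t; exact: dnbhs0_lt.
  rewrite lt_min => /andP[tr te].
  have := H t (ltW tr); rewrite /shift/=; set D := g _ - g y => HD.
  rewrite distrC -(ler_pM2l (_ : 0 < `|t|)) ?normr_gt0// -normrM.
  rewrite mulrBr [_ *: _]/(_ * _) mulrA divff// mul1r.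
  apply: (le_trans HD); apply: (@le_trans _ _ ((`|K| + 1) * `|t| ^+ 2)).
    rewrite real_normK ?num_real// ler_wpM2r ?sqr_ge0//.
    by rewrite (le_trans (ler_norm _))// lerDl.
  rewrite expr2 mulrCA ler_wpM2l// mulrC -ler_pdivlMr// ltW//.
split; first by apply/cvg_ex; exists a.
exact: cvg_lim.
Unshelve. all: by end_near. Qed.

Lemma cube_ball (y : V) : exists r : nat, cube 0 r%:R y.
Proof.
exists (Num.truncn `|y|).+1 => i; rewrite mxE subr0.
apply: le_trans (coord_le_norm y i) _; exact/ltW/truncnS_gt.
Qed.

Lemma sub_cube (r r' : R) : r <= r' -> cube (0 : V) r `<=` cube 0 r'.
Proof. by move=> rr y cy i; apply: le_trans rr; exact: cy. Qed.

Lemma cube_near (y : V) (r : R) i (t : R) : cube 0 r y -> `|t| <= 1 -> cube 0 (r + 1) (t *: e_ i + y).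
Proof.
move=> cy t1 j; rewrite !mxE eqxx subr0/=; have := cy j; rewrite mxE subr0 => yj.
apply: (le_trans (ler_normD _ _)); rewrite addrC lerD// normrM.
by apply: le_trans t1; rewrite ler_piMr//; case: (_ == _); rewrite ?normr1 ?normr0.
Qed.

(** The domain [W] may vary with [r]: a localized function solves the equation only where its cutoff
    is constant. *)
Definition tame (C : seq 'I_d -> nat -> R) (r : nat) (f : V -> R) := exists W : set V,
  [/\ solution W 1 f, cube 0 r%:R `<=` W &
      forall s y, cube 0 r%:R y -> `|partials s f y| <= C s r].

Section compactness.
Variables (T : Type) (F : set_system T) (f : T -> V -> R) (C : seq 'I_d -> nat -> R).
Hypothesis FU : UltraFilter F.
Hypothesis tame_f : forall r, F [set t | tame C r (f t)].

Let G_ex : exists G : seq 'I_d -> V -> R, forall s y, partials s (f t) y @[t --> F] --> G s y.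
Proof.
have /choice[G HG] : forall p : seq 'I_d * V, exists l : R, partials p.1 (f t) p.2 @[t --> F] --> l.
  move=> [s y] /=; have [r cy] := cube_ball y.
  apply: (ultra_bounded (C := C s r) FU); apply: filterS (tame_f r) => t [W [_ _]]; exact.
by exists (fun s y => G (s, y)) => s y; exact: (HG (s, y)).
Qed.

Let G := sval (cid G_ex).
Let GP s y : partials s (f t) y @[t --> F] --> G s y.
Proof. exact: (svalP (cid G_ex)). Qed.

Let L s r := \sum_i `|C (i :: s) r|.

Let lip t s r y z : tame C r (f t) -> cube 0 r%:R y -> cube 0 r%:R z ->
  `|partials s (f t) y - partials s (f t) z| <= L s r * \sum_i `|y ord0 i - z ord0 i|.
Proof.
move=> [W [[oW sf _] cW Ct]] cy cz.
apply: (cube_lipschitz (A := W) (smooth_on_partials s sf) cW) => // i w cw.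
rewrite partials_cat; apply: le_trans (Ct _ _ cw) _.
by rewrite /L (bigD1 i)//= (le_trans (ler_norm _))// lerDl sumr_ge0.
Qed.

Let G_lip s r y z : cube 0 r%:R y -> cube 0 r%:R z ->
  `|G s y - G s z| <= L s r * \sum_i `|y ord0 i - z ord0 i|.
Proof.
move=> cy cz; refine (@cvg_near_norm_le _ _ F _ _ _ _ (cvgB (@GP s y) (@GP s z)) _).
by apply: filterS (tame_f r) => t Ht; exact: lip.
Qed.

Let G_bound s r y : cube 0 r%:R y -> `|G s y| <= C s r.
Proof.
move=> cy; refine (@cvg_near_norm_le _ _ F _ _ _ _ (@GP s y) _).
by apply: filterS (tame_f r) => t [W [_ _]]; exact.
Qed.

(** The mean value theorem moves the derivative to an intermediate point, and its Lipschitz bound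
    brings it back to [y] at the price of a second factor |u|. *)
Let taylor t s r y i (u : R) : tame C r (f t) -> cube 0 r%:R y -> cube 0 r%:R (u *: e_ i + y) ->
  `|partials s (f t) (u *: e_ i + y) - partials s (f t) y - u * partials (i :: s) (f t) y|
    <= L (i :: s) r * u ^+ 2.
Proof.
move=> Ht cy cu; have [W [[oW sf _] cW Ct]] := Ht.
have seg (v : R) : (0 <= v <= u) || (u <= v <= 0) -> cube 0 r%:R (v *: e_ i + y).
  move=> uv j; have := cu j; have := cy j; rewrite !mxE eqxx !subr0/=.
  case: (j == i); last by rewrite !mulr0 !add0r.
  rewrite !mulr1 !ler_norml => /andP[? ?] /andP[? ?].
  by case/orP: uv => /andP[? ?]; apply/andP; split; lra.
have der (v : R) : (0 <= v <= u) || (u <= v <= 0) ->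
    is_derive (v *: e_ i + y) (e_ i) (partials s (f t)) (partials (i :: s) (f t) (v *: e_ i + y)).
  by move=> uv; apply: smooth_on_derive sf _; exact/cW/seg.
have : exists2 v : R, (0 <= v <= u) || (u <= v <= 0) &
    partials s (f t) (u *: e_ i + y) - partials s (f t) y = u * partials (i :: s) (f t) (v *: e_ i + y).
  have [u0|u0] := leP 0 u.
    have [v uv|v uv] := @line_MVT _ _ (partials s (f t)) (partials (i :: s) (f t)) y i 0 u u0.
      by apply: der; rewrite uv.
    by rewrite scale0r add0r subr0 mulrC => E; exists v; rewrite ?uv.
  have [v uv|v uv] := @line_MVT _ _ (partials s (f t)) (partials (i :: s) (f t)) y i u 0 (ltW u0).
    by apply: der; rewrite uv orbT.
  rewrite scale0r add0r sub0r => E; exists v; first by rewrite uv orbT.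
  by rewrite -opprB E mulrN opprK mulrC.
move=> [v uv ->]; rewrite -mulrBr normrM.
have := lip (i :: s) Ht (seg v uv) cy => /(ler_wpM2l (normr_ge0 u)) /le_trans; apply.
rewrite mulrCA ler_wpM2l ?sumr_ge0// -[leRHS]real_normK ?num_real// expr2 ler_wpM2l//.
rewrite (bigD1 i)//= big1 ?addr0.
  rewrite !mxE !eqxx mulr1 addrK.
  case/orP: uv => /andP[v0 vu]; first by rewrite !ger0_norm//; lra.
  by rewrite !ler0_norm//; lra.
by move=> j ji; rewrite !mxE (negbTE ji) andbF mulr0 add0r subrr normr0.
Qed.

Let G_taylor s r y i (u : R) : cube 0 r%:R y -> cube 0 r%:R (u *: e_ i + y) ->
  `|G s (u *: e_ i + y) - G s y - u * G (i :: s) y| <= L (i :: s) r * u ^+ 2.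
Proof.
move=> cy cu.
apply: (@cvg_near_norm_le _ _ F (fun t => partials s (f t) (u *: e_ i + y) - partials s (f t) y
  - u * partials (i :: s) (f t) y)); last by apply: filterS (tame_f r) => t Ht; exact: taylor.
by apply: cvgB; [apply: cvgB; exact: GP|apply: cvgMl_tmp; exact: GP].
Qed.

Let G_derive s i y : is_derive y (e_ i) (G s) (G (i :: s) y).
Proof.
have [r cy] := cube_ball y.
apply: (@is_derive_quadratic _ _ _ _ (L (i :: s) r.+1) 1 ltr01) => u u1.
apply: G_taylor; last by rewrite -natr1; exact: cube_near.
by apply: sub_cube cy; rewrite ler_nat.
Qed.

Let G_continuous s (y : V) : {for y, continuous (G s)}.
Proof.
have [r cy] := cube_ball y; apply/(@cvgrPdist_lt _ _ _ (nbhs (y : V))) => e e0.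
have L0 : 0 <= L s r.+1 by apply: sumr_ge0.
pose K := L s r.+1 * d%:R + 1; have K0 : 0 < K by rewrite ltr_wpDl// mulr_ge0.
have d0 : 0 < Num.min 1 (e / K) by rewrite lt_min ltr01 divr_gt0.
apply/(@nbhs_normP R V y); exists (Num.min 1 (e / K)) => // z; rewrite /= lt_min => /andP[z1 ze].
have cz : cube 0 r.+1%:R z.
  move=> j; rewrite mxE subr0 -natr1 -[z ord0 j](subrK (y ord0 j)).
  apply: (le_trans (ler_normD _ _)); rewrite addrC lerD//.
    by have := cy j; rewrite mxE subr0.
  rewrite distrC; apply: le_trans (ltW z1); apply: le_trans (coord_le_norm _ j).
  by rewrite !mxE.
have cy' : cube 0 r.+1%:R y by apply: sub_cube cy; rewrite ler_nat.
apply: (le_lt_trans (G_lip s cy' cz)).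
apply: (@le_lt_trans _ _ (K * `|y - z|)); last by rewrite mulrC -ltr_pdivlMr.
apply: (@le_trans _ _ (L s r.+1 * (d%:R * `|y - z|))).
  rewrite ler_wpM2l//; apply: sum_ord_le => j.
  by apply: le_trans (coord_le_norm _ j); rewrite !mxE.
by rewrite mulrA ler_wpM2r// /K lerDl.
Qed.

Let G_smooth : smooth_on setT (G [::]) /\ forall s x, partials s (G [::]) x = G s x.
Proof.
have [//|s x _|s i x _|sG E] := @smooth_on_family _ _ setT (G [::]) G openT.
- exact: G_continuous.
- exact: G_derive.
- by split=> // s x; exact: E.
Qed.

Let G_free : free_particle (G [::]).
Proof.
have [sG E] := G_smooth; split=> // x.
have [r cx] := cube_ball x.
have H : (fun t => - \sum_(i < d) partials [:: i; i] (f t) x - f t x) @ F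
     --> - \sum_(i < d) G [:: i; i] x - G [::] x.
  apply: cvgB; last exact: (@GP [::] x).
  by apply: cvgN; apply: cvg_sumr => i; exact: GP.
have : `|- \sum_(i < d) G [:: i; i] x - G [::] x| <= 0.
  apply: (@cvg_near_norm_le _ _ F _ _ _ _ H); apply: filterS (tame_f r) => t [W [[_ _ lap] cW _]].
  have H0 : - laplacian (f t) x - f t x = 0.
    by rewrite lap ?mul1r ?subrr//; exact: cW.
  by rewrite /laplacian in H0; rewrite /= H0 normr0.
rewrite normr_le0 subr_eq0 => /eqP <-; congr (- _).
by apply: eq_bigr => i _; exact: E.
Qed.

(** Otherwise the ultrafilter selects points [y t] of the cube with error at least [e]. They
    converge to some [z] by compactness, and the common Lipschitz bound together with convergence at
    [z] gives a contradiction. *)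
Let G_uniform s r (e : R) : 0 < e ->
  F [set t | forall y, cube 0 r%:R y -> `|partials s (f t) y - G s y| < e].
Proof.
move=> e0; set P := [set t | _].
have [//|FnP] := in_ultra_setVsetC P FU.
have /choice[y Hy] t : exists y, ~ P t -> cube 0 r%:R y /\ e <= `|partials s (f t) y - G s y|.
  have [Pt|/existsNP[y /not_implyP[cy /negP]]] := pselect (P t); first by exists 0.
  by rewrite -leNgt => ey; exists y.
have := @cube_compact R d r%:R; rewrite compact_ultra => Hc.
have [|z [cz yz]] := Hc (y @ F) (fmap_ultra y FU).
  by rewrite /fmap/=; apply: filterS FnP => t /Hy[].
have L0 : 0 <= L s r by apply: sumr_ge0.
have H : (fun t => L s r * (\sum_i `|y t ord0 i - z ord0 i| + \sum_i `|y t ord0 i - z ord0 i|)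
    + `|partials s (f t) z - G s z|) @ F --> L s r * (\sum_(i < d) 0 + \sum_(i < d) 0) + `|G s z - G s z|.
  have Hs : (fun t => \sum_(i < d) `|y t ord0 i - z ord0 i|) @ F --> \sum_(i < d) (0 : R).
    apply: cvg_sumr => i; rewrite -(normr0 R) -(subrr (z ord0 i)); apply: cvg_norm.
    apply: cvgB; last exact: cvg_cst.
    exact: (@cvg_comp _ _ _ y (fun v : V => v ord0 i) _ _ _ yz (@coord_continuous R _ _ ord0 i z)).
  apply: cvgD; last by apply: cvg_norm; apply: cvgB; [exact: GP|exact: cvg_cst].
  by apply: cvgMl_tmp; apply: cvgD.
rewrite big1// addr0 mulr0 add0r subrr normr0 in H.
have /cvgrPdist_lt/(_ _ e0) H' := H.
have [t [[nPt Ht] Dt]] := filter_ex (filterI (filterI FnP (tame_f r)) H').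
have [cy ey] := Hy t nPt; exfalso.
move: Dt => /=; rewrite sub0r normrN => Dt.
have : e < e; last by rewrite ltxx.
apply: (le_lt_trans ey); apply: le_lt_trans Dt; apply: le_trans (ler_norm _).
rewrite (_ : partials s (f t) (y t) - G s (y t) =
  (partials s (f t) (y t) - partials s (f t) z) + (G s z - G s (y t)) + (partials s (f t) z - G s z)); last by ring.
apply: (le_trans (ler_normD _ _)); rewrite lerD2r mulrDr.
apply: (le_trans (ler_normD _ _)); apply: lerD; first exact: lip.
by rewrite distrC; exact: G_lip.
Qed.

(* Arzela-Ascoli, with limits along an ultrafilter instead of subsequences. *)
Lemma tame_limit : exists g : FP R d,
  (forall r, tame C r g) /\
  forall s r (e : R), 0 < e ->
    F [set t | forall y, cube 0 r%:R y -> `|partials s (f t) y - partials s g y| < e].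
Proof.
have [sG E] := G_smooth.
exists (MkFP (asboolT G_free)); split=> [r|s r e e0].
  exists setT; split=> [||s y cy] //.
  - split; [exact: openT|exact: sG|move=> x _].
    by rewrite mul1r; exact: G_free.2.
  - by rewrite E; exact: G_bound.
apply: filterS (G_uniform s r e0) => t Ht y cy /=.
by rewrite E; exact: Ht.
Qed.

End compactness.

Lemma dist_k_le k (f g : V -> R) (e : R) (r : nat) : C_on k setT f -> C_on k setT g ->
  0 < e -> e^-1 <= r%:R ->
  (forall s y, (size s <= k)%N -> cube 0 r%:R y -> `|partials s f y - partials s g y| <= e / 2) ->
  dist_k k f g <= e.
Proof.
move=> cf cg e0 er H; apply: ge_inf; first by exists 0 => x [/ltW].
split=> //; apply: (@le_lt_trans _ _ (e / 2)%:E); last by rewrite lte_fin ltr_pdivrMr//; lra.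
apply: ge_ereal_sup => _ [s [x [sk xe ->]]]; rewrite lee_fin (partialsB cf cg sk)/=.
apply: H => // i; rewrite mxE subr0; apply: le_trans (coord_le_enorm x i) _.
exact: le_trans (ltW xe) er.
Qed.

Lemma cvg_Cspace k (T : Type) (F : set_system T) (f : T -> Cspace R d k) (g : Cspace R d k)
    {FF : Filter F} :
  (forall s r (e : R), 0 < e ->
    F [set t | forall y, cube 0 r%:R y -> `|partials s (f t) y - partials s g y| < e]) ->
  f @ F --> g.
Proof.
move=> H; apply/cvg_ballP => e e0; rewrite near_simpl.
have e2 : 0 < e / 2 by rewrite divr_gt0.
have e4 : 0 < e / 2 / 2 by rewrite divr_gt0.
have [r er] : exists r : nat, (e / 2)^-1 <= r%:R.
  by exists (Num.truncn (e / 2)^-1).+1; exact/ltW/truncnS_gt.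
(* There are finitely many multi-indices of length at most [k], so the convergence is simultaneous
   for all of them. *)
have := filter_forall (f := fun s : {bseq k of 'I_d} => [set t | forall y, cube 0 r%:R y ->
   `|partials s (f t) y - partials s g y| < e / 2 / 2]) FF (fun s => H s r _ e4).
apply: filterS => t /= Ht; rewrite ballEmdist/= metric_sym.
apply: (@le_lt_trans _ _ (e / 2)); last by rewrite ltr_pdivrMr//; lra.
apply: (dist_k_le (CspaceP _) (CspaceP _) e2 er) => s y sk cy.
exact/ltW/(Ht (Bseq sk)).
Qed.

Lemma cvg_FP (T : Type) (F : set_system T) (f : T -> FP R d) (g : FP R d) {FF : Filter F} :
  (forall s r (e : R), 0 < e ->
    F [set t | forall y, cube 0 r%:R y -> `|partials s (f t) y - partials s g y| < e]) ->
  f @ F --> g.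
Proof.
move=> H.
have Hc : (fun t => FP_incl 0 (f t)) @ F --> FP_incl 0 g by apply: cvg_Cspace.
move=> A /= [B [[C oC <-] Cg CA]].
have Cn : nbhs (FP_incl 0 g) C by exact: open_nbhs_nbhs.
have FC : F [set t | C (FP_incl 0 (f t))] := Hc _ Cn.
change (F (f @^-1` A)); apply: filterS FC => t Ct; exact: CA.
Qed.

(** The limit [g] is fixed before [k]: the same element of FP is the limit in every H^k. *)
Lemma tame_cvg (T : Type) (F : set_system T) (f : T -> V -> R) C : UltraFilter F ->
  (forall r, F [set t | tame C r (f t)]) ->
  exists g : FP R d, (forall r, tame C r g) /\
    forall k, F [set t | C_on k setT (f t)] -> to_Cspace k (f t) @[t --> F] --> FP_incl k g.
Proof.
move=> FU Hf; have [g [tg Hg]] := tame_limit FU Hf; exists g; split=> // k Fk.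
apply: cvg_Cspace => s r e e0.
apply: filterS2 Fk (Hg s r e e0) => t ct Ht y cy.
by rewrite /to_Cspace val_insubd asboolT//; exact: Ht.
Qed.

Definition tame_space C : set (FP R d) := [set g | forall r, tame C r g].

Lemma tame_compact C : compact (tame_space C).
Proof.
rewrite compact_ultra => F FU FK.
have [g [tg Hg]] := @tame_limit (FP R d) F (fun f => f : V -> R) C FU
  (fun r => filterS (fun f (H : tame_space C f) => H r) FK).
by exists g; split=> //; apply: cvg_FP => s r e e0; exact: Hg.
Qed.

Lemma FP_cozero (A : set (FP R d)) : open A -> exists g : Cb R (FP R d),
  (forall x, 0 <= g x <= 1) /\ (forall x, A x <-> 0 < g x).
Proof.
move=> [C oC <-]; have [g [cg g01 Cg]] := metric_cozero oC.
have cgi : continuous (fun x => g (FP_incl 0 x)).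
  move=> x; apply: continuous_comp; [exact: initial_continuous|exact: cg].
have bg : exists M, forall x, `|g (FP_incl 0 x)| <= M.
  by exists 1 => x; have /andP[? ?] := g01 (FP_incl 0 x); rewrite ger0_norm.
by exists (mkCb cgi bg); split=> x; [exact: g01|exact: Cg].
Qed.

End Limit.

(** * The localized functions *)

Section Class.
Variables (R : realType) (d : nat).
Local Notation V := 'rV[R]_d.
Local Notation e_ i := (delta_mx ord0 i : V).

(** A class of parametrized functions stable under differentiation produces the family that
    [smooth_on_family] needs. Each derivative stays in [P] as a function of the parameter too, so
    [P] can also record how it depends on [x]. *)
Lemma smooth_class (T : Type) (P : set (T -> V -> R)) (B : set T) (A : set V) (f : T -> V -> R) :
  open A ->
  (forall g, P g -> forall x y, B x -> A y -> {for y, continuous (g x)}) ->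
  (forall g i, P g -> exists g', P g' /\
     forall x y, B x -> A y -> is_derive y (e_ i) (g x) (g' x y)) ->
  P f ->
  exists F : seq 'I_d -> T -> V -> R, (forall s, P (F s)) /\
    forall x, B x -> smooth_on A (f x) /\ forall s y, A y -> partials s (f x) y = F s x y.
Proof.
move=> oA cP dP Pf.
have /choice[D DP] : forall p : 'I_d * (T -> V -> R), exists g', P p.2 -> P g' /\
    forall x y, B x -> A y -> is_derive y (e_ p.1) (p.2 x) (g' x y).
  move=> [i g] /=; have [Pg|nPg] := pselect (P g); last by exists g.
  by have [g' ?] := dP _ i Pg; exists g'.
pose F s := foldr (fun i g => D (i, g)) f s.
have PF s : P (F s) by elim: s => //= i s IH; exact: (DP (i, _) IH).1.
exists F; split=> // x Bx.
have [//|s y Ay|s i y Ay|sf E] := @smooth_on_family _ _ A (f x) (F ^~ x) oA.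
- exact: cP (PF s) _ _ Bx Ay.
- exact: (DP (i, _) (PF s)).2.
- by split.
Qed.

End Class.

(** * The Euclidean norm *)

Section Euclid.
Variables (R : realType) (d : nat).
Local Notation V := 'rV[R]_d.
Local Notation e_ i := (delta_mx ord0 i : V).
Implicit Types (x y z : V).

Lemma enorm_sqr x : enorm x ^+ 2 = \sum_i x ord0 i ^+ 2.
Proof. by rewrite sqr_sqrtr//; apply: sumr_ge0 => i _; exact: sqr_ge0. Qed.

Lemma enormZ (a : R) x : enorm (a *: x) = `|a| * enorm x.
Proof.
rewrite -sqrtr_sqr -sqrtrM ?sqr_ge0// /enorm mulr_sumr; congr Num.sqrt.
by apply: eq_bigr => i _; rewrite mxE exprMn.
Qed.

Lemma enormN x : enorm (- x) = enorm x.
Proof. by rewrite -scaleN1r enormZ normrN1 mul1r. Qed.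

Lemma enorm_sym x y : enorm (x - y) = enorm (y - x).
Proof. by rewrite -enormN opprB. Qed.

Lemma enorm_eq0 x : enorm x = 0 -> x = 0.
Proof.
move=> x0; apply/rowP => i; apply/eqP; rewrite mxE -normr_le0 -x0.
exact: coord_le_enorm.
Qed.

Lemma enorm_gt0 x : x != 0 -> 0 < enorm x.
Proof.
move=> x0; rewrite lt_neqAle enorm_ge0 andbT eq_sym.
by apply: contra x0 => /eqP/enorm_eq0/eqP.
Qed.

Lemma enorm_le_l1 x : enorm x <= \sum_i `|x ord0 i|.
Proof.
have s0 : 0 <= \sum_i `|x ord0 i| by apply: sumr_ge0.
rewrite -(ler_sqr (x := enorm x)) ?nnegrE ?enorm_ge0// enorm_sqr.
rewrite [leRHS]expr2 mulr_sumr; apply: ler_sum => i _.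
rewrite -real_normK ?num_real// expr2 ler_wpM2r//.
by rewrite (bigD1 i)//= lerDl sumr_ge0.
Qed.

Lemma enorm_le_sup x (t : R) : (forall i, `|x ord0 i| <= t) -> enorm x <= d%:R * t.
Proof. by move=> xt; apply: le_trans (enorm_le_l1 x) _; exact: sum_ord_le. Qed.

Lemma cauchy_schwarz x y : \sum_i x ord0 i * y ord0 i <= enorm x * enorm y.
Proof.
have [->|y0] := eqVneq y 0.
  by rewrite big1 ?mulr_ge0 ?enorm_ge0// => i _; rewrite mxE mulr0.
have [->|x0] := eqVneq x 0.
  by rewrite big1 ?mulr_ge0 ?enorm_ge0// => i _; rewrite mxE mul0r.
have a0 := enorm_gt0 x0; have b0 := enorm_gt0 y0.
have : 0 <= \sum_i (enorm y * x ord0 i - enorm x * y ord0 i) ^+ 2.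
  by apply: sumr_ge0 => i _; exact: sqr_ge0.
rewrite (eq_bigr (fun i => enorm y ^+ 2 * x ord0 i ^+ 2 + enorm x ^+ 2 * y ord0 i ^+ 2
  - enorm x * enorm y *+ 2 * (x ord0 i * y ord0 i))); last by move=> i _; ring.
rewrite sumrB big_split/= -!mulr_sumr -!enorm_sqr; move: (\sum_i _) => s.
rewrite (_ : _ - _ = enorm x * enorm y *+ 2 * (enorm x * enorm y - s)); last by ring.
by rewrite pmulr_rge0 ?subr_ge0// pmulrn_rgt0// mulr_gt0.
Qed.

Lemma ler_enormD x y : enorm (x + y) <= enorm x + enorm y.
Proof.
rewrite -(ler_sqr (x := enorm _)) ?nnegrE ?addr_ge0 ?enorm_ge0// enorm_sqr.
rewrite (eq_bigr (fun i => x ord0 i ^+ 2 + y ord0 i ^+ 2 + (x ord0 i * y ord0 i + x ord0 i * y ord0 i))); last first.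
  by move=> i _; rewrite mxE; ring.
rewrite !big_split/= -!enorm_sqr; have := cauchy_schwarz x y; nra.
Qed.

Lemma enorm_triangle x y z : enorm (x - z) <= enorm (x - y) + enorm (y - z).
Proof. by rewrite -[x - z](_ : (x - y) + (y - z) = _) ?ler_enormD// addrA subrK. Qed.

Lemma enorm_continuous : continuous (@enorm R d).
Proof.
move=> x; apply: (@continuous_comp _ _ _ (fun x : V => \sum_i x ord0 i ^+ 2) Num.sqrt).
  apply: (@continuous_big R _ +%R 0 xpredT add_continuous V _ (fun i z => z ord0 i ^+ 2)) => i _ {}x.
  apply: (@continuous_comp _ _ _ (fun x : V => x ord0 i) (fun u : R => u ^+ 2)).
    exact: coord_continuous.
  exact: exprn_continuous.
exact: sqrt_continuous.
Qed.

Lemma open_eball (r : R) : open (@eball R d r).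
Proof. change (open (@enorm R d @^-1` [set u | u < r])).
apply: open_comp; [by move=> x _; exact: enorm_continuous|exact: open_lt]. Qed.

Lemma is_derive_enorm x i : x != 0 ->
  is_derive x (e_ i) (@enorm R d) (x ord0 i * (enorm x)^-1).
Proof.
move=> x0; have e0 := enorm_gt0 x0.
have ds : is_derive x (e_ i) (fun z : V => \sum_j z ord0 j ^+ 2) (x ord0 i *+ 2).
  have H j : is_derive x (e_ i) (fun z : V => z ord0 j ^+ 2) ((j == i)%:R * x ord0 i *+ 2).
    have := is_derive_coord x i j => dc; apply: is_derive_eq.
    change (x ord0 j * (j == i)%:R + x ord0 j * (j == i)%:R = (j == i)%:R * x ord0 i *+ 2).
    by case: eqP => [->|_]; rewrite ?mulr0 ?mul0r ?mul0rn ?addr0// mulr1 mul1r mulr2n.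
  have -> : (fun z : V => \sum_j z ord0 j ^+ 2) = \sum_j (fun z : V => z ord0 j ^+ 2).
    by apply/funext => z; rewrite fct_sumE.
  apply: (is_derive_eq (is_derive_sum H)).
  rewrite (bigD1 i)//= eqxx mul1r big1 ?addr0// => j /negbTE ->.
  by rewrite mul0r mul0rn.
have p0 : 0 < \sum_j x ord0 j ^+ 2 by rewrite -enorm_sqr exprn_gt0.
have := is_derive_comp1 (is_derive1_sqrt p0) ds.
rewrite -/(enorm x) => H; apply: (is_derive_eq H).
by field; rewrite gt_eqF.
Qed.

End Euclid.

(** * The radial cutoff function *)

Section Cutoff.
Variables (R : realType) (d : nat) (chi : R -> R).
Hypothesis chiP : cutoff chi.
Local Notation V := 'rV[R]_d.
Local Notation e_ i := (delta_mx ord0 i : V).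

Lemma cutoff_derive n (t : R) : 0 < t -> is_derive t 1 (derive1n n chi) (derive1n n.+1 chi t).
Proof.
move=> t0; rewrite derive1nS derive1E; apply/derivableP.
by have [H _ _ _ _] := chiP; exact: H.
Qed.

(** A class of expressions that contains chi(|z|) and is stable under differentiation away from 0.
    The argument in [unit] is the trivial parameter for [smooth_class]. *)
Inductive radial : (unit -> V -> R) -> Prop :=
| radial_cst c : radial (fun _ _ => c)
| radial_coord j : radial (fun _ z => z ord0 j)
| radial_inv : radial (fun _ z => (enorm z)^-1)
| radial_chi n : radial (fun _ z => derive1n n chi (enorm z))
| radial_add f g : radial f -> radial g -> radial (fun u z => f u z + g u z)
| radial_mul f g : radial f -> radial g -> radial (fun u z => f u z * g u z).

Let A0 := [set z : V | z != 0].

Lemma radial_derive g i : radial g -> exists g', radial g' /\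
  forall u z, True -> A0 z -> is_derive z (e_ i) (g u) (g' u z).
Proof.
elim=> {g} [c|j||n|f g _ [f' [rf' df]] _ [g' [rg' dg]]|f g rf [f' [rf' df]] rg [g' [rg' dg]]].
- exists (fun _ _ => 0); split; first exact: radial_cst.
  by move=> u z _ _; exact: is_derive_cst.
- exists (fun _ _ => (j == i)%:R); split; first exact: radial_cst.
  by move=> u z _ _; exact: is_derive_coord.
- exists (fun u z => -1 * ((enorm z)^-1 * (enorm z)^-1) * (z ord0 i * (enorm z)^-1)); split.
    by do ![exact: radial_cst|exact: radial_coord|exact: radial_inv|apply: radial_mul].
  move=> u z _ z0; have n0 := enorm_gt0 z0.
  have dV : is_derive (enorm z) 1 (fun t : R => t^-1) (-1 * ((enorm z)^-1 * (enorm z)^-1)).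
    have H := @is_deriveV R id (enorm z) 1 1 (lt0r_neq0 n0) (is_derive_id _ _).
    by apply: (is_derive_eq H); rewrite /= [_ *: _]mulr1 -exprVn expr2 mulN1r.
  exact: (is_derive_comp1 dV (is_derive_enorm i z0)).
- exists (fun u z => derive1n n.+1 chi (enorm z) * (z ord0 i * (enorm z)^-1)); split.
    by do ![exact: radial_chi|exact: radial_coord|exact: radial_inv|apply: radial_mul].
  move=> u z _ z0.
  exact: (is_derive_comp1 (cutoff_derive n (enorm_gt0 z0)) (is_derive_enorm i z0)).
- exists (fun u z => f' u z + g' u z); split; first exact: radial_add.
  by move=> u z _ z0; have := df u z Logic.I z0; have := dg u z Logic.I z0 => ? ?; exact: is_deriveD.
- exists (fun u z => f u z * g' u z + g u z * f' u z); split.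
    by apply: radial_add; exact: radial_mul.
  by move=> u z _ z0; have := df u z Logic.I z0; have := dg u z Logic.I z0 => ? ?; exact: is_deriveM.
Qed.

Lemma radial_continuous g : radial g -> forall u z, True -> A0 z -> {for z, continuous (g u)}.
Proof.
elim=> {g} [c|j||n|f g _ cf _ cg|f g _ cf _ cg] u z _ z0.
- exact: cst_continuous.
- exact: coord_continuous.
- have nz : enorm z != 0 by rewrite gt_eqF// enorm_gt0.
  exact: (cvgV nz (@enorm_continuous R d z)).
- apply: (@continuous_comp _ _ _ (@enorm R d) (derive1n n chi)); first exact: enorm_continuous.
  have := cutoff_derive n (enorm_gt0 z0) => -[H _].
  exact: differentiable_continuous ((derivable1_diffP _ _).1 H).
- by have := cf u z Logic.I z0; have := cg u z Logic.I z0 => c1 c2; exact: (cvgD c2 c1).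
- by have := cf u z Logic.I z0; have := cg u z Logic.I z0 => c1 c2; exact: (cvgM c2 c1).
Qed.

Definition bump (z : V) : R := chi (enorm z).

(** At the origin the norm is not smooth, but there the cutoff is constantly 1; elsewhere the radial
    class applies. *)
Lemma bump_smooth : smooth_on setT bump.
Proof.
have [_ [e e0 He] _ _ _] := chiP.
have oA : open A0.
  rewrite (_ : A0 = (@enorm R d) @^-1` [set u | 0 < u]).
    by apply: open_comp; [by move=> x _; exact: enorm_continuous|exact: open_gt].
  apply/seteqP; split => z /= z0; first exact: enorm_gt0.
  by apply: contraTneq z0 => ->; rewrite enorm0 ltxx.
have [F [_ /(_ tt Logic.I)[sA _]]] := smooth_class (B := setT) oA radial_continuous
  (fun g i => @radial_derive g i) (radial_chi 0).
have sB : smooth_on (@eball R d e) bump.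
  apply: (@eq_smooth_on _ _ _ (fun=> 1)); first exact: open_eball.
    by move=> y ye; rewrite /bump He// enorm_ge0.
  have dc (s : seq 'I_d) (i : 'I_d) (x : V) : eball e x ->
    is_derive x (e_ i) (fun=> (s == [::])%:R : R) (i :: s == [::])%:R.
    by move=> _; exact: is_derive_cst.
  apply: (smooth_on_family (F := fun s _ => (s == [::])%:R) (@open_eball _ _ e) _ _ dc).1 => // s x _.
  exact: cst_continuous.
apply/smooth_onP => s z _; have [->|z0] := eqVneq z 0.
  by move/smooth_onP: sB; apply; rewrite /eball/= enorm0.
by move/smooth_onP: sA; apply.
Qed.

Lemma bump_partials0 s z : 1 <= enorm z -> partials s bump z = 0.
Proof.
have [_ _ chi0 _ _] := chiP.
have oB : open [set z : V | 1 < enorm z].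
  change (open (@enorm R d @^-1` [set u | 1 < u])).
  by apply: open_comp; [by move=> x _; exact: enorm_continuous|exact: open_gt].
have H y : 1 < enorm y -> partials s bump y = 0.
  move=> y1; rewrite (@eq_partials _ _ _ _ (fun=> 0) _ _ oB) ?partials0//.
  by move=> x x1; rewrite /bump chi0.
rewrite le_eqVlt => /predU1P[z1|]; last exact: H.
have z0 : z != 0 by apply: contra_eq_neq z1 => ->; rewrite enorm0 oner_eq0.
(* On the sphere itself the value is the limit along the ray from outside, where the derivative
   vanishes. *)
have c1 : {for 1 : R, continuous (fun u : R => partials s bump (u *: z))}.
  apply: (@continuous_comp _ _ _ (fun u : R => u *: z) (partials s bump)).
    exact: scalel_continuous.
  exact: (smooth_on_continuous (s := s) bump_smooth).
have c1' : partials s bump (u *: z) @[u --> 1^'+] --> partials s bump z.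
  by rewrite -[in X in _ --> X](scale1r z); exact: cvg_at_right_filter c1.
apply: (cvg_unique _ c1') => //; apply: cvg_near_cst.
near=> u; apply: H; rewrite enormZ -z1 mulr1.
have u1 : 1 < u by near: u; exact: nbhs_right_gt.
by rewrite ger0_norm// ltW// (lt_trans ltr01).
Unshelve. all: by end_near. Qed.

(** Induction on [m], for all [s] at once: every derivative vanishes at the nearest point w = z/|z|
    of the sphere, so flatness of order [m] of the next derivatives gains one order between [w] and
    [z]. Points of the cube of half-side t = 1 - |z| around [z] satisfy 1 - |v| <= (d + 1) t, hence
    the factor (d + 1)^m. *)
Lemma bump_flat m s : exists2 K : R, 0 <= K &
  forall z, enorm z < 1 -> `|partials s bump z| <= K * (1 - enorm z) ^+ m.
Proof.
have bdd t : exists2 K : R, 0 <= K & forall z, enorm z < 1 -> `|partials t bump z| <= K.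
  have [M HM] := Ck_bounded (bump_smooth (size t)).
  exists `|M| => // z z1; apply: le_trans (ler_norm _); exact: HM.
elim: m s => [|m IH] s.
  by have [K K0 HK] := bdd s; exists K => // z /HK; rewrite expr0 mulr1.
have [K0 K00 HK0] := bdd s.
have /choice[K HK] : forall i, exists K : R, 0 <= K /\ forall z, enorm z < 1 ->
    `|partials (i :: s) bump z| <= K * (1 - enorm z) ^+ m.
  by move=> i; have [K ? ?] := IH (i :: s); exists K.
pose L := \sum_i K i; have L0 : 0 <= L by apply: sumr_ge0 => i _; exact: (HK i).1.
exists (K0 + L * (d.+1%:R) ^+ m * d%:R).
  by rewrite addr_ge0// !mulr_ge0// exprn_ge0.
move=> z z1; have t0 : 0 < 1 - enorm z by rewrite subr_gt0.
(* The origin has no preferred nearest point on the sphere; the term [K0] of the constant takes care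
   of it. *)
rewrite mulrDl; have [->|zn0] := eqVneq z 0.
  rewrite enorm0 subr0 expr1n !mulr1; apply: le_trans (HK0 0 _) _; first by rewrite enorm0.
  by rewrite lerDl !mulr_ge0// exprn_ge0.
apply: ler_wpDl; first by rewrite mulr_ge0// exprn_ge0// ltW.
have nz := enorm_gt0 zn0.
pose w := (enorm z)^-1 *: z.
have w1 : enorm w = 1 by rewrite enormZ ger0_norm ?invr_ge0 ?enorm_ge0// mulVf// gt_eqF.
have zw : enorm (w - z) = 1 - enorm z.
  have -> : w - z = ((enorm z)^-1 - 1) *: z by rewrite scalerBl scale1r.
  rewrite enormZ ger0_norm; last first.
    by rewrite subr_ge0 invf_ge1// ltW.
  by rewrite mulrBl mulVf ?gt_eqF// mul1r.
set t := 1 - enorm z in t0 zw *.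
have cz : cube z t z by move=> i; rewrite subrr normr0 ltW.
have cw : cube z t w by move=> i; rewrite -zw; have := coord_le_enorm (w - z) i; rewrite !mxE.
have bound i v : cube z t v -> `|partials [:: i] (partials s bump) v| <= L * (d.+1%:R * t) ^+ m.
  move=> cv; rewrite -[partials _ _]/(partials (i :: s) bump).
  have [v1|v1] := ltP (enorm v) 1; last first.
    by rewrite bump_partials0// normr0 mulr_ge0// exprn_ge0// mulr_ge0// ltW.
  apply: le_trans ((HK i).2 _ v1) _; apply: ler_pM.
  - exact: (HK i).1.
  - by rewrite exprn_ge0// subr_ge0 ltW.
  - by rewrite /L (bigD1 i)//= lerDl sumr_ge0// => j _; exact: (HK j).1.
  rewrite lerXn2r ?nnegrE ?mulr_ge0 ?subr_ge0 ?(ltW t0) ?(ltW v1) ?(ltW z1)//.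
  have : enorm (z - v) <= d%:R * t.
    by rewrite enorm_sym; apply: enorm_le_sup => j; rewrite !mxE; exact: cv.
  have := ler_enormD (z - v) v; rewrite subrK -natr1 /t; lra.
have := cube_lipschitz (smooth_on_partials s bump_smooth) (@subsetT _ _) bound cz cw.
rewrite (bump_partials0 _ (z := w)) ?w1// subr0 => /le_trans; apply.
rewrite exprMn exprS -!mulrA ler_wpM2l// ler_wpM2l ?exprn_ge0//.
rewrite [leRHS]mulrCA mulrA [leRHS]mulrC ler_wpM2l ?exprn_ge0 ?(ltW t0)//.
by rewrite mulrC; apply: sum_ord_le => j; rewrite distrC; exact: cw.
Qed.

End Cutoff.

Lemma measurable_row_affine (R : realType) d (a : 'rV[R]_d) (r : R) (g : borel 'rV[R]_d -> \bar R) :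
  measurable_fun setT g -> measurable_fun setT (fun t => g (a + r *: row_of_tuple t)).
Proof.
move=> mg; under eq_fun do rewrite -row_affine_tuple.
exact: (measurableT_comp (measurable_row mg) (measurable_affine_tuple _ _)).
Qed.

Lemma leb_bounded (R : realType) d (Omega : set (borel 'rV[R]_d)) : measurable Omega ->
  bounded_set (Omega : set 'rV[R]_d) -> (leb Omega < +oo)%E.
Proof.
move=> mO bO; have [M [_ HM]] := bO; pose r := `|M| + 1; have r0 : 0 < r by rewrite ltr_wpDl.
have HO x : Omega x -> cube 0 r x.
  move=> Ox i; rewrite mxE subr0; apply: le_trans (coord_le_norm x i) _.
  by apply: HM Ox; rewrite (le_lt_trans (ler_norm _))// ltrDl.
pose f (x : borel 'rV[R]_d) : \bar R := (\1_Omega x : R)%:E.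
have mf : measurable_fun setT f by apply/measurable_EFinP; exact: measurable_indic.
have f0 x : (0 <= f x)%E by rewrite lee_fin indicE.
have := @integral_leb_affine R d 0 r f r0 mf f0.
have -> : (\int[@leb R d]_x f x = leb Omega)%E.
  by rewrite (@integral_indic _ _ _ (@leb R d) setT measurableT Omega mO) setIT.
move=> H.
have rd : 0 < r ^- d by rewrite invr_gt0 exprn_gt0.
suff : ((r ^- d)%:E * leb Omega < +oo)%E.
  move: (measure_ge0 (@leb R d) Omega); case: (leb Omega) => [x _ _|_|//]; first by rewrite ltry.
  by rewrite gt0_muley ?lte_fin// ltxx.
rewrite -H; apply: (@le_lt_trans _ _ (J (fun=> 1%:E))); last by rewrite J_cst// ltry.
rewrite /J [leRHS]integral_mkcond; apply: ge0_le_integral => //.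
- exact: measurable_row_affine.
- exact: measurable_patch_tcube.
move=> t _; rewrite /f indicE patchE; set w := 0 + _; have [Ow|_] := boolP (w \in Omega); last first.
  by case: ifP; rewrite lee_fin.
rewrite mem_set// => i; have := HO w (set_mem Ow) i.
by rewrite /w add0r !mxE subr0 normrM ger0_norm ?(ltW r0)// -[leRHS]mulr1 ler_pM2l.
Qed.

(** * The distance to the boundary *)

Section Domain.
Variables (R : realType) (d : nat) (Omega : set 'rV[R]_d).
Local Notation V := 'rV[R]_d.
Local Notation e_ i := (delta_mx ord0 i : V).
Local Notation bd := (boundary Omega).
Local Notation D x := (edist_to x bd).
Hypotheses (oO : open Omega) (bO : bounded_set Omega) (d0 : (0 < d)%N).

(** The boundary point is where the segment from [x] to [z] first leaves [Omega]. *)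
Lemma segment_boundary x z : Omega x -> ~ Omega z ->
  exists2 b, bd b & enorm (x - b) <= enorm (x - z).
Proof.
move=> Ox nOz; pose p (t : R) : V := x + t *: (z - x).
have cp : continuous p.
  move=> t; apply: (@continuousD _ _ _ (cst x : R -> V) (fun t : R => t *: (z - x)) t).
    exact: cst_continuous.
  exact: scalel_continuous.
pose S := [set t : R | 0 <= t /\ ~ Omega (p t)].
have lb0 : lbound S 0 by move=> t [].
have S1 : S 1 by split=> //; rewrite /p scale1r addrCA subrr addr0.
have hS : has_inf S by split; [exists 1|exists 0].
pose t := inf S; have t0 : 0 <= t by apply: lb_le_inf => //; exists 1.
have t1 : t <= 1 by apply: ge_inf => //; exists 0.
have nOt : ~ Omega (p t).
  move=> Opt; have : nbhs t (p @^-1` Omega) by apply: cp; exact: open_nbhs_nbhs.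
  move=> /nbhs_ballP[e /= e0 He].
  have [u [u0 nu] ute] := inf_adherent e0 hS.
  have tu : t <= u by apply: ge_inf; [exists 0|split].
  by apply: nu; apply: He; rewrite /ball/= distrC ger0_norm ?subr_ge0// ltrBlDl.
have tp : 0 < t.
  rewrite lt_neqAle t0 andbT; apply/eqP => tE; apply: nOt.
  by rewrite -tE /p scale0r addr0.
exists (p t).
  split; last by rewrite (interior_id Omega).1.
  have : p u @[u --> t^'-] --> p t by apply: cvg_at_left_filter; exact: cp.
  move=> Hp; apply: (closed_cvg _ (@closed_closure _ Omega) _ _ Hp).
  near=> u; apply: subset_closure; apply: contrapT => nu.
  have ut : u < t by near: u; exact: nbhs_left_lt.
  suff : t <= u by rewrite leNgt ut.
  apply: ge_inf; first by exists 0.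
  by split=> //; near: u; exact: nbhs_left_ge.
rewrite /p opprD addrA subrr sub0r enormN enormZ ger0_norm// enorm_sym.
by rewrite ler_piMl// enorm_ge0.
Unshelve. all: by end_near. Qed.

(** In positive dimension a bounded set is not the whole space. If the boundary were empty,
    [edist_to] would be an infimum over the empty set, that is 0. *)
Lemma boundary_nonempty x : Omega x -> bd !=set0.
Proof.
move=> Ox; suff [z nOz] : exists z, ~ Omega z by have [b bb _] := segment_boundary Ox nOz; exists b.
have [M [_ HM]] := bO; pose i0 := Ordinal d0.
exists ((`|M| + 2) *: e_ i0) => Oz.
have M1 : M < `|M| + 1 by rewrite (le_lt_trans (ler_norm _))// ltrDl.
have := HM _ M1 _ Oz; apply/negP; rewrite -ltNge.
have p0 : 0 <= `|M| + 2 by rewrite addr_ge0.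
apply: (@lt_le_trans _ _ (`|M| + 2)); first by rewrite ltrD2l ltr1n.
have := coord_le_norm ((`|M| + 2) *: e_ i0) i0.
by rewrite !mxE !eqxx/= mulr1 (ger0_norm p0).
Qed.

Lemma edist_to_le x b : bd b -> D x <= enorm (x - b).
Proof. by move=> bb; apply: ge_inf; [exists 0 => _ [z _ <-]; exact: enorm_ge0|exists b]. Qed.

Lemma edist_to_lip x y : bd !=set0 -> D x <= D y + enorm (x - y).
Proof.
move=> b0; rewrite -lerBlDr; apply: lb_le_inf; first by have [b bb] := b0; exists (enorm (y - b)), b.
move=> _ [z bz <-]; rewrite lerBlDr; apply: le_trans (edist_to_le x bz) _.
by rewrite [leRHS]addrC enorm_triangle.
Qed.

Lemma edist_to_gt0 x : Omega x -> 0 < D x.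
Proof.
move=> Ox; have b0 := boundary_nonempty Ox.
have /nbhs_ballP[e /= e0 He] : nbhs x Omega by exact: open_nbhs_nbhs.
apply: (lt_le_trans e0); apply: lb_le_inf; first by have [b bb] := b0; exists (enorm (x - b)), b.
move=> _ [b [_ nb] <-]; rewrite leNgt; apply/negP => xb; apply: nb.
rewrite (interior_id Omega).1//; apply: He; rewrite -ball_normE /ball_/=.
apply: le_lt_trans xb; apply/rV_norm_leP; first exact: enorm_ge0.
exact: coord_le_enorm.
Qed.

Lemma edist_to_ball x z : Omega x -> enorm (x - z) < D x -> Omega z.
Proof.
move=> Ox xz; apply: contrapT => nOz; have [b bb xb] := segment_boundary Ox nOz.
by have := edist_to_le x bb; rewrite leNgt (le_lt_trans xb).
Qed.

Lemma edist_to_continuous x : Omega x -> continuous (fun y => D y).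
Proof.
move=> Ox; have b0 := boundary_nonempty Ox => y; apply/(@cvgrPdist_lt _ _ _ (nbhs (y : V))) => e e0.
have : {for y, continuous (fun z : V => enorm ((y : V) - z))}.
  apply: (@continuous_comp _ _ _ (fun z : V => y - z) (@enorm R d)); last exact: enorm_continuous.
  by apply: (@continuousB _ _ _ (cst y : V -> V) id); [exact: cst_continuous|exact: cvg_id].
move=> /(@cvgr_lt _ _ (nbhs (y : V))); rewrite subrr enorm0 => /(_ _ e0); apply: filterS => z /= yz.
apply: le_lt_trans yz; rewrite ler_norml.
have := edist_to_lip y z b0; have := edist_to_lip z y b0; rewrite (enorm_sym z y); lra.
Qed.

Lemma edist_to_bounded : exists2 M : R, 0 <= M & forall x, Omega x -> D x <= M.
Proof.
have [[y Oy]|/nonemptyPn O0] := pselect (Omega !=set0); last by exists 0 => // x; rewrite O0.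
have [b bb] := boundary_nonempty Oy; have [M [_ HM]] := bO.
exists (d%:R * (`|M| + 1) + enorm b); first by rewrite addr_ge0 ?mulr_ge0 ?addr_ge0 ?enorm_ge0.
move=> x Ox; apply: le_trans (edist_to_le x bb) _; apply: le_trans (ler_enormD _ _) _.
rewrite enormN lerD2r; apply: (@enorm_le_sup _ _ _ (`|M| + 1)) => i; apply: le_trans (coord_le_norm x i) _.
by apply: HM Ox; rewrite (le_lt_trans (ler_norm _))// ltrDl.
Qed.

End Domain.

(** * Growth of eigenfunctions at the boundary *)

Section Growth.
Variables (R : realType) (d : nat) (Omega : set 'rV[R]_d) (phi : 'rV[R]_d -> R) (h : R).
Local Notation V := 'rV[R]_d.
Local Notation D x := (edist_to x (boundary Omega)).
Hypotheses (oO : open Omega) (bO : bounded_set Omega) (d0 : (0 < d)%N) (h0 : 0 < h).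
Hypothesis phi_smooth : smooth_on Omega phi.
Hypothesis phi_eigen : forall x, Omega x -> - (h ^+ 2) * laplacian phi x = phi x.
Hypothesis phi_norm : (\int[@leb R d]_(x in Omega) ((phi x) ^+ 2)%:E < +oo)%E.

Lemma eigen_solution : solution Omega (h ^- 2) phi.
Proof.
split=> // x Ox; rewrite -[X in _ = _ * X](phi_eigen Ox) mulrA mulrN mulVf ?mulN1r//.
by rewrite expf_neq0// gt_eqF.
Qed.

Definition density (x : borel V) : \bar R := (((phi \_ Omega) x) ^+ 2)%:E.

Lemma measurable_density : measurable_fun setT density.
Proof.
apply/measurable_EFinP; apply: measurable_funX.
apply: open_continuous_borel => // x Ox.
exact: (smooth_on_continuous (s := [::]) phi_smooth).
Qed.

Lemma density_ge0 x : (0 <= density x)%E.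
Proof. by rewrite lee_fin sqr_ge0. Qed.

Lemma integral_density :
  (\int[@leb R d]_x density x = \int[@leb R d]_(x in Omega) ((phi x) ^+ 2)%:E)%E.
Proof.
rewrite [RHS]integral_mkcond; apply: eq_integral => x _.
by rewrite /density !patchE; case: ifP => //; rewrite expr0n.
Qed.

(** The interior estimate is applied on the cube of half-side rho = D z / (d + 1), which lies in
    [Omega]. The L^2 norm on it costs rho^(-d/2); the larger integer exponent [d] avoids square
    roots, the surplus being bounded by the maximal distance [M]. *)
Lemma growth s : exists2 K : R, 0 <= K &
  forall z, Omega z -> D z ^+ (size s + d) * `|partials s phi z| <= K.
Proof.
have [M M0 HM] := edist_to_bounded oO bO d0.
have Lam0 : 0 <= h ^- 2 * M ^+ 2 by rewrite mulr_ge0 ?invr_ge0 ?sqr_ge0.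
have [C C0 HC] := elliptic s Lam0.
set E := (\int[@leb R d]_x density x)%E.
have E0 : (0 <= E)%E by apply: integral_ge0 => x _; exact: density_ge0.
have Efin : E \is a fin_num by rewrite ge0_fin_numE// /E integral_density.
pose N := (size s + d)%N; pose K := Num.sqrt (C * fine E * M ^+ d).
exists (d.+1%:R ^+ N * K); first by rewrite mulr_ge0 ?exprn_ge0 ?sqrtr_ge0.
move=> z Oz; have Dz := edist_to_gt0 oO bO d0 Oz.
pose rho := D z / d.+1%:R; have r0 : 0 < rho by rewrite divr_gt0.
have rM : rho <= M.
  by apply: le_trans (HM z Oz); rewrite ler_pdivrMr// ler_peMr ?(ltW Dz)// ler1n.
have DE : D z = d.+1%:R * rho by rewrite mulrC divfK.
have cO x : Q1 x -> Omega (z + rho *: x).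
  move=> Qx; apply: (edist_to_ball oO Oz); rewrite opprD addrA subrr sub0r enormN enormZ (gtr0_norm r0).
  rewrite DE mulrC ltr_pM2r//; apply: (@le_lt_trans _ _ (d%:R * 1)); last by rewrite mulr1 ltr_nat.
  by apply: enorm_le_sup => i; have := Qx i; rewrite mxE subr0.
have lr : `|h ^- 2| * rho ^+ 2 <= h ^- 2 * M ^+ 2.
  rewrite ger0_norm ?invr_ge0 ?sqr_ge0// ler_wpM2l ?invr_ge0 ?sqr_ge0//.
  by rewrite lerXn2r ?nnegrE ?(ltW r0).
have := HC _ _ _ z rho eigen_solution r0 cO lr.
have JE : (J (fun t => density (z + rho *: row_of_tuple t)%R) <= (rho ^- d)%:E * E)%E.
  rewrite -(integral_leb_affine z r0 measurable_density density_ge0).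
  apply: ge0_subset_integral => //; first exact: measurable_tcube.
    exact: measurable_row_affine measurable_density.
  by move=> t _; exact: density_ge0.
move=> /le_trans/(_ (lee_wpmul2l _ JE)); rewrite lee_fin => /(_ C0).
rewrite -(fineK Efin) -!EFinM lee_fin => H.
have HK : rho ^+ N * `|partials s phi z| <= K.
  rewrite -(ger0_norm (x := rho ^+ N)) ?exprn_ge0 ?(ltW r0)// -normrM -sqrtr_sqr ler_sqrt; last first.
    by rewrite !mulr_ge0 ?exprn_ge0// fine_ge0.
  rewrite /N exprD mulrAC exprMn.
  apply: (@le_trans _ _ (C * (rho ^- d * fine E) * (rho ^+ d) ^+ 2)); first by rewrite ler_wpM2r ?sqr_ge0.
  have rd0 : rho ^+ d != 0 by rewrite expf_neq0// gt_eqF.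
  rewrite (_ : _ * _ = C * fine E * rho ^+ d); last by field.
  by rewrite ler_wpM2l ?mulr_ge0 ?fine_ge0// lerXn2r ?nnegrE ?(ltW r0).
rewrite -/N DE exprMn -mulrA ler_wpM2l// exprn_ge0//.
Qed.

End Growth.

(** * Smoothness of the localized functions and their dependence on the base point *)

Section Localized.
Variables (R : realType) (d : nat) (chi : R -> R) (Omega : set 'rV[R]_d) (phi : 'rV[R]_d -> R) (h : R).
Local Notation V := 'rV[R]_d.
Local Notation e_ i := (delta_mx ord0 i : V).
Local Notation D x := (edist_to x (boundary Omega)).
Hypothesis chiP : cutoff chi.
Hypotheses (oO : open Omega) (bO : bounded_set Omega) (d0 : (0 < d)%N) (h0 : 0 < h).
Hypothesis phi_smooth : smooth_on Omega phi.
Hypothesis phi_eigen : forall x, Omega x -> - (h ^+ 2) * laplacian phi x = phi x.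
Hypothesis phi_norm : (\int[@leb R d]_(x in Omega) ((phi x) ^+ 2)%:E < +oo)%E.

Local Notation kappa x := (h / D x).

Lemma kappa_gt0 x : Omega x -> 0 < kappa x.
Proof. by move=> Ox; rewrite divr_gt0// edist_to_gt0. Qed.

(* The second factor vanishes wherever [x + h *: y] may leave [Omega], so no case
   distinction is needed at the edge of the cutoff. *)
Definition loc_term a b (x y : V) : R :=
  partials a phi (x + h *: y) * partials b (bump chi) (kappa x *: y).

Lemma loc_term_in x y : Omega x -> kappa x * enorm y < 1 -> Omega (x + h *: y).
Proof.
move=> Ox k1; apply: (edist_to_ball oO Ox); rewrite opprD addrA subrr sub0r enormN enormZ (gtr0_norm h0).
by move: k1; rewrite mulrAC ltr_pdivrMr ?mul1r// edist_to_gt0.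
Qed.

Lemma loc_term0 a b x y : Omega x -> 1 <= kappa x * enorm y -> loc_term a b x y = 0.
Proof.
move=> Ox k1; rewrite /loc_term (bump_partials0 chiP) ?mulr0//.
by rewrite enormZ ger0_norm// ltW// kappa_gt0.
Qed.

(** Relative distance of [y] to the edge of the cutoff, where |y| = D x / h, and 0 beyond it. *)
Definition loc_gap (x y : V) : R := Num.max 0 (1 - kappa x * enorm y).

(* The infinite order of vanishing of the cutoff beats the polynomial blow-up of the
   derivatives of [phi] at the boundary. *)
Lemma loc_term_bound a b : exists2 K : R, 0 <= K & exists N, forall x y, Omega x ->
  `|loc_term a b x y| <= K * (D x ^- N) * loc_gap x y ^+ 2.
Proof.
have [K K0 HK] := growth oO bO d0 h0 phi_smooth phi_eigen phi_norm a.
set N := (size a + d)%N in HK.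
(* [N] orders of flatness compensate the growth of [phi]; the two others leave the quadratic decay
   that makes the derivative at the edge zero. *)
have [K' K'0 HK'] := bump_flat chiP (N + 2) b.
exists (K * K'); first exact: mulr_ge0.
exists N => x y Ox; have Dx := edist_to_gt0 oO bO d0 Ox; rewrite /loc_gap.
have [k1|k1] := ltP (kappa x * enorm y) 1; last first.
  rewrite loc_term0// normr0 mulr_ge0 ?sqr_ge0//.
  by rewrite !mulr_ge0// invr_ge0 exprn_ge0// ltW.
rewrite max_r ?subr_ge0 ?(ltW k1)//; set t := 1 - _.
have t0 : 0 < t by rewrite subr_gt0.
have Oz := loc_term_in Ox k1; have Dz := edist_to_gt0 oO bO d0 Oz.
have tz : t * D x <= D (x + h *: y).
  have := edist_to_lip x (x + h *: y) (boundary_nonempty oO bO d0 Ox).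
  rewrite opprD addrA subrr sub0r enormN enormZ (gtr0_norm h0).
  rewrite /t mulrBl mul1r mulrAC divfK ?gt_eqF//; lra.
have E : enorm (kappa x *: y) = kappa x * enorm y.
  by rewrite enormZ ger0_norm// ltW// kappa_gt0.
rewrite /loc_term normrM.
have HP := HK _ Oz; have HB : `|partials b (bump chi) (kappa x *: y)| <= K' * t ^+ (N + 2).
  by have := HK' (kappa x *: y); rewrite E; exact.
have HP' : (t * D x) ^+ N * `|partials a phi (x + h *: y)| <= K.
  apply: le_trans HP; rewrite ler_wpM2r// lerXn2r ?nnegrE ?mulr_ge0//; exact: ltW.
have DN : 0 < D x ^+ N by rewrite exprn_gt0.
have tN : 0 < t ^+ N by rewrite exprn_gt0.
apply: (le_trans (ler_wpM2l (normr_ge0 _) HB)).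
rewrite -(ler_pM2l DN) exprD.
rewrite (_ : _ * (_ * _) = ((t * D x) ^+ N * `|partials a phi (x + h *: y)|) * (K' * t ^+ 2)); last first.
  by rewrite exprMn; ring.
rewrite (_ : D x ^+ N * _ = K * (K' * t ^+ 2)); last by field; rewrite gt_eqF.
by rewrite ler_wpM2r// mulr_ge0// sqr_ge0.
Qed.

(** Strictly inside the cutoff this is the product rule. At the edge and beyond, the quadratic bound
    gives derivative 0, and both terms of the formula are 0 as well. *)
Lemma loc_term_derive a b i x y : Omega x ->
  is_derive y (e_ i) (loc_term a b x) (h * loc_term (i :: a) b x y + kappa x * loc_term a (i :: b) x y).
Proof.
move=> Ox; have [k1|k1] := ltP (kappa x * enorm y) 1.
  have dp := is_derive_affine (smooth_on_derive i a phi_smooth (loc_term_in Ox k1)).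
  have db : is_derive y (e_ i) (fun y => partials b (bump chi) (kappa x *: y))
      (kappa x * partials (i :: b) (bump chi) (kappa x *: y)).
    have := @is_derive_affine _ _ (partials b (bump chi)) 0 (kappa x) y (e_ i)
      (partials (i :: b) (bump chi) (0 + kappa x *: y)).
    rewrite add0r; under [X in is_derive y (e_ i) X]eq_fun do rewrite add0r.
    by apply; exact: (smooth_on_derive (x := kappa x *: y) i b (@bump_smooth R d chi chiP) Logic.I).
  have H := is_deriveM dp db; apply: (is_derive_eq H).
  rewrite /loc_term; move: (partials a phi _) (partials (i :: a) phi _) (partials b _ _) (partials (i :: b) _ _).
  by move: (kappa x) => k p p' q q'; rewrite /GRing.scale/=; ring.
rewrite [X in _ * X + _]loc_term0// [X in _ + _ * X]loc_term0// !mulr0 addr0.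
have [K K0 [N HK]] := loc_term_bound a b.
have kx := kappa_gt0 Ox; have Dx := edist_to_gt0 oO bO d0 Ox.
apply: (@is_derive_quadratic _ _ _ _ _ _ (K * D x ^- N * kappa x ^+ 2) 1 ltr01) => u _.
rewrite mulr0 subr0 [X in _ - X]loc_term0// subr0; apply: (le_trans (HK _ _ Ox)).
rewrite -[leRHS]mulrA ler_wpM2l//; first by rewrite mulr_ge0// invr_ge0 exprn_ge0// ltW.
rewrite -exprMn -[leRHS]real_normK ?num_real// lerXn2r ?nnegrE ?le_max ?lexx//.
rewrite /loc_gap ge_max normr_ge0/= normrM (gtr0_norm kx).
have : enorm y <= enorm (u *: e_ i + y) + `|u|.
  rewrite -{1}[y](addKr (u *: e_ i)) addrC; apply: (le_trans (ler_enormD _ _)).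
  rewrite lerD2l enormN; apply: le_trans (enorm_le_l1 _) _.
  rewrite (bigD1 i)//= big1 ?addr0; first by rewrite !mxE !eqxx mulr1.
  by move=> j ji; rewrite !mxE (negbTE ji) andbF mulr0 normr0.
move=> /(ler_wpM2l (ltW kx)); rewrite mulrDr; move: k1; lra.
Qed.

(** Coefficients in [x] are only asked to be continuous: the distance to the boundary enters through
    [kappa], and all derivatives are taken in [y]. *)
Inductive loc_class : (V -> V -> R) -> Prop :=
| loc_class_term a b : loc_class (loc_term a b)
| loc_class_add f g : loc_class f -> loc_class g -> loc_class (fun x y => f x y + g x y)
| loc_class_scale (c : V -> R) f : (forall x, Omega x -> {for x, continuous c}) -> loc_class f ->
    loc_class (fun x y => c x * f x y).

Lemma kappa_continuous x : Omega x -> {for x, continuous (fun x => kappa x)}.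
Proof.
move=> Ox; have D0 : D x != 0 by rewrite gt_eqF// edist_to_gt0.
apply: (@continuousM _ _ (cst h) (fun x => (D x)^-1)); first exact: cst_continuous.
have H : {for x, continuous (fun x => D x)} by exact: (edist_to_continuous oO bO d0 Ox).
exact: (cvgV D0 H).
Qed.

Lemma loc_class_derive g i : loc_class g -> exists g', loc_class g' /\
  forall x y, Omega x -> [set: V] y -> is_derive y (e_ i) (g x) (g' x y).
Proof.
elim=> {g} [a b|f g _ [f' [lf df]] _ [g' [lg dg]]|c f cc lf [f' [lf' df]]].
- exists (fun x y => h * loc_term (i :: a) b x y + kappa x * loc_term a (i :: b) x y); split.
    apply: loc_class_add.
      by apply: (@loc_class_scale (fun=> h)); [move=> x _; exact: cst_continuous|exact: loc_class_term].
    by apply: (@loc_class_scale (fun x => kappa x)); [exact: kappa_continuous|exact: loc_class_term].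
  by move=> x y Ox _; exact: loc_term_derive.
- exists (fun x y => f' x y + g' x y); split; first exact: loc_class_add.
  by move=> x y Ox _; have := df x y Ox Logic.I; have := dg x y Ox Logic.I => ? ?; exact: is_deriveD.
- exists (fun x y => c x * f' x y); split; first exact: loc_class_scale.
  move=> x y Ox _; have H := df x y Ox Logic.I.
  have dc : is_derive y (e_ i) (fun=> c x) 0 by exact: is_derive_cst.
  by apply: (is_derive_eq (is_deriveM dc H)); rewrite scaler0 addr0.
Qed.

Lemma loc_class_continuous g : loc_class g ->
  forall x y, Omega x -> {for (x, y), continuous (fun p => g p.1 p.2)}.
Proof.
elim=> {g} [a b|f g _ cf _ cg|c f cc _ cf] x y Ox; last 2 first.
- by have := cf x y Ox; have := cg x y Ox => c1 c2; exact: (cvgD c2 c1).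
- have c1 : {for (x, y), continuous (fun p : V * V => c p.1)}.
    apply: (@continuous_comp _ _ _ (fun p : V * V => p.1) c); first exact: cvg_fst.
    exact: cc.
  exact: (cvgM c1 (cf x y Ox)).
have cfst : {for (x, y), continuous (fun p : V * V => p.1)} by exact: cvg_fst.
have csnd : {for (x, y), continuous (fun p : V * V => p.2)} by exact: cvg_snd.
have ck : {for (x, y), continuous (fun p : V * V => kappa p.1)}.
  by apply: (@continuous_comp _ _ _ (fun p : V * V => p.1) (fun x => kappa x)) => //; exact: kappa_continuous.
have [k1|k1] := ltP (kappa x * enorm y) 1.
  have c1 : {for (x, y), continuous (fun p : V * V => partials a phi (p.1 + h *: p.2))}.
    apply: (@continuous_comp _ _ _ (fun p : V * V => p.1 + h *: p.2) (partials a phi)).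
      by apply: (cvgD cfst); exact: (cvgZr csnd).
    exact: (smooth_on_continuous (s := a) phi_smooth (loc_term_in Ox k1)).
  have c2 : {for (x, y), continuous (fun p : V * V => partials b (bump chi) (kappa p.1 *: p.2))}.
    apply: (@continuous_comp _ _ _ (fun p : V * V => kappa p.1 *: p.2) (partials b (bump chi))).
      exact: (cvgZ ck csnd).
    exact: (smooth_on_continuous (s := b) (@bump_smooth R d chi chiP) Logic.I).
  exact: (cvgM c1 c2).
(* At the edge or beyond, the term is dominated by [B], which is continuous and vanishes at (x,
   y). *)
have [K K0 [N HK]] := loc_term_bound a b.
pose B (p : V * V) := K * (D p.1 ^- N) * loc_gap p.1 p.2 ^+ 2.
have cB : {for (x, y), continuous B}.
  have D0 : D x != 0 by rewrite gt_eqF// edist_to_gt0.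
  have cD : {for (x, y), continuous (fun p : V * V => D p.1)}.
    apply: (@continuous_comp _ _ _ (fun p : V * V => p.1) (fun x => D x)) => //.
    by exact: (edist_to_continuous oO bO d0 Ox).
  have cDN : {for (x, y), continuous (fun p : V * V => D p.1 ^- N)}.
    apply: cvgV; first by rewrite expf_neq0.
    apply: (@continuous_comp _ _ _ (fun p : V * V => D p.1) (fun u : R => u ^+ N)) => //.
    exact: exprn_continuous.
  have cg : {for (x, y), continuous (fun p : V * V => loc_gap p.1 p.2)}.
    have cen : {for (x, y), continuous (fun p : V * V => enorm p.2)}.
      apply: (@continuous_comp _ _ _ (fun p : V * V => p.2) (@enorm R d)) => //.
      exact: enorm_continuous.
    apply: (@continuous_max _ _ (cst 0) (fun p : V * V => 1 - kappa p.1 * enorm p.2)).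
      exact: cst_continuous.
    have c1 : {for (x, y), continuous (fun _ : V * V => 1 : R)} by exact: cst_continuous.
    exact: (cvgB c1 (cvgM ck cen)).
  apply: (@continuousM _ _ (fun p : V * V => K * D p.1 ^- N) (fun p : V * V => loc_gap p.1 p.2 ^+ 2)).
    by apply: (@continuousM _ _ (cst K) (fun p : V * V => D p.1 ^- N)) => //; exact: cst_continuous.
  apply: (@continuous_comp _ _ _ (fun p : V * V => loc_gap p.1 p.2) (fun u : R => u ^+ 2)) => //.
  exact: exprn_continuous.
have B0 : B (x, y) = 0.
  rewrite /B /loc_gap/= max_l ?subr_le0// expr0n mulr0//.
apply/(@cvgrPdist_lt _ _ _ (nbhs (x, y))) => e e0; rewrite /= loc_term0//.
have /(@cvgr_lt _ _ (nbhs (x, y))) := cB; rewrite B0 => /(_ _ e0) HB.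
have nO : \forall p \near (x, y), Omega p.1.
  by apply: (cfst Omega); exact: open_nbhs_nbhs.
apply: filterS2 HB nO => p Bp Op; rewrite sub0r normrN.
exact: le_lt_trans (HK _ _ Op) Bp.
Qed.

Lemma localizedE x : Omega x -> localized chi Omega phi h x = loc_term [::] [::] x.
Proof.
move=> Ox; apply/funext => y; rewrite /localized /loc_term/= /bump enormZ.
by rewrite ger0_norm ?ltW ?kappa_gt0// mulrAC.
Qed.

Lemma localized_family : exists F : seq 'I_d -> V -> V -> R,
  (forall s x y, Omega x -> {for (x, y), continuous (fun p => F s p.1 p.2)}) /\
  forall x, Omega x -> smooth_on setT (localized chi Omega phi h x) /\
    forall s y, partials s (localized chi Omega phi h x) y = F s x y.
Proof.
have cP g : loc_class g -> forall x y, Omega x -> setT y -> {for y, continuous (g x)}.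
  move=> lg x y Ox _.
  apply: (@continuous_comp _ _ _ (fun y => (x, y)) (fun p : V * V => g p.1 p.2)).
    move=> A [[P Q] /= [nP nQ] PQ]; apply: filterS nQ => z Qz; apply: PQ; split=> //=.
    exact: nbhs_singleton.
  exact: loc_class_continuous.
have [F [lF HF]] := smooth_class openT cP (fun g i => @loc_class_derive g i) (loc_class_term [::] [::]).
exists F; split=> [s x y Ox|x Ox]; first exact: loc_class_continuous.
by rewrite localizedE//; have [? H] := HF x Ox; split=> // s y; exact: H.
Qed.

Lemma localized_smooth x : Omega x -> smooth_on setT (localized chi Omega phi h x).
Proof. by move=> Ox; have [F [_ H]] := localized_family; exact: (H x Ox).1. Qed.

(** Compactness of cubes turns joint continuity in (x, y) into uniformity in [y]. This is the source
    of the measurability on which the local measures rest. *)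
Lemma localized_continuous k x : Omega x ->
  {for x, continuous (fun x => to_Cspace k (localized chi Omega phi h x))}.
Proof.
move=> Ox; have [F [cF HF]] := localized_family.
apply: (@cvg_Cspace _ _ _ _ (nbhs (x : V))) => s r e e0.
have vE z y : Omega z -> partials s (to_Cspace k (localized chi Omega phi h z)) y = F s z y.
  move=> Oz; have [sz Ez] := HF z Oz.
  by rewrite /to_Cspace val_insubd asboolT; [exact: Ez|exact: sz].
have /compact_near_coveringP Hc := @cube_compact R d r%:R.
have nO : nbhs x Omega by exact: open_nbhs_nbhs.
have H : \forall z \near x, forall y, cube 0 r%:R y -> `|F s z y - F s x y| < e.
  apply: (Hc V (nbhs x) (fun z y => `|F s z y - F s x y| < e)) => y cy.
  have e2 : 0 < e / 2 by rewrite divr_gt0.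
  have /(@cvgrPdist_lt _ _ _ (nbhs (x, y)))/(_ _ e2) := cF s x y Ox.
  move=> [[A B] /= [nA nB] AB].
  exists (B, A) => //= -[y' z] /= [By Az].
  have := AB (z, y') (conj Az By); have := AB (x, y') (conj (nbhs_singleton nA) By).
  rewrite /= !ltr_norml => /andP[? ?] /andP[? ?]; apply/andP; split; lra.
apply: filterS2 nO H => z Oz Hz y cy.
have := Hz y cy.
by rewrite -(vE z y Oz) -(vE x y Ox).
Qed.

Lemma measurable_localized k (U : set (borel V)) : measurable U -> U `<=` Omega ->
  measurable_fun U (fun x => to_Cspace k (localized chi Omega phi h x) : borel (Cspace R d k)).
Proof.
move=> mU UO; apply: measurability => //= _ [A oA <-].
set f := fun x => _.
rewrite (_ : U `&` f @^-1` A = U `&` (Omega `&` f @^-1` A)); last first.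
  by rewrite setIA (setIidl UO).
apply: measurableI => //; apply: sub_sigma_algebra.
rewrite openE => x [Ox Ax]; apply: filterI; first exact: open_nbhs_nbhs.
by apply: (localized_continuous (k := k) Ox); exact: open_nbhs_nbhs.
Qed.

End Localized.

(** * Local energies *)

Section LocalEnergy.
Variables (R : realType) (d : nat).
Local Notation V := 'rV[R]_d.
Local Notation T := (d.-tuple (measurableTypeR R)).

Lemma measurable_tuple_of_row : measurable_fun setT (@tuple_of_row R d : borel V -> T).
Proof.
apply/measurable_fun_tnthP => i.
rewrite (_ : _ \o _ = (fun x : V => x ord0 i) \_ setT).
  by apply: open_continuous_borel => [|x _]; [exact: openT|exact: coord_continuous].
by apply/funext => x; rewrite patchT ?inE//= tnth_mktuple.
Qed.

Lemma measurable_cube (r : R) : measurable (cube 0 r : set (borel V)).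
Proof.
rewrite -[cube 0 r]setCK; apply: measurableC; apply: sub_sigma_algebra.
apply: closed_openC; apply: (@compact_closed V); [exact: norm_hausdorff|exact: cube_compact].
Qed.

Lemma leb_cube (r : R) : (leb (cube (0 : V) r) < +oo)%E.
Proof.
apply: leb_bounded; first exact: measurable_cube.
exists `|r|; split; first exact: num_real.
move=> M rM y cy; apply: ltW; apply: le_lt_trans rM; apply/rV_norm_leP => // i.
by apply: le_trans (ler_norm _); have := cy i; rewrite mxE subr0.
Qed.

Variables (g : borel V -> \bar R) (h : R).
Hypotheses (mg : measurable_fun setT g) (g0 : forall x, (0 <= g x)%E).

(** For h > 0, the integral of [g] over the cube of half-side h r centred at [x], divided by h^d. *)
Definition local_energy (r : R) (x : borel V) : \bar R :=
  (\int[tuple_leb R d]_t (g (x + h *: row_of_tuple t)%R * (\1_(cube 0 r) (row_of_tuple t))%:E))%E.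

Let F r (p : T * T) : \bar R :=
  (g (row_of_tuple p.1 + h *: row_of_tuple p.2)%R * (\1_(cube 0 r) (row_of_tuple p.2))%:E)%E.

Let mF r : measurable_fun setT (F r).
Proof.
apply: emeasurable_funM.
  pose a (p : T * T) : T := [tuple (tnth p.1 i + h * tnth p.2 i)%R | i < d].
  have ma : measurable_fun setT a.
    apply/measurable_fun_tnthP => i.
    rewrite (_ : _ \o _ = fun p : T * T => (tnth p.1 i + h * tnth p.2 i)%R); last first.
      by apply/funext => p /=; rewrite tnth_mktuple.
    apply: measurable_funD.
      exact: (measurableT_comp (measurable_tnth i) measurable_fst).
    apply: measurable_funM; first exact: measurable_cst.
    exact: (measurableT_comp (measurable_tnth i) measurable_snd).
  rewrite (_ : (fun _ => _) = (g \o @row_of_tuple R d) \o a).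
    exact: (measurableT_comp (measurable_row mg) ma).
  apply/funext => p /=; congr g; apply/rowP => i.
  by rewrite !mxE tnth_mktuple.
apply/measurable_EFinP.
have m1 : measurable_fun setT (\1_(cube 0 r) : borel V -> R).
  by apply: measurable_indic; exact: measurable_cube.
exact: (measurableT_comp (measurableT_comp m1 (@measurable_row_of_tuple R d)) measurable_snd).
Qed.

Let F0 r p : (0 <= F r p)%E.
Proof. by rewrite mule_ge0// lee_fin indicE. Qed.

Lemma measurable_local_energy r : measurable_fun setT (local_energy r).
Proof.
rewrite (_ : local_energy r = fubini_F (tuple_leb R d) (F r) \o @tuple_of_row R d).
  apply: (measurableT_comp _ measurable_tuple_of_row).
  exact: measurable_fun_fubini_tonelli_F.
apply/funext => x; rewrite /local_energy /fubini_F/=; apply: eq_integral => t _.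
by rewrite /F/= tuple_of_rowK.
Qed.

Lemma local_energy_ge0 r x : (0 <= local_energy r x)%E.
Proof. by apply: integral_ge0 => t _; rewrite mule_ge0// lee_fin indicE. Qed.

(** By Tonelli the integral over [x] comes first, and translation invariance removes the shift h t.
    The result does not involve [h], whence bounds uniform in n. *)
Lemma integral_local_energy r :
  (\int[@leb R d]_x local_energy r x = (\int[@leb R d]_x g x) * leb (cube (0 : V) r))%E.
Proof.
rewrite integral_leb; [|exact: measurable_local_energy|exact: local_energy_ge0].
have -> : (\int[tuple_leb R d]_s local_energy r (row_of_tuple s) =
           \int[tuple_leb R d]_s \int[tuple_leb R d]_t F r (s, t))%E by [].
rewrite (fubini_tonelli (F r) (mF r) (F0 r)).
have E (t : T) : (\int[tuple_leb R d]_s F r (s, t) =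
    (\int[@leb R d]_x g x) * (\1_(cube 0 r) (row_of_tuple t))%:E)%E.
  rewrite /F/= ge0_integralZr//; last first.
  - have := measurable_row_affine (h *: row_of_tuple t) 1 mg.
    by under eq_fun do rewrite scale1r addrC.
  - rewrite -[in RHS](mul1e (\int[_]_x _)%E); congr (_ * _)%E.
    have := integral_leb_affine (h *: row_of_tuple t) ltr01 mg g0.
    rewrite expr1n invr1 => <-.
    by apply: eq_integral => s _; rewrite scale1r addrC.
under eq_integral do rewrite E.
have m1 : measurable_fun setT (fun x : borel V => ((\1_(cube 0 r) x : R)%:E)).
  by apply/measurable_EFinP/measurable_indic; exact: measurable_cube.
rewrite ge0_integralZl//; last 2 first.
- exact: (measurable_row m1).
- by apply: integral_ge0 => x _; exact: g0.
rewrite -(@integral_leb R d (fun x => (\1_(cube 0 r) x)%:E) m1)//.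
by rewrite (@integral_indic _ _ _ (@leb R d) setT measurableT _ (measurable_cube r)) setIT.
Qed.

Lemma local_energy_markov r (M : R) : 0 < M ->
  (M%:E * leb [set x | M%:E <= local_energy r x] <= (\int[@leb R d]_x g x) * leb (cube (0 : V) r))%E.
Proof.
move=> M0; rewrite -integral_local_energy.
have := @le_integral_abse _ _ _ (@leb R d) setT measurableT _ M (measurable_local_energy r) M0.
rewrite setTI; under eq_set do rewrite gee0_abs ?local_energy_ge0//.
by under eq_integral do rewrite gee0_abs ?local_energy_ge0//.
Qed.

End LocalEnergy.

Lemma solution_subset (R : realType) d (A B : set 'rV[R]_d) (lam : R) (f g : 'rV[R]_d -> R) :
  solution A lam f -> open B -> B `<=` A -> (forall y, B y -> f y = g y) -> solution B lam g.
Proof.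
move=> [oA sf lapf] oB BA fg.
have sB : smooth_on B f by apply/smooth_onP => s x /BA Ax; exact: (smooth_onP _ _).1 sf s x Ax.
split=> // [|x Bx]; first exact: eq_smooth_on sB.
rewrite -(fg _ Bx) -(lapf _ (BA _ Bx)); congr (- _).
apply: eq_bigr => i _; apply: esym.
exact: (@eq_partials _ _ B f g [:: i; i] x oB fg Bx).
Qed.

(** * Uniform bounds for the localized functions *)

Section Tame.
Variables (R : realType) (d : nat) (chi : R -> R) (Omega : set 'rV[R]_d).
Local Notation V := 'rV[R]_d.
Local Notation D x := (edist_to x (boundary Omega)).
Hypothesis chiP : cutoff chi.
Hypotheses (oO : open Omega) (bO : bounded_set Omega) (d0 : (0 < d)%N).

(** For [h] this small, the ball of radius d (r + 1) + 1 lies where the cutoff is 1, so the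
    localized function is the rescaled eigenfunction, with eigenvalue 1. The unit cube about any
    point of the cube [r] lies in the cube r + 1: [K] depends on [s] alone. *)
Lemma localized_tame : exists2 e : R, 0 < e & exists K : seq 'I_d -> R,
  forall (phi : V -> R) (h eta M : R) x r, 0 < h -> smooth_on Omega phi ->
    (forall x, Omega x -> - (h ^+ 2) * laplacian phi x = phi x) ->
    Omega x -> 0 < eta -> eta < D x -> h * (d%:R * r.+1%:R + 1) < eta * e ->
    (local_energy (density Omega phi) h r.+1%:R x <= M%:E)%E ->
    exists W : set V, [/\ solution W 1 (localized chi Omega phi h x), cube 0 r%:R `<=` W &
      forall s y, cube 0 r%:R y -> `|partials s (localized chi Omega phi h x) y| <= Num.sqrt (K s * M)].
Proof.
have [_ [e e0 He] _ _ _] := chiP.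
(* The bound by 1 keeps x + h y in [Omega]; the bound by [e] makes the cutoff equal to 1. *)
have e1 : 0 < Num.min 1 e by rewrite lt_min ltr01.
exists (Num.min 1 e) => //.
have Kex s := elliptic (d := d) s (ler01 : 0 <= 1 :> R).
pose K s := s2val (cid2 (Kex s)); exists K => phi h eta M x r h0 sphi eigen Ox eta0 etaD hr HM.
have Dx : 0 < D x := lt_trans eta0 etaD.
pose rho := d%:R * r.+1%:R + 1 : R; rewrite -/rho in hr.
pose W := @eball R d rho.
have oW : open W by exact: open_eball.
have small y : W y -> h * enorm y / D x < Num.min 1 e.
  move=> Wy; rewrite ltr_pdivrMr//; apply: (@lt_trans _ _ (h * rho)); first by rewrite ltr_pM2l.
  by apply: (lt_trans hr); rewrite mulrC ltr_pM2l.
have WO y : W y -> Omega (x + h *: y).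
  move=> Wy; apply: (loc_term_in oO bO d0 h0 Ox); rewrite mulrAC.
  by have := small _ Wy; rewrite lt_min => /andP[].
have fE y : W y -> phi (x + h *: y) = localized chi Omega phi h x y.
  move=> Wy; rewrite /localized He ?mulr1//; have := small _ Wy; rewrite lt_min => /andP[_ ->].
  by rewrite divr_ge0 ?mulr_ge0 ?enorm_ge0 ?(ltW h0) ?(ltW Dx).
have sol := solution_affine x h (eigen_solution oO h0 sphi eigen).
have hh : h ^+ 2 * h ^- 2 = 1 by rewrite divff// expf_neq0// gt_eqF.
rewrite hh in sol.
have cW y : cube 0 r.+1%:R y -> W y.
  move=> cy; apply: (@le_lt_trans _ _ (d%:R * r.+1%:R)); last by rewrite /rho ltrDl.
  by apply: enorm_le_sup => i; have := cy i; rewrite mxE subr0.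
have cr (y : V) : cube 0 r%:R y -> cube 0 r.+1%:R y by apply: sub_cube; rewrite ler_nat.
exists W; split=> [||s y cy].
- exact: (solution_subset sol).
- by move=> y /cr/cW.
have Q y' : Q1 y' -> cube 0 r.+1%:R (y + 1 *: y').
  move=> Qy i; rewrite !mxE subr0 mul1r -natr1; apply: le_trans (ler_normD _ _) _.
  by apply: lerD; [have := cy i|have := Qy i]; rewrite mxE subr0.
rewrite -(@eq_partials _ _ W _ _ s y oW fE (cW _ (cr _ cy))).
have M0 : 0 <= M by rewrite -lee_fin; apply: le_trans HM; apply: local_energy_ge0 => z; exact: density_ge0.
have K0 : 0 <= K s := s2valP (cid2 (Kex s)).
have HKs := s2valP' (cid2 (Kex s)); rewrite -/(K s) in HKs.
have lr : `|1 : R| * 1 ^+ 2 <= 1 by rewrite normr1 expr1n mulr1.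
have := HKs _ _ _ y 1 sol ltr01 (fun y' Qy => WO _ (cW _ (Q _ Qy))) lr.
rewrite expr1n mul1r => H.
rewrite -sqrtr_sqr ler_sqrt ?mulr_ge0// -lee_fin; apply: (le_trans H).
rewrite EFinM lee_wpmul2l ?lee_fin//; apply: le_trans HM.
have mg := measurable_density oO sphi.
have g0 := density_ge0 Omega phi.
pose G (z : borel V) : \bar R := (density Omega phi (x + h *: z)%R * (\1_(cube 0 r.+1%:R) z)%:E)%E.
have mgz : measurable_fun setT (fun z : borel V => density Omega phi (x + h *: z)).
  rewrite (_ : (fun _ => _) = (fun t => density Omega phi (x + h *: row_of_tuple t)) \o @tuple_of_row R d).
    exact: (measurableT_comp (measurable_row_affine x h mg) (@measurable_tuple_of_row R d)).
  by apply/funext => z /=; rewrite tuple_of_rowK.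
have mG : measurable_fun setT G.
  by apply: emeasurable_funM => //; apply/measurable_EFinP/measurable_indic; exact: measurable_cube.
have G0 z : (0 <= G z)%E by rewrite mule_ge0// lee_fin indicE.
have -> : local_energy (density Omega phi) h r.+1%:R x = (\int[tuple_leb R d]_t G (row_of_tuple t))%E by [].
rewrite -integral_leb//.
have := integral_leb_affine y ltr01 mG G0; rewrite expr1n invr1 mul1e => <-.
rewrite /J [leLHS]integral_mkcond; apply: ge0_le_integral => //.
- by move=> t _; rewrite patchE; case: ifP => // _; rewrite lee_fin sqr_ge0.
- apply/(measurable_restrictT _ (@measurable_tcube R d)); apply: measurable_funTS.
  exact: (measurable_row_affine y 1 mgz).
- exact: measurable_row_affine.
move=> t _; rewrite patchE; case: ifP => [|_]; last exact: G0.
rewrite inE => tt; rewrite /G indicE mem_set ?mule1//.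
by apply: Q; exact/Q1_row.
Qed.

End Tame.

Section Good.
Variables (R : realType) (d : nat) (chi : R -> R) (Omega : set 'rV[R]_d).
Local Notation V := 'rV[R]_d.
Local Notation D x := (edist_to x (boundary Omega)).
Hypothesis chiP : cutoff chi.
Hypotheses (oO : open Omega) (bO : bounded_set Omega) (d0 : (0 < d)%N).
Variables (phi : nat -> V -> R) (h : nat -> R).
Hypothesis phi_smooth : forall n, smooth_on Omega (phi n).
Hypothesis h_gt0 : forall n, 0 < h n.
Hypothesis h_cvg0 : h @ \oo --> 0.
Hypothesis phi_eigen : forall n x, Omega x -> - (h n ^+ 2) * laplacian (phi n) x = phi n x.
Hypothesis phi_norm : forall n,
  (\int[@leb R d]_(x in Omega) ((phi n x) ^+ 2)%:E = leb Omega)%E.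

Let mO : measurable (Omega : set (borel V)).
Proof. exact: sub_sigma_algebra. Qed.

Definition collar (eta : R) : set (borel V) := [set x | Omega x /\ D x <= eta].

(** The collars decrease to the empty set because the distance is positive on [Omega]; the measure
    of [Omega] is finite, so continuity from above applies. *)
Lemma leb_collar (e : R) : 0 < e -> exists2 eta : R, 0 < eta &
  measurable (collar eta) /\ (leb (collar eta) <= e%:E)%E.
Proof.
move=> e0; have [[x0 Ox0]|/nonemptyPn O0] := pselect (Omega !=set0); last first.
  exists 1 => //; rewrite (_ : collar 1 = set0) ?measure0 ?lee_fin ?(ltW e0)//.
  by apply/seteqP; split => // x []; rewrite O0.
pose F m := collar m.+1%:R^-1.
have mF m : measurable (F m).
  rewrite (_ : F m = Omega `&` ~` [set x | m.+1%:R^-1 < D x]).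
    apply: measurableI => //; apply: measurableC; apply: sub_sigma_algebra.
    change (open ((fun x : V => D x) @^-1` [set u | m.+1%:R^-1 < u])).
    apply: open_comp; last exact: open_gt.
    by move=> x _; exact: (edist_to_continuous oO bO d0 Ox0).
  apply/seteqP; split => x /= [Ox].
    by move=> Dx; split=> //; apply/negP; rewrite -leNgt.
  by move=> /negP; rewrite -leNgt.
have F0 : \bigcap_n F n = set0.
  apply/seteqP; split => // x HF; have [Ox _] := HF 0%N Logic.I.
  have Dx := edist_to_gt0 oO bO d0 Ox.
  have [_] := HF (Num.truncn (D x)^-1) Logic.I.
  by rewrite leNgt invf_plt ?posrE// truncnS_gt.
have oe : open [set y : \bar R | (y < e%:E)%E] by exact: open_ereal_lt_ereal.
have ne : nbhs (leb (\bigcap_n F n)) [set y : \bar R | (y < e%:E)%E].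
  by apply: open_nbhs_nbhs; split=> //=; rewrite F0 measure0 lte_fin.
have [| | |N _ HN] := @nonincreasing_cvg_mu _ _ _ (@leb R d) F _ mF _ _ _ ne.
- apply: le_lt_trans (leb_bounded mO bO); apply: le_measure; rewrite ?inE//.
  by move=> x [].
- by rewrite F0.
- move=> n m nm; apply/subsetPset => x [Ox Dx]; split=> //; apply: le_trans Dx _.
  by rewrite lef_pV2 ?posrE// ler_nat.
exists N.+1%:R^-1; first by rewrite invr_gt0.
by split; [exact: mF|apply: ltW; exact: (HN N (leqnn N))].
Qed.

(* By Chebyshev, outside a set of measure at most [e] the rescaled functions have local
   energies, hence derivatives, bounded uniformly in [n]. *)
Lemma good_sets (e : R) : 0 < e ->
  exists C (B : nat -> set (borel V)), [/\ forall n, measurable (B n),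
    forall n, (leb (B n) <= e%:E)%E &
    forall r, exists N, forall n x, (N <= n)%N -> Omega x -> ~ B n x ->
      tame C r (localized chi Omega (phi n) (h n) x)].
Proof.
move=> e0; have e20 : 0 < e / 2 by rewrite divr_gt0.
have [eta eta0 [mE lE]] := leb_collar e20.
have [k k0 [K HK]] := localized_tame chiP oO bO d0.
have OL : leb Omega \is a fin_num by rewrite ge0_fin_numE// leb_bounded.
pose L r := fine (leb Omega) * fine (leb (cube (0 : V) r.+1%:R)).
have L0 r : 0 <= L r by rewrite mulr_ge0// fine_ge0.
(* Chebyshev bounds the bad set at radius [r] by L r / M r, at most (e / 2) / 2^(r + 1). All radii
   together cost e / 2, and the collar the other half. *)
pose M r := (L r + 1) * (2 ^ r.+1)%:R / (e / 2).
have M0 r : 0 < M r by rewrite !divr_gt0// mulr_gt0// ltr_wpDl.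
pose bad n r : set (borel V) :=
  [set x | ((M r)%:E <= local_energy (density Omega (phi n)) (h n) r.+1%:R x)%E].
have mbad n r : measurable (bad n r).
  have := measurable_local_energy (h n) (measurable_density oO (phi_smooth n))
    (density_ge0 Omega (phi n)) r.+1%:R.
  by move=> /(emeasurable_fun_c_infty measurableT)/(_ (M r)%:E); rewrite setTI.
have lbad n r : (leb (bad n r) <= (e / 2 / (2 ^ r.+1)%:R)%:E)%E.
  have := local_energy_markov (h n) (measurable_density oO (phi_smooth n))
    (density_ge0 Omega (phi n)) r.+1%:R (M0 r).
  rewrite integral_density phi_norm -(fineK OL).
  have /fineK <- : leb (cube (0 : V) r.+1%:R) \is a fin_num by rewrite ge0_fin_numE// leb_cube.
  rewrite -EFinM -/(L r) => H.
  rewrite -(@lee_pmul2l _ (M r)%:E) ?lte_fin//; apply: (le_trans H).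
  rewrite -EFinM lee_fin.
  have p2 : (2 ^ r.+1)%:R != 0 :> R by rewrite pnatr_eq0 expn_eq0.
  rewrite (_ : M r * _ = L r + 1); first by rewrite lerDl.
  by rewrite /M; field; rewrite p2 gt_eqF.
exists (fun s r => Num.sqrt (K s * M r)), (fun n => collar eta `|` \bigcup_r bad n r).
have mU n : measurable (\bigcup_r bad n r) by exact: bigcup_measurable.
split=> [n|n|r].
- exact: measurableU.
- apply: (le_trans (@measureU2 _ _ _ (@leb R d) _ _ mE (mU n))).
  rewrite (splitr e) EFinD; apply: leeD => //.
  apply: (le_trans (measure_sigma_subadditive (@leb R d) (mbad n) (mU n) (@subset_refl _ _))).
  apply: (@le_trans _ _ (\sum_(0 <= r <oo) (0%R + (e / 2 / (2 ^ r.+1)%:R)%:E))%E).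
    by apply: lee_nneseries => [r _ _|r _]; [exact: measure_ge0|rewrite add0r; exact: lbad].
  by apply: (le_trans (epsilon_trick xpredT _ (ltW e20))) => //; rewrite eseries0 ?add0e.
have c0 : 0 < d%:R * r.+1%:R + 1 :> R by rewrite ltr_wpDl ?mulr_ge0.
have /cvgrPdist_lt/(_ (eta * k / (d%:R * r.+1%:R + 1))) := h_cvg0.
rewrite divr_gt0 ?mulr_gt0// => /(_ isT)[N _ HN].
exists N => n x Nn Ox; rewrite /= not_orE => -[/not_andP[//|/negP]]; rewrite -ltNge => etaD nb.
have hn := HN n Nn; rewrite /= sub0r normrN gtr0_norm// ltr_pdivlMr// in hn.
apply: (HK _ _ eta (M r) _ r (h_gt0 n) (phi_smooth n) (@phi_eigen n) Ox eta0 etaD hn).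
apply: ltW; rewrite ltNge; apply/negP => Hb; apply: nb; exists r => //.
Qed.

End Good.

(** * The local measures and their accumulation points *)

Section IntegralTransfer.
Local Open Scope ereal_scope.
Import HBNNSimple.

(* [m1] and [m2] are bare set functions because [LM] is a measure on the Borel sets only. *)
Lemma eq_set_integral dT (T : measurableType dT) (R : realType) (m1 m2 : set T -> \bar R) (f : T -> \bar R) :
  (forall A, measurable A -> m1 A = m2 A) -> \int[m1]_x f x = \int[m2]_x f x.
Proof.
move=> m12; rewrite /integral.
have E (g : T -> \bar R) :
    ereal_sup [set sintegral m1 h | h in [set h : {nnsfun T >-> R} | forall x, (h x)%:E <= g x]] =
    ereal_sup [set sintegral m2 h | h in [set h : {nnsfun T >-> R} | forall x, (h x)%:E <= g x]].
  congr ereal_sup; apply: eq_imagel => h _; rewrite /sintegral.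
  by apply: eq_fsbigr => x _; rewrite m12.
by rewrite !E.
Qed.

Lemma integral_mrestr dT (T : measurableType dT) (R : realType) (m : {measure set T -> \bar R})
    (U : set T) (mU : measurable U) (f : T -> \bar R) : measurable_fun setT f -> (forall x, 0 <= f x) ->
  \int[mrestr m mU]_x f x = \int[m]_(x in U) f x.
Proof.
move=> mf f0; have nU : mrestr m mU (~` U) = 0 by rewrite /mrestr setICl measure0.
rewrite (ge0_negligible_integral (measurableC mU) measurableT mf _ nU)// setTD setCK.
apply: eq_measure_integral => A mA AU.
by change (m (A `&` U) = m A); rewrite (setIidl AU).
Qed.

End IntegralTransfer.

Lemma Cb_bounded_comp (R : realType) (X : topologicalType) (T : Type) (G : Cb R X) (f : T -> X)
  (A : set T) : [bounded G (f x) | x in A].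
Proof.
exists (Cb_norm G); split; first exact: num_real.
by move=> M GM x _; apply: le_trans (ltW GM); exact: Cb_norm_ub.
Qed.

Section LocalMeasure.
Variables (R : realType) (d k : nat).
Local Notation V := 'rV[R]_d.
Local Notation H := (Cspace R d k).
Variables (chi : R -> R) (Omega : set V) (phi : V -> R) (h : R) (U : set (borel V)).
Hypotheses (mU : measurable U) (U_pos : (0 < leb U)%E) (U_fin : (leb U < +oo)%E).

Local Notation f := (fun x => to_Cspace k (localized chi Omega phi h x) : borel H).
Hypothesis mf : measurable_fun U f.

(** A default value off [U] makes the map Borel on the whole space; the restricted measure does not
    see it. *)
Let ff : borel V -> borel H := f \_ U.

Let mff : measurable_fun setT ff.
Proof. exact/(measurable_restrictT _ mU). Qed.

Let ffE x : x \in U -> ff x = f x.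
Proof. by move=> xU; rewrite /ff patchE xU. Qed.

Let u := fine (leb U).

Let u_ge0 : 0 <= u^-1.
Proof. by rewrite invr_ge0 fine_ge0. Qed.

Let m0 := mscale (NngNum u_ge0) (mrestr (@leb R d) mU).

Let LME A : measurable A -> LM chi Omega U phi h A = pushforward m0 ff A.
Proof.
move=> mA; rewrite /LM /pushforward /m0 /mscale/= /mrestr; congr (_ * _)%E.
rewrite -(@integral_indic _ _ _ (@leb R d) U mU (ff @^-1` A)); last first.
  by rewrite -[X in measurable X]setTI; exact: mff.
apply: eq_integral => x xU; rewrite diracE indicE /ff; congr (_%:R%:E).
congr nat_of_bool; apply/idP/idP; rewrite !inE => Ax; first by change (A (ff x)); rewrite ffE.
by have := (Ax : A (ff x)); rewrite ffE.
Qed.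

Let integral_m0 (g : borel V -> \bar R) : measurable_fun setT g -> (forall x, (0 <= g x)%E) ->
  (\int[m0]_x g x = (u^-1)%:E * \int[@leb R d]_(x in U) g x)%E.
Proof.
move=> mg g0.
rewrite (@ge0_integral_mscale _ _ _ (mrestr (@leb R d) mU) setT measurableT (NngNum u_ge0) g mg)//.
by rewrite (integral_mrestr _ _ mg).
Qed.

Lemma integrable_Cb_comp (G : Cb R H) : (@leb R d).-integrable U (fun x => (G (f x))%:E).
Proof.
apply: measurable_bounded_integrable => //.
  exact: (measurableT_comp (@measurable_Cb _ _ G) mf).
exact: Cb_bounded_comp.
Qed.

(** By [LME], [LM] is on Borel sets the image of normalized Lebesgue measure on [U], so the change
    of variables formula applies. *)
Lemma LM_integral (G : Cb R H) :
  (\int[LM chi Omega U phi h]_y (G y)%:E = (u^-1)%:E * \int[@leb R d]_(x in U) (G (f x))%:E)%E.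
Proof.
pose g (y : borel H) := (G y)%:E.
have mg : measurable_fun setT g by apply/measurable_EFinP; exact: measurable_Cb.
have mgf := measurableT_comp mg mff.
have m0fin : (m0 setT < +oo)%E.
  rewrite /m0 /mscale/= /mrestr setTI lte_mul_pinfty//.
have ig : m0.-integrable (ff @^-1` setT) (g \o ff).
  rewrite preimage_setT; apply: measurable_bounded_integrable => //.
    exact: (measurableT_comp (@measurable_Cb _ _ G) mff).
  exact: Cb_bounded_comp.
rewrite (eq_set_integral _ LME) (integral_pushforward mff mg ig measurableT) preimage_setT.
rewrite integralE integral_m0//; last exact: measurable_funepos.
rewrite integral_m0//; last exact: measurable_funeneg.
have E1 : (\int[@leb R d]_(x in U) (g \o ff)^\+ x = \int[@leb R d]_(x in U) (fun x => (G (f x))%:E)^\+ x)%E.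
  by apply: eq_integral => x xU; rewrite !funeposE /= ffE.
have E2 : (\int[@leb R d]_(x in U) (g \o ff)^\- x = \int[@leb R d]_(x in U) (fun x => (G (f x))%:E)^\- x)%E.
  by apply: eq_integral => x xU; rewrite !funenegE /= ffE.
rewrite E1 E2 -muleBr//; last exact: integrable_add_def (integrable_Cb_comp G).
by congr (_ * _)%E; rewrite [RHS]integralE.
Qed.

End LocalMeasure.

(** At a cluster point, the tails of the indices and the preimages of neighbourhoods together
    generate a proper filter, and any ultrafilter refining it will do. *)
Lemma cluster_ultra (T : topologicalType) (Y : uniformType) (f : nat -> T -> Y) (nu : {ptws T -> Y}) :
  cluster ((f : nat -> {ptws T -> Y}) @ \oo) nu <->
  exists F : set_system nat, [/\ UltraFilter F, \oo `<=` F & forall t, f n t @[n --> F] --> nu t].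
Proof.
split=> [cl|[F [FU ooF Fnu]]]; last first.
  have : {ptws, (f : nat -> {ptws T -> Y}) @ F --> nu}.
    by apply/pointwise_cvgP => t; exact: Fnu.
  move=> H A B ooA nB; have FB : F (f @^-1` B) := H _ nB.
  have FA : F (f @^-1` A) := ooF _ ooA.
  by have [n [? ?]] := filter_ex (filterI FA FB); exists (f n).
pose D := [set P : set nat * set {ptws T -> Y} | \oo P.1 /\ nbhs nu P.2].
pose W (P : set nat * set {ptws T -> Y}) := P.1 `&` f @^-1` P.2.
have FF : ProperFilter (filter_from D W).
  apply: filter_from_proper; last first.
    move=> [A B] [/= ooA nB].
    have [|_ [[n An <-] Bn]] := cl (f @` A) B _ nB; last by exists n.
    by change (\oo (f @^-1` (f @` A))); apply: filterS ooA => n An; exists n.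
  apply: filter_from_filter; first by exists (setT, setT); split; exact: filterT.
  move=> [A B] [A' B'] [/= a b] [/= a' b']; exists (A `&` A', B `&` B').
    by split; exact: filterI.
  by move=> n [/= [? ?] [? ?]].
have [F [FU sF]] := ultraFilterLemma FF.
exists F; split=> // [A ooA|].
  by apply: sF; exists (A, setT); [split=> //; exact: filterT|move=> n []].
have H : {ptws, (f : nat -> {ptws T -> Y}) @ F --> nu}.
  by move=> B nB; apply: sF; exists (setT, B); [split=> //; exact: filterT|move=> n []].
by move/pointwise_cvgP : H.
Qed.

Section Dini.
Variables (R : realType) (d : nat).

(** If [F m (g m) > e] for every [m], a limit [x] of the points [g m] along an ultrafilter satisfies
    [F n x >= e] for all [n], because [F n] dominates the later functions. *)
Lemma tame_dini C (F : nat -> Cb R (FP R d)) (e : R) : 0 < e ->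
  (forall n x, F n.+1 x <= F n x) -> (forall x, F n x @[n --> \oo] --> 0) ->
  exists m, forall g, tame_space C g -> F m g <= e.
Proof.
move=> e0 Fdec F0; apply: contrapT => nH.
have /choice[g Hg] m : exists g, tame_space C g /\ e < F m g.
  apply: contrapT => nm; apply: nH; exists m => g tg; rewrite leNgt; apply/negP => eg.
  by apply: nm; exists g.
have [U [UU ooU]] := ultraFilterLemma (eventually_filter : ProperFilter (\oo : set_system nat)).
have := @tame_compact R d C; rewrite compact_ultra => Hc.
have [|x [tx gx]] := Hc (g @ U) (fmap_ultra g UU).
  by rewrite /fmap/=; apply: filterS filterT => m _; exact: (Hg m).1.
have Fmono n k y : F (n + k)%N y <= F n y.
  elim: k => [|k IH]; first by rewrite addn0.
  by rewrite addnS; apply: le_trans IH; exact: Fdec.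
have ex n : e <= F n x.
  have H : F n (g m) @[m --> U] --> F n x.
    exact: (@cvg_comp _ _ _ g (F n) _ _ _ gx (@Cb_continuous _ _ (F n) x)).
  rewrite -lerN2; apply: (@cvg_near_le _ _ U _ _ _ _ (cvgN H)).
  have on : \oo [set m | (n <= m)%N] by exists n.
  apply: filterS (ooU _ on) => m nm /=; rewrite lerN2; apply: (le_trans (ltW (Hg m).2)).
  by have := Fmono n (m - n)%N (g m); rewrite subnKC.
have /cvgrPdist_lt/(_ _ e0) := F0 x; case=> n _ /(_ n (leqnn n)) /=.
rewrite sub0r normrN ger0_norm; last exact: le_trans (ltW e0) (ex n).
by rewrite ltNge ex.
Qed.

End Dini.

(** * Limits of means over base points *)

Section Assembly.
Variables (R : realType) (d : nat) (chi : R -> R) (Omega : set 'rV[R]_d).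
Variables (phi : nat -> 'rV[R]_d -> R) (h : nat -> R) (U : set (borel 'rV[R]_d)).
Local Notation V := 'rV[R]_d.
Local Notation FP := (FP R d).
Hypothesis chiP : cutoff chi.
Hypotheses (oO : open Omega) (bO : bounded_set Omega) (d0 : (0 < d)%N).
Hypothesis phi_smooth : forall n, smooth_on Omega (phi n).
Hypothesis h_gt0 : forall n, 0 < h n.
Hypothesis h_cvg0 : h @ \oo --> 0.
Hypothesis phi_eigen : forall n x, Omega x -> - (h n ^+ 2) * laplacian (phi n) x = phi n x.
Hypothesis phi_norm : forall n,
  (\int[@leb R d]_(x in Omega) ((phi n x) ^+ 2)%:E = leb Omega)%E.
Hypotheses (mU : measurable U) (UO : U `<=` Omega) (U_pos : (0 < leb U)%E).

Local Notation loc n x := (localized chi Omega (phi n) (h n) x).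

Let mO : measurable (Omega : set (borel V)).
Proof. exact: sub_sigma_algebra. Qed.

Let O_fin : (leb Omega < +oo)%E.
Proof. exact: leb_bounded. Qed.

Let U_fin : (leb U < +oo)%E.
Proof. by apply: le_lt_trans O_fin; apply: le_measure; rewrite ?inE. Qed.

Let u := fine (leb U).
Let u_gt0 : 0 < u.
Proof. by rewrite fine_gt0// U_pos. Qed.

Let uE : leb U = u%:E.
Proof. by rewrite fineK// ge0_fin_numE. Qed.

Let phi_fin n : (\int[@leb R d]_(x in Omega) ((phi n x) ^+ 2)%:E < +oo)%E.
Proof. by rewrite phi_norm. Qed.

Let mloc k n : measurable_fun U (fun x => to_Cspace k (loc n x) : borel (Cspace R d k)).
Proof.
exact: (@measurable_localized R d chi Omega (phi n) (h n) chiP oO bO d0 (h_gt0 n) (phi_smooth n)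
  (@phi_eigen n) (phi_fin n) k U mU UO).
Qed.

(** [LM_ext] is the mean of an extended function. Arbitrary functions on H^k are allowed, so that
    two extensions can be compared. *)
Definition mean k n (G : Cb R (Cspace R d k)) : R :=
  fine (\int[LM chi Omega U (phi n) (h n)]_y (G y)%:E)%E.

Let ig k n (G : Cb R (Cspace R d k)) :
  (@leb R d).-integrable U (fun x => (G (to_Cspace k (loc n x)))%:E).
Proof. exact: (integrable_Cb_comp mU U_fin (@mloc k n)). Qed.

Let meanE k n (G : Cb R (Cspace R d k)) :
  (\int[@leb R d]_(x in U) (G (to_Cspace k (loc n x)))%:E = (u * mean n G)%:E)%E.
Proof.
rewrite /mean (LM_integral mU U_fin (@mloc k n)) -/u.
have /fineK <- := integrable_fin_num mU (ig n G).
by rewrite -EFinM/= mulrA divff ?mul1r// gt_eqF.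
Qed.

(** Violations for infinitely many n would yield, along an ultrafilter, good points whose localized
    functions converge in both spaces to one tame [g], violating the bound assumed there. *)
Lemma tame_eventually C (B : nat -> set V) k1 k2 (G1 : Cb R (Cspace R d k1)) (G2 : Cb R (Cspace R d k2))
    (c delta : R) :
  (forall r, exists N, forall n x, (N <= n)%N -> Omega x -> ~ B n x -> tame C r (loc n x)) ->
  (forall g, tame_space C g -> G1 (FP_incl k1 g) - G2 (FP_incl k2 g) <= c) -> 0 < delta ->
  \forall n \near \oo, forall x, Omega x -> ~ B n x ->
    G1 (to_Cspace k1 (loc n x)) - G2 (to_Cspace k2 (loc n x)) <= c + delta.
Proof.
move=> good Hc delta0; apply: contrapT => nH.
pose S n := exists x, [/\ Omega x, ~ B n x &
  c + delta < G1 (to_Cspace k1 (loc n x)) - G2 (to_Cspace k2 (loc n x))].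
(* [S] contains arbitrarily large indices, so the tails stay nonempty when restricted to it. *)
have PS : ProperFilter (within S \oo).
  split; last exact: within_filter.
  move=> S0; apply: nH; have {}S0 : \oo [set n | S n -> False] := S0.
  apply: filterS S0 => n nS x Ox nB; rewrite leNgt; apply/negP => Hx.
  by apply: nS; exists x.
have [F [FU sF]] := ultraFilterLemma PS.
have ooF A : \oo A -> F A by move=> ooA; apply: sF; apply: filterS ooA.
have FS : F S by apply: sF; have : \oo [set n | S n -> S n] by apply: filterE => n.
have /choice[x Hx] n : exists x, S n -> [/\ Omega x, ~ B n x &
    c + delta < G1 (to_Cspace k1 (loc n x)) - G2 (to_Cspace k2 (loc n x))].
  by have [[x ?]|nS] := pselect (S n); [exists x|exists 0].
have [r|g [tg cg]] := @tame_cvg R d nat F (fun n => loc n (x n)) C FU.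
  have [N HN] := good r; have oN : \oo [set n | (N <= n)%N] by exists N.
  by apply: filterS2 (ooF _ oN) FS => n Nn /Hx[Ox nB _]; exact: HN.
have FC k : F [set n | C_on k setT (loc n (x n))].
  apply: filterS FS => n /Hx[Ox _ _].
  exact: (localized_smooth chiP oO bO d0 (h_gt0 n) (phi_smooth n) (@phi_eigen n) (phi_fin n) Ox k).
have H k (G : Cb R (Cspace R d k)) : G (to_Cspace k (loc n (x n))) @[n --> F] --> G (FP_incl k g).
  exact: (cvg_comp _ _ (cg k (FC k)) (@Cb_continuous _ _ G _)).
have : c + delta <= G1 (FP_incl k1 g) - G2 (FP_incl k2 g).
  rewrite -lerN2; apply: (@cvg_near_le _ _ F _ _ _ _ (cvgN (cvgB (H _ G1) (H _ G2)))).
  by apply: filterS FS => n /Hx[_ _ Hn] /=; rewrite lerN2 ltW.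
have := Hc g tg; lra.
Qed.

(** Good points contribute at most c + delta by [tame_eventually]. On bad points, of measure at most
    [e], the sup norms are used; [u] is the normalizing volume of [U]. *)
Lemma mean_le C (B : nat -> set (borel V)) k1 k2 (G1 : Cb R (Cspace R d k1)) (G2 : Cb R (Cspace R d k2))
    (e c delta : R) :
  (forall n, measurable (B n)) -> (forall n, (leb (B n) <= e%:E)%E) ->
  (forall r, exists N, forall n x, (N <= n)%N -> Omega x -> ~ B n x -> tame C r (loc n x)) ->
  (forall g, tame_space C g -> G1 (FP_incl k1 g) - G2 (FP_incl k2 g) <= c) ->
  0 <= c -> 0 < delta -> 0 < e ->
  \forall n \near \oo, mean n G1 - mean n G2 <= c + delta + (`|G1| + `|G2|) * e / u.
Proof.
move=> mB lB good Hc c0 delta0 e0.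
apply: filterS (tame_eventually good Hc delta0) => n Hn.
pose M := `|G1| + `|G2|; have M0 : 0 <= M by rewrite addr_ge0.
have cd : 0 <= c + delta by rewrite addr_ge0// ltW.
pose b (x : borel V) : R := c + delta + M * \1_(B n) x.
have ib : (@leb R d).-integrable U (EFin \o b).
  apply: measurable_bounded_integrable => //.
    apply: measurable_funTS; apply: measurable_funD; first exact: measurable_cst.
    apply: measurable_funM; first exact: measurable_cst.
    exact: measurable_indic.
  exists (c + delta + M); split; first exact: num_real.
  move=> M' MM' x _; apply: le_trans (ltW MM').
  have i0 : 0 <= (\1_(B n) x : R) by rewrite indicE.
  rewrite ger0_norm; last by rewrite addr_ge0// mulr_ge0.
  by rewrite lerD2l ler_piMr// indicE; case: (_ \in _).
have : (\int[@leb R d]_(x in U) ((G1 (to_Cspace k1 (loc n x)))%:E - (G2 (to_Cspace k2 (loc n x)))%:E) <=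
  \int[@leb R d]_(x in U) (b x)%:E)%E.
  apply: (le_integral mU _ ib); first exact: (integrableB mU (ig n G1) (ig n G2)).
  move=> x; rewrite inE => Ux; rewrite -EFinB lee_fin /b indicE.
  have [Bx|nBx] := boolP (x \in B n).
    rewrite mulr1; apply: ler_wpDl => //; apply: (le_trans (ler_norm _)).
    by apply: (le_trans (ler_normB _ _)); apply: lerD; exact: Cb_norm_ub.
  by rewrite mulr0 addr0; apply: Hn; [exact: UO|move=> Bx; move: nBx; rewrite mem_set].
rewrite (integralB_EFin mU (ig n G1) (ig n G2)) !meanE -EFinB => H.
have Hb : (\int[@leb R d]_(x in U) (b x)%:E <= ((c + delta) * u + M * e)%:E)%E.
  rewrite /b; under eq_integral do rewrite EFinD EFinM.
  rewrite ge0_integralD//; last 2 first.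
  - by move=> x _; rewrite mule_ge0// lee_fin// indicE.
  - by apply: measurable_funeM; apply/measurable_EFinP; apply: measurable_funTS; exact: measurable_indic.
  have -> : (\int[@leb R d]_(_ in U) (c + delta)%:E = ((c + delta) * u)%:E)%E.
    by rewrite EFinM -uE integral_cst.
  rewrite [leRHS]EFinD; apply: leeD2l.
  rewrite ge0_integralZl//; last first.
    by apply/measurable_EFinP; apply: measurable_funTS; exact: measurable_indic.
  rewrite EFinM lee_wpmul2l ?lee_fin//.
  rewrite (@integral_indic _ _ _ (@leb R d) U mU (B n) (mB n)).
  apply: le_trans (lB n); apply: le_measure; rewrite ?inE//; exact: measurableI.
have := le_trans H Hb; rewrite lee_fin -mulrBr => H2.
rewrite -(ler_pM2l u_gt0); apply: (le_trans H2).
by rewrite [leRHS]mulrDr (mulrC u (_ / u)) divfK ?gt_eqF// mulrC.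
Qed.

Lemma mean0 k n : mean n (0 : Cb R (Cspace R d k)) = 0.
Proof.
have /eqP := meanE n (0 : Cb R (Cspace R d k)).
rewrite integral0_eq// eqe eq_sym mulf_eq0 (gt_eqF u_gt0)/=.
by move=> /eqP.
Qed.

Lemma mean_eventually_le k1 k2 (G1 : Cb R (Cspace R d k1)) (G2 : Cb R (Cspace R d k2)) (e : R) :
  (forall g : FP, G1 (FP_incl k1 g) - G2 (FP_incl k2 g) <= 0) -> 0 < e ->
  \forall n \near \oo, mean n G1 - mean n G2 <= e.
Proof.
move=> H e0; have M0 : 0 < `|G1| + `|G2| + 1 by rewrite ltr_wpDl ?addr_ge0.
have e20 : 0 < e / 2 by rewrite divr_gt0.
(* Bad points then contribute at most e / 2; the 1 avoids a division by zero. *)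
pose e' := e / 2 * u / (`|G1| + `|G2| + 1); have e'0 : 0 < e' by rewrite divr_gt0// mulr_gt0.
have [C [B [mB lB good]]] := good_sets chiP oO bO d0 phi_smooth h_gt0 h_cvg0 phi_eigen phi_norm e'0.
have := mean_le mB lB good (fun g _ => H g) (lexx 0) e20 e'0.
apply: filterS => n /le_trans; apply.
rewrite add0r [leRHS]splitr lerD2l /e' ler_pdivrMr// mulrA ler_pdivrMr// [leRHS]mulrC.
by rewrite ler_wpM2r ?lerDl// mulr_ge0// ltW.
Qed.

Lemma mean_cvg0 k1 k2 (G1 : Cb R (Cspace R d k1)) (G2 : Cb R (Cspace R d k2)) :
  (forall g : FP, G1 (FP_incl k1 g) = G2 (FP_incl k2 g)) ->
  mean n G1 - mean n G2 @[n --> \oo] --> 0.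
Proof.
move=> H; apply/cvgrPdist_le => e e0.
have H1 : \forall n \near \oo, mean n G1 - mean n G2 <= e.
  by apply: mean_eventually_le => // g; rewrite H subrr.
have H2 : \forall n \near \oo, mean n G2 - mean n G1 <= e.
  by apply: mean_eventually_le => // g; rewrite H subrr.
apply: filterS2 H1 H2 => n a b; rewrite sub0r normrN ler_norml; apply/andP; split=> //.
by rewrite -opprB lerN2.
Qed.

Section Accumulation.
Variables (k : nat) (iota : {linear Cb R FP -> Cb R (Cspace R d k)}) (nu : {linear Cb R FP -> R^o}).
Variable F : set_system nat.
Hypotheses (iota_ext : extension_map iota) (FU : UltraFilter F) (ooF : \oo `<=` F).
Hypothesis nuF : forall G, mean n (iota G) @[n --> F] --> (nu G : R).

(** [iota G] may be negative off FP; positivity is recovered in the limit, by comparison with the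
    zero function on FP. *)
Lemma accumulation_ge0 (G : Cb R FP) : (forall x, 0 <= G x) -> 0 <= nu G.
Proof.
have [_ ext _] := iota_ext.
move=> G0; apply/ler_addgt0Pr => e e0; rewrite -lerBlDr sub0r.
have H : \forall n \near \oo, mean n (0 : Cb R (Cspace R d k)) - mean n (iota G) <= e.
  by apply: mean_eventually_le => // g; rewrite ext sub0r lerNl oppr0.
rewrite -lerN2 opprK; apply: (@cvg_near_le _ _ F _ _ _ _ (cvgN (@nuF G))).
by apply: filterS (ooF H) => n /=; rewrite mean0 sub0r.
Qed.

(** Dini's theorem makes [G m] at most e / 4 on the tame functions. Since [iota] is isometric, the
    norm of [iota (G m)] is at most that of [G 0], so the bad sets can be fixed before [m] is
    chosen. *)
Lemma accumulation_sigma (G : nat -> Cb R FP) : (forall n x, 0 <= G n x) ->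
  (forall n x, G n.+1 x <= G n x) -> (forall x, G n x @[n --> \oo] --> 0) ->
  nu (G n) @[n --> \oo] --> 0.
Proof.
have [_ ext isom] := iota_ext.
move=> G0 Gdec Gcvg; apply/cvgrPdist_le => e e0.
have e40 : 0 < e / 4 by rewrite divr_gt0.
have e20 : 0 < e / 2 by rewrite divr_gt0.
have M0 : 0 < `|G 0%N| + 1 by rewrite ltr_wpDl.
pose e' := e / 2 * u / (`|G 0%N| + 1); have e'0 : 0 < e' by rewrite divr_gt0// mulr_gt0.
have [C [B [mB lB good]]] := good_sets chiP oO bO d0 phi_smooth h_gt0 h_cvg0 phi_eigen phi_norm e'0.
have [m Hm] := tame_dini C e40 Gdec Gcvg.
have mono j x : G (m + j)%N x <= G m x.
  elim: j => [|j IH]; first by rewrite addn0.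
  by rewrite addnS; apply: le_trans IH; exact: Gdec.
have Gm0 x : G m x <= G 0%N x.
  by elim: (m) => // j; apply: le_trans; exact: Gdec.
have nG : `|G m| <= `|G 0%N|.
  apply: Cb_norm_le; first exact: normr_ge0.
  move=> x; rewrite ger0_norm//; apply: (le_trans (Gm0 x)).
  by apply: le_trans (Cb_norm_ub (G 0%N) x); exact: ler_norm.
have nuGm : nu (G m) <= e.
  have tm g : tame_space C g -> (iota (G m)) (FP_incl k g) - (0 : Cb R (Cspace R d k)) (FP_incl k g) <= e / 4.
    by move=> tg; rewrite ext subr0; exact: Hm.
  have := mean_le mB lB good tm (ltW e40) e40 e'0.
  move=> /ooF H; apply: (@cvg_near_le _ _ F _ _ _ _ (@nuF (G m))).
  apply: filterS H => n; rewrite mean0 subr0 => /le_trans; apply.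
  rewrite [leRHS](_ : e = e / 4 + e / 4 + e / 2); last by field.
  rewrite lerD2l normr0 addr0 isom /e' ler_pdivrMr// mulrA ler_pdivrMr// [leRHS]mulrC.
  rewrite ler_wpM2r ?(mulr_ge0 (ltW e20) (ltW u_gt0))//.
  by apply: (le_trans nG); rewrite lerDl.
exists m => // n /= mn; rewrite sub0r normrN ger0_norm; last exact: accumulation_ge0.
apply: le_trans nuGm; rewrite -subr_ge0 -linearB; apply: accumulation_ge0 => x.
by rewrite CbB subr_ge0 -(subnKC mn).
Qed.

Lemma accumulation_signed_measure : signed_measures nu.
Proof.
have [mu Hmu] := daniell (@FP_cozero R d) accumulation_ge0 accumulation_sigma.
(* The measure is positive, so the whole space is its positive part and its negative variation is
   zero. *)
have PN : hahn_decomposition (charge_of_finite_measure mu) setT set0.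
  split; rewrite ?setU0 ?setI0//.
  by split=> // A mA; rewrite subset0 => ->; rewrite charge0.
exists (charge_of_finite_measure mu), setT, set0, PN => G; rewrite Hmu.
have -> : (\int[jordan_pos PN]_x (G x)%:E = \int[mu]_x (G x)%:E)%E.
  apply: eq_set_integral => A mA.
  by rewrite jordan_posE cjordan_posE /crestr0 mem_set// /crestr setIT.
have -> : (\int[jordan_neg PN]_x (G x)%:E = 0)%E.
  rewrite -(@integral_measure_zero _ _ _ setT (fun x : borel FP => (G x)%:E)).
  apply: eq_set_integral => A mA.
  by rewrite jordan_negE cjordan_negE /crestr0 mem_set// /crestr setI0 charge0 oppe0.
by rewrite sube0.
Qed.

End Accumulation.

End Assembly.

(** In dimension 0 the Laplacian is an empty sum, so the equation forces phi = 0 and the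
    normalization gives [Omega] measure 0. *)
Lemma eigenfunction_dim_gt0 (R : realType) d (Omega : set 'rV[R]_d) (phi : 'rV[R]_d -> R) (h : R)
    (U : set (borel 'rV[R]_d)) :
  open Omega -> (forall x, Omega x -> - (h ^+ 2) * laplacian phi x = phi x) ->
  (\int[@leb R d]_(x in Omega) ((phi x) ^+ 2)%:E = leb Omega)%E ->
  measurable U -> U `<=` Omega -> (0 < leb U)%E -> (0 < d)%N.
Proof.
move=> oO eigen norm mU UO; apply: contraTltn; rewrite leqn0 => /eqP d0; rewrite -leNgt.
have phi0 x : Omega x -> phi x = 0.
  move=> /eigen <-; rewrite /laplacian big1 ?mulr0// => i.
  by have := ltn_ord i; rewrite [X in (_ < X)%N]d0.
apply: (@le_trans _ _ (leb Omega)).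
  by apply: le_measure; rewrite ?inE//; exact: sub_sigma_algebra.
rewrite -norm integral0_eq// => x Ox.
by rewrite phi0// expr0n.
Qed.

Lemma cvg_difference0 (R : realType) (T : Type) (F : set_system T) {FF : Filter F} (f g : T -> R) (l : R) :
  f @ F --> l -> g t - f t @[t --> F] --> 0 -> g @ F --> l.
Proof.
move=> fl gf; have H := cvgD fl gf; rewrite addr0 in H.
have <- : f + (fun t => g t - f t) = g by apply/funext => t; rewrite fctE addrC subrK.
exact: H.
Qed.

Theorem corollary2 (R : realType) (d : nat) (chi : R -> R)
  (Omega : set 'rV[R]_d) (phi : nat -> 'rV[R]_d -> R) (h : nat -> R)
  (U : set (borel 'rV[R]_d))
  (chi_cutoff : cutoff chi)
  (Omega_open : open Omega) (Omega_bounded : bounded_set Omega)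
  (phi_smooth : forall n, smooth_on Omega (phi n))
  (h_gt0 : forall n, 0 < h n) (h_cvg0 : h @ \oo --> 0)
  (phi_eigen : forall n x, Omega x ->
     - (h n ^+ 2) * laplacian (phi n) x = phi n x)
  (phi_dirichlet : forall n, dirichlet Omega (phi n))
  (phi_norm : forall n,
     (\int[@leb R d]_(x in Omega) ((phi n x) ^+ 2)%:E = leb Omega)%E)
  (U_borel : measurable U) (U_sub : U `<=` Omega) (U_pos : (0 < leb U)%E) :
  (forall (k : nat) (iota : {linear Cb R (FP R d) -> Cb R (Cspace R d k)})
     (nu : {linear Cb R (FP R d) -> R^o}),
     extension_map iota -> acc_points chi Omega U phi h iota nu ->
     signed_measures nu /\
     forall (k' : nat) (iota' : {linear Cb R (FP R d) -> Cb R (Cspace R d k')}),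
       extension_map iota' -> acc_points chi Omega U phi h iota' nu) /\
  (forall (F : Cb R (FP R d)) (k1 k2 : nat)
     (iota1 : {linear Cb R (FP R d) -> Cb R (Cspace R d k1)})
     (iota2 : {linear Cb R (FP R d) -> Cb R (Cspace R d k2)}),
     extension_map iota1 -> extension_map iota2 ->
     let u1 := fun n => LM_ext chi Omega U (phi n) (h n) iota1 F in
     let u2 := fun n => LM_ext chi Omega U (phi n) (h n) iota2 F in
     (cvgn u1 <-> cvgn u2) /\ (cvgn u1 -> limn u1 = limn u2)).

Proof.
have d0 : (0 < d)%N.
  exact: eigenfunction_dim_gt0 Omega_open (phi_eigen 0%N) (phi_norm 0%N) U_borel U_sub U_pos.
pose m k n (G : Cb R (Cspace R d k)) := mean chi Omega phi h U n G.
(* Two extensions of [G] agree on FP, so [mean_cvg0] applies to them even in different spaces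
   H^k. *)
have diff (G : Cb R (FP R d)) k k' (iota : {linear Cb R (FP R d) -> Cb R (Cspace R d k)})
    (iota' : {linear Cb R (FP R d) -> Cb R (Cspace R d k')}) :
    extension_map iota -> extension_map iota' -> m k' n (iota' G) - m k n (iota G) @[n --> \oo] --> 0.
  move=> [_ ext _] [_ ext' _].
  apply: (mean_cvg0 chi_cutoff Omega_open Omega_bounded d0 phi_smooth h_gt0 h_cvg0 phi_eigen
    phi_norm U_borel U_sub U_pos) => g.
  by rewrite ext ext'.
split=> [k iota nu ext [cnu /cluster_ultra[F [FU ooF nuF]]]|G k1 k2 iota1 iota2 ext1 ext2].
  split.
    exact: (accumulation_signed_measure chi_cutoff Omega_open Omega_bounded d0 phi_smooth h_gt0
      h_cvg0 phi_eigen phi_norm U_borel U_sub U_pos ext FU ooF nuF).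
  (* The ultrafilter that yields [nu] for [iota] yields it for [iota'] too: the difference of the
     means tends to 0 along all n, hence along [F]. *)
  move=> k' iota' ext'; split=> //; apply/cluster_ultra; exists F; split=> // G.
  have H0 : m k' n (iota' G) - m k n (iota G) @[n --> F] --> 0.
    by move=> A /(diff G _ _ _ _ ext ext'); exact: ooF.
  exact: (cvg_difference0 (nuF G) H0).
have H12 := diff G _ _ _ _ ext1 ext2; have H21 := diff G _ _ _ _ ext2 ext1.
move=> u1 u2.
have to2 (l : R) : u1 @ \oo --> l -> u2 @ \oo --> l by move=> H; exact: cvg_difference0 H H12.
have to1 (l : R) : u2 @ \oo --> l -> u1 @ \oo --> l by move=> H; exact: cvg_difference0 H H21.
split=> [|/cvg_ex[l ul]].
  by split=> /cvg_ex[l ul]; apply/cvg_ex; exists l; [exact: to2|exact: to1].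
by rewrite (cvg_lim _ ul)// (cvg_lim _ (to2 _ ul)).
Qed.
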